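(* Let $-\infty<a<b<\infty$ and $x\in[a,b]$, and let $X^Z$ be the diffusion started at $x$ and controlled by the reflecting barrier policy $Z=(U^a,D^b)$. Then $$\lim_{T\to\infty}\frac1T\,\mathbb{E}_x\int_0^T\left(c(X^Z_s)\,ds+q_u\,dU^a_s+q_d\,dD^b_s\right)=C(a,b),$$ where $$C(a,b)=\frac{1}{m(a,b)}\left[\int_a^b c(t)m'(t)\,dt+\frac{q_u}{S'(a)}+\frac{q_d}{S'(b)}\right].$$ Consequently, if there exists a pair $a^\ast<b^\ast$ minimizing the expected long-run average cumulative costs $C(a,b)$ over all $-\infty<a<b<\infty$, then it satisfies the first order conditions $$C(a^\ast,b^\ast)=\pi_2(a^\ast),\qquad C(a^\ast,b^\ast)=\pi_1(b^\ast),$$ which can be re-expressed as (i.e. this pair of equations is equivalent to the pair) $$\int_{a^\ast}^{b^\ast}(\pi_1(t)-\pi_1(b^\ast))m'(t)\,dt+\frac{q_d+q_u}{S'(a^\ast)}=0,\qquad \int_{a^\ast}^{b^\ast}(\pi_2(t)-\pi_2(a^\ast))m'(t)\,dt+\frac{q_d+q_u}{S'(b^\ast)}=0.$$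
   Context: Setting. $W$ is a standard Brownian motion on a complete filtered probability space. The controlled process on $\mathbb{R}$ satisfies (in the weak sense) $$dX^Z_t=\mu(X^Z_t)\,dt+\sigma(X^Z_t)\,dW_t+dU_t-dD_t,\qquad X^Z_0=x,$$ where $\mu:\mathbb{R}\to\mathbb{R}$ is continuous, $\sigma:\mathbb{R}\to[0,\infty)$ is continuous with $\sigma^2(x)>0$ for all $x$, $(1+|\mu|)/\sigma^2$ is locally integrable, and the control $Z=(U,D)$ consists of non-negative, non-decreasing, right-continuous adapted processes. Reflecting barrier policy: for $a<b$, $Z=(U^a,D^b)$ is the policy that keeps $X^Z$ in $[a,b]$, with $U^a$, $D^b$ continuous on $t>0$ and increasing only when $X^Z_t=a$, respectively $X^Z_t=b$ (two-sided Skorokhod reflection at $a$ and $b$). Notation. $S'(x)=\exp\left(-\int_{x_0}^x\frac{2\mu(y)}{\sigma^2(y)}dy\right)$ (for an arbitrary fixed $x_0$) is the scale density, $m'(x)=\frac{2}{\sigma^2(x)S'(x)}$ the speed density, and $m(a,b)=\int_a^b m'(t)\,dt$. Costs. $c:\mathbb{R}\to[0,\infty)$ is continuous with $c(x)\ge c(0)\ge 0$ for all $x$; $q_u,q_d\ge0$ are constants. Put $\pi_1(x)=c(x)+q_d\mu(x)$ and $\pi_2(x)=c(x)-q_u\mu(x)$. Standing assumptions: (i) for $i=1,2$ there is a unique minimizer $\hat x_i\in\mathbb{R}$ of $\pi_i$, and $\pi_i$ is (strictly) decreasing on $(-\infty,\hat x_i)$ and (strictly) increasing on $(\hat x_i,\infty)$;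 (ii) $\lim_{x\uparrow\infty}\pi_1(x)=\lim_{x\downarrow-\infty}\pi_2(x)=\infty$. *)

(* Defs.v *)
From HB Require Import structures.
From mathcomp Require Import all_boot all_order all_algebra.
From mathcomp Require Import all_classical all_reals all_analysis.
Set Implicit Arguments.
Unset Strict Implicit.
Unset Printing Implicit Defensive.
Import Order.TTheory GRing.Theory Num.Theory.
Import numFieldNormedType.Exports.
Local Open Scope classical_set_scope.
Local Open Scope ring_scope.

(* Time is the half-line [0, +oo[: processes are indexed by R, but only their
   values at times t >= 0 are ever constrained, except for the controls, whose
   value at negative times encodes the left limit at 0 (see below). *)

Section stochastic_basis.
Context {R : realType} {d : measure_display} {Omega : measurableType d}.
Implicit Types (P : probability Omega R) (F : R -> set (set Omega)).
Implicit Types (X W H M : R -> Omega -> R) (U D : Omega -> cumulative R R).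

Definition measurable_wrt (G : set (set Omega)) (Y : Omega -> R) :=
  forall B : set R, measurable B -> G (Y @^-1` B).

Definition complete_filtration P F :=
  [/\ measure_is_complete P,
      forall t : R, 0 <= t -> sigma_algebra setT (F t) /\ F t `<=` measurable,
      forall s t : R, 0 <= s -> s <= t -> F s `<=` F t &
      P.-negligible `<=` F 0].

Definition adapted F X := forall t : R, 0 <= t -> measurable_wrt (F t) (X t).

Definition progressive F X := forall t : R, 0 <= t ->
  measurable_fun
    (`[0, t] `*` setT : set (R * g_sigma_algebraType (F t)))
    (fun p : R * g_sigma_algebraType (F t) => X p.1 p.2).

Definition ae_continuous P X :=
  {ae P, forall w, {within `[0, +oo[, continuous (X ^~ w)}}.

Definition brownian_motion P F W :=
  [/\ adapted F W,
      {ae P, forall w, W 0 w = 0},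
      ae_continuous P W,
      forall s t : R, 0 <= s -> s < t -> forall (A : set Omega) (B : set R),
        F s A -> measurable B ->
        P (A `&` [set w | B (W t w - W s w)]) =
        (P A * P [set w | B (W t w - W s w)%R])%E &
      forall s t : R, 0 <= s -> s < t -> forall B : set R, measurable B ->
        P [set w | B (W t w - W s w)] = normal_prob 0 (Num.sqrt (t - s)) B].

Definition cvg_in_probability0 P (Y : nat -> Omega -> \bar R) :=
  forall e : R, 0 < e ->
    P [set w | (e%:E < `|Y n w|)%E] @[n --> \oo] --> 0%E.

Record simple_process := SimpleProcess {
  sp_size : nat;
  sp_time : nat -> R;
  sp_val : nat -> Omega -> R }.

Definition simple_predictable F (phi : simple_process) :=
  [/\ 0 <= sp_time phi 0,
      forall i, sp_time phi i <= sp_time phi i.+1,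
      forall i, measurable_wrt (F (sp_time phi i)) (sp_val phi i) &
      exists K : R, forall i w, `|sp_val phi i w| <= K].

Definition simple_eval (phi : simple_process) (s : R) (w : Omega) : R :=
  \sum_(i < sp_size phi)
    sp_val phi i w * \1_`]sp_time phi i, sp_time phi i.+1] s.

Definition simple_integral W (phi : simple_process) (t : R) (w : Omega) : R :=
  \sum_(i < sp_size phi) sp_val phi i w *
    (W (Num.min t (sp_time phi i.+1)) w - W (Num.min t (sp_time phi i)) w).

(* M_t = \int_0^t H_s dW_s: the continuous adapted process which is the limit
   in probability of the integrals of simple predictable processes that
   approximate H in L^2([0, T], ds), in probability, for every T. *)
Definition ito_integral P F W H M :=
  [/\ progressive F H,
      forall T : R, 0 <= T -> {ae P, forall w,
        (\int[lebesgue_measure]_(s in `[0%R, T]) (H s w ^+ 2)%:E < +oo)%E},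
      adapted F M,
      ae_continuous P M &
      exists phi : nat -> simple_process,
        [/\ forall n, simple_predictable F (phi n),
            forall T : R, 0 <= T -> cvg_in_probability0 P (fun n w =>
              \int[lebesgue_measure]_(s in `[0%R, T])
                ((simple_eval (phi n) s w - H s w) ^+ 2)%:E)%E &
            forall t : R, 0 <= t -> cvg_in_probability0 P (fun n w =>
              (simple_integral W (phi n) t w - M t w)%:E)]].

(* A control is given by paths in [cumulative R R], i.e. nondecreasing
   right-continuous functions on the whole line; they vanish at negative times,
   so that they are nonnegative and the Lebesgue-Stieltjes measure of a path on
   [0, T] includes the mass of a possible initial jump. Accordingly the
   starting point x is the value of the controlled process just before 0. *)
Definition control F U :=
  (forall (w : Omega) (t : R), t < 0 -> U w t = 0) /\ adapted F (fun t w => U w t).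

Definition controlled_diffusion P F W (mu sigma : R -> R) (x : R) X U D :=
  [/\ adapted F X,
      forall (w : Omega) (t : R), 0 <= t -> X s w @[s --> t^'+] --> X t w,
      control F U /\ control F D,
      {ae P, forall w, forall t : R, 0 <= t ->
        lebesgue_measure.-integrable `[0, t] (fun s => (mu (X s w))%:E)} &
      exists2 M, ito_integral P F W (fun s w => sigma (X s w)) M &
        {ae P, forall w, forall t : R, 0 <= t ->
          X t w = x + \int[lebesgue_measure]_(s in `[0, t]) mu (X s w)
                  + M t w + U w t - D w t}].

Definition reflecting_barrier P (a b : R) X U D :=
  {ae P, forall w,
    [/\ forall t : R, 0 <= t -> a <= X t w <= b,
        forall t : R, 0 < t -> {for t, continuous (U w)},
        forall t : R, 0 < t -> {for t, continuous (D w)},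
        lebesgue_stieltjes_measure (U w)
          [set t | 0 <= t /\ X t w <> a] = 0%E &
        lebesgue_stieltjes_measure (D w)
          [set t | 0 <= t /\ X t w <> b] = 0%E]}.

Definition expected_cost P (c : R -> R) (qu qd : R) X U D (T : R) : \bar R :=
  (\int[P]_w
    (\int[lebesgue_measure]_(s in `[0%R, T]) (c (X s w))%:E
     + \int[lebesgue_stieltjes_measure (U w)]_(s in `[0%R, T]) qu%:E
     + \int[lebesgue_stieltjes_measure (D w)]_(s in `[0%R, T]) qd%:E))%E.

End stochastic_basis.

Section diffusion_characteristics.
Context {R : realType}.
Implicit Types (mu sigma c : R -> R).

(* \int_a^b with the usual sign convention when b < a *)
Definition oriented_integral (f : R -> R) (a b : R) : R :=
  if a <= b then \int[lebesgue_measure]_(y in `[a, b]) f y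
  else - \int[lebesgue_measure]_(y in `[b, a]) f y.

Definition scale_density mu sigma (x0 x : R) : R :=
  expR (- oriented_integral (fun y => 2 * mu y / sigma y ^+ 2) x0 x).

Definition speed_density mu sigma (x0 x : R) : R :=
  2 / (sigma x ^+ 2 * scale_density mu sigma x0 x).

Definition speed_measure mu sigma (x0 a b : R) : R :=
  \int[lebesgue_measure]_(t in `[a, b]) speed_density mu sigma x0 t.

Definition long_run_cost mu sigma c (qu qd x0 a b : R) : R :=
  (speed_measure mu sigma x0 a b)^-1 *
  (\int[lebesgue_measure]_(t in `[a, b]) (c t * speed_density mu sigma x0 t)
   + qu / scale_density mu sigma x0 a + qd / scale_density mu sigma x0 b).

Definition pi1 mu c (qd x : R) : R := c x + qd * mu x.
Definition pi2 mu c (qu x : R) : R := c x - qu * mu x.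

Definition unimodal (f : R -> R) :=
  exists xhat : R,
    [/\ forall x, x <> xhat -> f xhat < f x,
        {in `]-oo, xhat[ &, forall x y, x < y -> f y < f x} &
        {in `]xhat, +oo[ &, forall x y, x < y -> f x < f y}].

End diffusion_characteristics.

(* Main.v *)
(* Let h solve sigma^2 h'' / 2 + mu h' + c = C on [a, b], with C = C(a, b),
   h'(a) = - q_u and h'(b) = q_d: the value C is exactly the one for which both
   boundary conditions can hold.  Ito's formula gives
     E(cost on [0, T]) = C T - E h(X_T) + h(x),
   and h is bounded on [a, b], so dividing by T gives the limit.

   Ito's formula is obtained from a second order Taylor expansion of h along the
   grid i T / (n + 1).  Write A = X - M = B + U - D with B the drift part, and
   V = U + D.  The i-th step is weighted by the F_(t_i)-measurable indicator of
   V_(t_i) <= N, which makes the sums of h' dM and of h'' (dM^2 - sigma^2 dt) / 2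
   have mean zero while the total variation of A stays bounded, up to the last
   step.  Only E dM^4 <= 3 K^4 dt^2 is needed to control the errors.  When
   n -> oo one obtains Ito's formula up to C P(V_T > N); letting N -> oo gives
   first the integrability of V_T, by monotone convergence, and then equality.

   The moments of M follow from those of step integrals, which are Gaussian
   computations: the approximating simple processes are clamped to [-K, K], and
   convergence in probability with bounded fourth moments is convergence in L^2.

   The first order conditions are C' = 0 for N(y) - C m(y), where
   C(a, y) = N(y) / m(y), and their integrated form comes from the identity
   (1 / S')' = mu m'. *)
Require Import Defs.
From HB Require Import structures.
From mathcomp Require Import all_boot all_order all_algebra.
From mathcomp Require Import all_classical all_reals all_analysis.
From mathcomp Require Import measurable_realfun ring lra.
Set Implicit Arguments.
Unset Strict Implicit.
Unset Printing Implicit Defensive.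
Import Order.TTheory GRing.Theory Num.Theory.
Import numFieldNormedType.Exports.
Local Open Scope classical_set_scope.
Local Open Scope ring_scope.

(** * Expectations and convergence in probability *)

(** Nothing controls $V_T$ a priori, so the integrability of the pushing has to come out of Ito's
    formula itself. This is why the formula is first proved as two one-sided inequalities: on $V_T >
    N$ the weights stop the discrete sum at an uncontrolled place, but there $h' dA$ is a bounded
    drift part plus $-q_u dU - q_d dD$ up to a small error, and the pushing part has a sign. Since
    $X$ stays in $[a,b]$, the integrand $\sigma(X)$ is bounded by some $K$, and increments of $M$
    have fourth moments of order $dt^2$, so that their sum over $n + 1$ steps is of order $1/n$. The
    same quartic quantity pays for Taylor's remainder: $h$ is only $C^2$, and pairs of points that
    are not close are charged to a term $C (z - y)^4$. Reflection, boundedness and the integral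
    equation hold almost surely only. Truncating $X$ to $[a,b]$ and the integrand to $[-K,K]$ gives
    versions that are bounded for every $\omega$, adapted or measurable as before, and unchanged at
    nonnegative times off a null set. *)

Section expectation.
Context {R : realType} {d : measure_display} {T : measurableType d}.
Variable P : probability T R.
Implicit Types f g : T -> R.

Local Notation L1 f := (P.-integrable setT (EFin \o f)).
Local Notation "'E[' f ]" := (Rintegral P setT f).

Lemma integrable_measurable f : L1 f -> measurable_fun setT f.
Proof. by move/(measurable_int P)/measurable_EFinP. Qed.

Lemma integrable_rvD f g : L1 f -> L1 g -> L1 (fun w => f w + g w).
Proof. by move=> lf lg; have := integrableD measurableT lf lg. Qed.

Lemma integrable_rvZ (k : R) f : L1 f -> L1 (fun w => k * f w).
Proof. by move=> lf; have := integrableZl measurableT k lf. Qed.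

Lemma integrable_rvN f : L1 f -> L1 (fun w => - f w).
Proof. by move=> lf; have := integrableN lf. Qed.

Lemma integrable_rvB f g : L1 f -> L1 g -> L1 (fun w => f w - g w).
Proof. by move=> lf lg; have := integrable_rvD lf (integrable_rvN lg). Qed.

Lemma integrable_rv_cst (k : R) : L1 (fun=> k).
Proof. exact: finite_measure_integrable_cst. Qed.

Lemma integrable_rv_norm f : L1 f -> L1 (fun w => `|f w|).
Proof. by move=> lf; have := integrable_norm lf. Qed.

Lemma integrable_rv_sum n (F : 'I_n -> T -> R) :
  (forall i, L1 (F i)) -> L1 (fun w => \sum_(i < n) F i w).
Proof.
elim: n F => [|n IH] F LF.
  apply: (@eq_integrable _ _ _ _ _ measurableT (EFin \o (fun=> 0)));
    last exact: integrable_rv_cst.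
  by move=> w _ /=; rewrite big_ord0.
apply: (@eq_integrable _ _ _ _ _ measurableT
   (EFin \o (fun w => \sum_(i < n) F (widen_ord (leqnSn n) i) w + F ord_max w))).
  by move=> w _ /=; rewrite big_ord_recr.
by apply: integrable_rvD => //; apply: IH.
Qed.

Lemma integrable_rv_le f g : measurable_fun setT f ->
  (forall w, `|f w| <= g w) -> L1 g -> L1 f.
Proof.
move=> mf fg lg; apply: (le_integrable measurableT _ _ lg).
  exact/measurable_EFinP.
by move=> w _ /=; rewrite lee_fin (le_trans (fg w))// ler_norm.
Qed.

Lemma integrable_rv_bounded f (K : R) : measurable_fun setT f ->
  (forall w, `|f w| <= K) -> L1 f.
Proof. by move=> mf fK; exact: (integrable_rv_le mf fK (integrable_rv_cst K)). Qed.

Lemma integrable_rvMb f g (K : R) : measurable_fun setT f ->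
  (forall w, `|f w| <= K) -> L1 g -> L1 (fun w => f w * g w).
Proof.
move=> mf fK lg.
apply: (@integrable_rv_le _ (fun w => K * `|g w|)).
- by apply: measurable_funM => //; exact: integrable_measurable.
- by move=> w; rewrite normrM ler_wpM2r.
- exact/integrable_rvZ/integrable_rv_norm.
Qed.

Lemma expectD f g : L1 f -> L1 g -> E[fun w => f w + g w] = E[f] + E[g].
Proof. by move=> lf lg; rewrite RintegralD. Qed.

Lemma expectB f g : L1 f -> L1 g -> E[fun w => f w - g w] = E[f] - E[g].
Proof. by move=> lf lg; rewrite RintegralB. Qed.

Lemma expectZ k f : L1 f -> E[fun w => k * f w] = k * E[f].
Proof. by move=> lf; rewrite RintegralZl. Qed.

Lemma expect_cst k : E[fun=> k] = k.
Proof.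
by rewrite Rintegral_cst// [X in fine X](_ : _ = 1%E) ?mulr1//; exact: probability_setT.
Qed.

Lemma expect_sum n (F : 'I_n -> T -> R) : (forall i, L1 (F i)) ->
  E[fun w => \sum_(i < n) F i w] = \sum_(i < n) E[F i].
Proof.
elim: n F => [|n IH] F LF.
  rewrite big_ord0 -[RHS](expect_cst 0); apply: eq_Rintegral => w _.
  by rewrite big_ord0.
rewrite big_ord_recr/= -IH//.
rewrite -expectD//; last exact: integrable_rv_sum.
by apply: eq_Rintegral => w _; rewrite big_ord_recr.
Qed.

Lemma expect_eq_ae f g : measurable_fun setT f -> measurable_fun setT g ->
  {ae P, forall w, f w = g w} -> E[f] = E[g].
Proof.
move=> mf mg fg; congr fine; apply: ae_eq_integral => //;
  [exact/measurable_EFinP|exact/measurable_EFinP|].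
by apply: filterS fg => w fgw _ /=; rewrite fgw.
Qed.

Lemma expect_ge0_ae f : measurable_fun setT f ->
  {ae P, forall w, 0 <= f w} -> 0 <= E[f].
Proof.
move=> mf f0.
rewrite (@expect_eq_ae f (fun w => Num.max (f w) 0))//.
- by apply: Rintegral_ge0 => w _; rewrite le_max lexx orbT.
- exact: measurable_maxr.
- by apply: filterS f0 => w fw; rewrite max_l.
Qed.

Lemma expect_le_ae f g : L1 f -> L1 g ->
  {ae P, forall w, f w <= g w} -> E[f] <= E[g].
Proof.
move=> lf lg fg; rewrite -subr_ge0 -expectB//; apply: expect_ge0_ae.
  exact: (integrable_measurable (integrable_rvB lg lf)).
by apply: filterS fg => w; rewrite subr_ge0.
Qed.

Lemma expect_le f g : L1 f -> L1 g -> (forall w, f w <= g w) -> E[f] <= E[g].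
Proof. by move=> lf lg fg; apply: expect_le_ae => //; exact: aeW. Qed.

Lemma expect_norm_le f g : L1 f -> L1 g -> {ae P, forall w, `|f w| <= g w} ->
  `|E[f]| <= E[g].
Proof.
move=> lf lg fg; apply: le_trans (_ : E[fun w => `|f w|] <= _).
  exact: le_normr_Rintegral.
by apply: expect_le_ae => //; exact: integrable_rv_norm.
Qed.

Lemma bounded_convergence (f_ : nat -> T -> R) f (K : R) :
  (forall n, measurable_fun setT (f_ n)) -> measurable_fun setT f ->
  (forall n w, `|f_ n w| <= K) ->
  {ae P, forall w, f_ n w @[n --> \oo] --> f w} ->
  E[f_ n] @[n --> \oo] --> E[f].
Proof.
move=> mf_ mf fK ff.
have ff' : \forall w \ae P, setT w ->
    (fun n => EFin (f_ n w)) @ \oo --> (EFin \o f) w.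
  by apply: filterS ff => w fw _; apply: cvg_EFin fw; exact: nearW.
have fK' : \forall w \ae P, forall n, setT w -> (`|(EFin \o f_ n) w| <= K%:E)%E.
  by apply: aeW => w n _; rewrite lee_fin.
have [lf _ cf] := dominated_convergence measurableT
  (fun n => (measurable_EFinP _ _).2 (mf_ n)) ((measurable_EFinP _ _).2 mf)
  ff' (integrable_rv_cst K) fK'.
apply: fine_cvg; rewrite fineK//.
exact: integrable_fin_num.
Qed.

Definition cvg_prob0 (Y : nat -> T -> R) :=
  forall e : R, 0 < e -> P [set w | e < `|Y n w|] @[n --> \oo] --> 0%E.

Lemma measurable_gt_norm f (e : R) : measurable_fun setT f ->
  measurable [set w | e < `|f w|].
Proof.
move=> mf; have mnf : measurable_fun setT (fun w => `|f w|) by exact: measurableT_comp.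
rewrite (_ : [set w | _] = setT `&` (fun w => `|f w|) @^-1` `]e, +oo[%classic).
  exact: mnf.
by rewrite setTI; apply/seteqP; split=> w /=; rewrite in_itv/= andbT.
Qed.

Lemma expect_indic (A : set T) : measurable A -> E[\1_A] = fine (P A).
Proof. by move=> mA; rewrite /Rintegral integral_indic// setIT. Qed.

Lemma integrable_rv_indic (A : set T) : measurable A -> L1 (\1_A : T -> R).
Proof. exact: integrable_indic. Qed.

(** Bounded second moments make the sequence uniformly integrable: completing the square gives
    [|y| <= l * y ^+ 2 + (4 * l)^-1], where the constant is charged only to the event
    [|y| > e / 4]. *)
Lemma cvg_prob0_expect_norm (Y : nat -> T -> R) (C : R) :
  (forall n, L1 (fun w => Y n w ^+ 2)) -> (forall n, measurable_fun setT (Y n)) ->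
  (forall n, E[fun w => Y n w ^+ 2] <= C) ->
  cvg_prob0 Y -> E[fun w => `|Y n w|] @[n --> \oo] --> 0.
Proof.
move=> L2 mY YC Y0; apply/cvgrPdist_le => /= e e0.
have C0 : 0 <= C by apply: le_trans (YC 0); apply: Rintegral_ge0 => w _; exact: sqr_ge0.
(* [l] makes [l * C] at most [e / 4]; once [P A <= l * e], the term [(4 * l)^-1 * P A] is at most
   [e / 4] too, so the three parts stay below [e]. *)
pose l := e / 4 / (C + 1).
have l0 : 0 < l by rewrite !divr_gt0// ltr_wpDl.
have PY : \forall n \near \oo, fine (P [set w | e / 4 < `|Y n w|]) <= l * e.
  have /cvgrPdist_le/(_ _ (mulr_gt0 l0 e0)) :
    fine (P [set w | e / 4 < `|Y n w|]) @[n --> \oo] --> 0.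
    by apply: fine_cvg; apply: Y0; rewrite divr_gt0.
  by apply: filterS => n; rewrite sub0r normrN ger0_norm ?fine_ge0.
apply: filterS PY => n PA.
rewrite sub0r normrN ger0_norm; last by apply: Rintegral_ge0.
pose A := [set w | e / 4 < `|Y n w|].
have mA : measurable A by exact: measurable_gt_norm.
rewrite -/A in PA.
have H w : `|Y n w| <= e / 4 + (l * Y n w ^+ 2 + (4 * l)^-1 * \1_A w).
  rewrite indicE; case: (boolP (w \in A)) => [|/negP].
    rewrite inE /A/= mulr1 => _.
    have -> : (4 * l)^-1 = (l / 4) * l^-1 ^+ 2 by field; lra.
    have := sqr_ge0 (`|Y n w| - (2 * l)^-1) => /(mulr_ge0 (ltW l0)).
    rewrite -(real_normK (num_real (Y n w))).
    have -> : l * (`|Y n w| - (2 * l)^-1) ^+ 2 = l * `|Y n w| ^+ 2 - `|Y n w| + (l / 4) * l^-1 ^+ 2.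
      by field; lra.
    by lra.
  rewrite inE /A/= => /negP; rewrite -leNgt => YA.
  by rewrite mulr0 addr0 ler_wpDr// mulr_ge0 ?sqr_ge0// ltW.
have L3 : L1 (fun w => l * Y n w ^+ 2 + (4 * l)^-1 * \1_A w).
  by apply: integrable_rvD; apply: integrable_rvZ => //; exact: integrable_rv_indic.
apply: le_trans (_ : E[fun w => e / 4 + (l * Y n w ^+ 2 + (4 * l)^-1 * \1_A w)] <= _).
  apply: expect_le => //.
    apply: (integrable_rv_le _ _ (integrable_rvD (integrable_rv_cst (e / 4)) L3)).
      exact: measurableT_comp.
    by move=> w; rewrite normr_id H.
  by apply: integrable_rvD => //; exact: integrable_rv_cst.
rewrite expectD ?expect_cst//; last exact: integrable_rv_cst.
rewrite expectD ?expectZ ?expect_indic//; last 3 first.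
- exact: integrable_rv_indic.
- exact: integrable_rvZ.
- by apply: integrable_rvZ; exact: integrable_rv_indic.
have : l * E[fun w => Y n w ^+ 2] <= e / 4.
  rewrite (le_trans (ler_wpM2l (ltW l0) (YC n)))// /l.
  have C1 : 0 < C + 1 by rewrite ltr_wpDl.
  by rewrite mulrAC ler_pdivrMr// ler_wpM2l ?lerDl// ltW// divr_gt0.
have : (4 * l)^-1 * fine (P A) <= e / 4.
  have l40 : 0 < 4 * l by apply: mulr_gt0.
  by rewrite mulrC ler_pdivrMr//; apply: le_trans PA _; lra.
by lra.
Qed.
End expectation.

(** * Fourth moments and truncation *)

Section fourth_moments.
Context {R : realType} {d : measure_display} {T : measurableType d}.
Variable P : probability T R.
Implicit Types f g : T -> R.

Local Notation L1 f := (P.-integrable setT (EFin \o f)).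
Local Notation "'E[' f ]" := (Rintegral P setT f).

(** On a probability space this single condition yields all the integrability used below: powers up
    to 4 and mixed products of total degree at most 4. *)
Definition finite_moment4 f := measurable_fun setT f /\ L1 (fun w => f w ^+ 4).

Lemma finite_moment4_le (f g : T -> R) : measurable_fun setT f ->
  (forall w, `|f w| <= `|g w|) -> finite_moment4 g -> finite_moment4 f.
Proof.
move=> mf fg [mg lg]; split=> //; apply: (integrable_rv_le _ _ lg).
  exact: measurable_funX.
move=> w; rewrite normrX -(ger0_norm (exprn_even_ge0 (g w) (isT : ~~ odd 4))).
by rewrite normrX lerXn2r ?nnegrE.
Qed.

Lemma finite_moment4_cst (k : R) : finite_moment4 (fun=> k).
Proof. by split; [exact: measurable_cst|exact: integrable_rv_cst]. Qed.

Lemma finite_moment4Z (k : R) f : finite_moment4 f -> finite_moment4 (fun w => k * f w).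
Proof.
move=> [mf lf]; split; first exact: measurable_funM.
rewrite (_ : (fun w => _) = fun w => k ^+ 4 * f w ^+ 4); first exact: integrable_rvZ.
by apply/funext => w; rewrite exprMn.
Qed.

(** The constant is [2 ^ 3], from convexity of the fourth power; the gap is exhibited as a square
    times a sum of squares. *)
Lemma exprD4_le (x y : R) : (x + y) ^+ 4 <= 8 * x ^+ 4 + 8 * y ^+ 4.
Proof.
rewrite -subr_ge0 (_ : _ - _ =
  (x - y) ^+ 2 * (5 * (x + y) ^+ 2 + (2 * x ^+ 2 + 2 * y ^+ 2))); last by ring.
apply: mulr_ge0; first exact: sqr_ge0.
have [? ? ?] := And3 (sqr_ge0 x) (sqr_ge0 y) (sqr_ge0 (x + y)); lra.
Qed.

Lemma finite_moment4D f g : finite_moment4 f -> finite_moment4 g ->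
  finite_moment4 (fun w => f w + g w).
Proof.
move=> [mf lf] [mg lg]; split; first exact: measurable_funD.
apply: (@integrable_rv_le _ _ _ _ _ (fun w => 8 * f w ^+ 4 + 8 * g w ^+ 4)).
- by apply: measurable_funX; exact: measurable_funD.
- move=> w; rewrite ger0_norm ?exprD4_le//.
  exact: exprn_even_ge0.
- by apply: integrable_rvD; exact: integrable_rvZ.
Qed.

Lemma finite_moment4N f : finite_moment4 f -> finite_moment4 (fun w => - f w).
Proof.
move=> [mf lf]; split; first exact: measurableT_comp.
by rewrite (_ : (fun w => _) = fun w => f w ^+ 4)//; apply/funext => w; rewrite exprNn; ring.
Qed.

Lemma finite_moment4B f g : finite_moment4 f -> finite_moment4 g ->
  finite_moment4 (fun w => f w - g w).
Proof. by move=> hf hg; exact: finite_moment4D hf (finite_moment4N hg). Qed.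

Lemma finite_moment4_sum n (F : 'I_n -> T -> R) :
  (forall i, finite_moment4 (F i)) -> finite_moment4 (fun w => \sum_(i < n) F i w).
Proof.
elim: n F => [|n IH] F LF.
  rewrite (_ : (fun w => _) = fun=> 0); first exact: finite_moment4_cst.
  by apply/funext => w; rewrite big_ord0.
rewrite (_ : (fun w => _) =
  fun w => \sum_(i < n) F (widen_ord (leqnSn n) i) w + F ord_max w).
  by apply: finite_moment4D => //; apply: IH.
by apply/funext => w; rewrite big_ord_recr.
Qed.

Lemma finite_moment4Mb f g (K : R) : measurable_fun setT f ->
  (forall w, `|f w| <= K) -> finite_moment4 g -> finite_moment4 (fun w => f w * g w).
Proof.
move=> mf fK hg; apply: (finite_moment4_le _ _ (finite_moment4Z K hg)).
  by apply: measurable_funM => //; case: hg.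
by move=> w; rewrite !normrM ler_wpM2r// (le_trans (fK w))// ler_norm.
Qed.

Lemma exp_le_1exp4 (x : R) n : (n <= 4)%N -> `|x| ^+ n <= 1 + x ^+ 4.
Proof.
move=> n4; have x4 : x ^+ 4 = `|x| ^+ 4.
  by rewrite -normrX ger0_norm// exprn_even_ge0.
rewrite x4; have [x1|x1] := leP `|x| 1.
  by rewrite ler_wpDr ?exprn_ge0// exprn_ile1.
by rewrite ler_wpDl// ler_weXn2l// ltW.
Qed.

Lemma integrable_rvX f n : (n <= 4)%N -> finite_moment4 f -> L1 (fun w => f w ^+ n).
Proof.
move=> n4 [mf lf]; apply: (@integrable_rv_le _ _ _ _ _ (fun w => 1 + f w ^+ 4)).
- exact: measurable_funX.
- by move=> w; rewrite normrX exp_le_1exp4.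
- by apply: integrable_rvD => //; exact: integrable_rv_cst.
Qed.

Lemma integrable_rv4 f : finite_moment4 f -> L1 f.
Proof. by move=> /(@integrable_rvX _ 1 isT). Qed.

Lemma integrable_rvXM f g i j : (i + j <= 4)%N ->
  finite_moment4 f -> finite_moment4 g -> L1 (fun w => f w ^+ i * g w ^+ j).
Proof.
move=> ij4 hf hg; have [[mf lf] [mg lg]] := (hf, hg).
apply: (@integrable_rv_le _ _ _ _ _ (fun w => (1 + f w ^+ 4) + (1 + g w ^+ 4))).
- by apply: measurable_funM; exact: measurable_funX.
- move=> w; rewrite normrM !normrX.
  have x4 (x : R) : 0 <= 1 + x ^+ 4 by rewrite addr_ge0// exprn_even_ge0.
  have [fg|/ltW fg] := leP `|f w| `|g w|.
    rewrite ler_wpDl//; apply: le_trans (exp_le_1exp4 (g w) ij4).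
    by rewrite exprD ler_wpM2r ?exprn_ge0// lerXn2r ?nnegrE.
  rewrite ler_wpDr//; apply: le_trans (exp_le_1exp4 (f w) ij4).
  by rewrite exprD ler_wpM2l ?exprn_ge0// lerXn2r ?nnegrE.
- by apply: integrable_rvD; apply: integrable_rvD => //; exact: integrable_rv_cst.
Qed.

(** For [0 <= L], the nearest-point projection onto [[-L, L]]. It is 1-Lipschitz and fixes [0], so
    it bounds random variables without spoiling convergence in probability. *)
Definition clamp (L x : R) : R := Num.max (- L) (Num.min L x).

Lemma clamp_le (L x : R) : 0 <= L -> `|clamp L x| <= L.
Proof.
move=> L0; rewrite /clamp ler_norml le_max lexx/= ge_max ge_min lexx andbT.
by rewrite (le_trans _ L0)// oppr_le0.
Qed.

Lemma clamp_id (L x : R) : `|x| <= L -> clamp L x = x.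
Proof. by rewrite /clamp ler_norml => /andP[h1 h2]; rewrite min_r// max_r. Qed.

Lemma clamp_lipschitz (L x y : R) : `|clamp L x - clamp L y| <= `|x - y|.
Proof.
wlog xy : x y / x <= y => [H|].
  by have [/H//|/ltW/H] := leP x y; rewrite distrC => h; rewrite (distrC x).
rewrite distrC (distrC x) ger0_norm ?subr_ge0; last first.
  by rewrite /clamp ge_max le_max lexx/= le_max le_min2// orbT.
rewrite ger0_norm ?subr_ge0// /clamp /Num.max /Num.min.
by do ! case: ifPn; rewrite -?leNgt => *; lra.
Qed.

Lemma clamp_norm_le (L x : R) : 0 <= L -> `|clamp L x| <= `|x|.
Proof.
move=> L0; have := clamp_lipschitz L x 0.
by rewrite (@clamp_id L 0) ?normr0// !subr0.
Qed.

Lemma measurable_clamp f (L : R) : measurable_fun setT f ->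
  measurable_fun setT (fun w => clamp L (f w)).
Proof. by move=> mf; apply: measurable_maxr => //; exact: measurable_minr. Qed.

Lemma cvg_prob0_le (Y Z : nat -> T -> R) :
  (forall n, measurable_fun setT (Y n)) -> (forall n, measurable_fun setT (Z n)) ->
  (forall n, {ae P, forall w, `|Y n w| <= `|Z n w|}) ->
  cvg_prob0 P Z -> cvg_prob0 P Y.
Proof.
move=> mY mZ YZ cZ e e0; apply: (squeeze_cvge _ (cvg_cst 0%E) (cZ e e0)).
apply: nearW => n; apply/andP; split=> //.
have [N [mN N0 HN]] := YZ n.
apply: (@le_trans _ _ (P ([set w | e < `|Z n w|] `|` N))).
  apply: le_measure; rewrite ?inE; [exact: measurable_gt_norm| |].
    by apply: measurableU => //; exact: measurable_gt_norm.
  move=> w /= eY; have [wN|wN] := pselect (N w); [by right|left].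
  apply: (lt_le_trans eY); apply: contrapT => h; apply: wN; apply: HN => /=.
  exact: h.
apply: le_trans (measureU2 _ _ _) _ => //; first exact: measurable_gt_norm.
by rewrite [X in (_ + X)%E](_ : _ = 0%E) ?adde0.
Qed.

Lemma cvg_prob0_sqr (Y : nat -> T -> R) :
  cvg_prob0 P Y -> cvg_prob0 P (fun n w => Y n w ^+ 2).
Proof.
move=> cY e e0; rewrite [X in X @ _ --> _](_ : _ =
  (fun n => P [set w | Num.sqrt e < `|Y n w|])); first by apply: cY; rewrite sqrtr_gt0.
apply/funext => n; congr (P _); apply/seteqP; split => w /=.
  by rewrite normrX => h; rewrite -(ltr_pXn2r (isT : 0 < 2)%N) ?nnegrE ?sqrtr_ge0// sqr_sqrtr// ltW.
by rewrite normrX -(ltr_pXn2r (isT : 0 < 2)%N) ?nnegrE ?sqrtr_ge0// sqr_sqrtr// ltW.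
Qed.

End fourth_moments.

Section convergence_in_probability.
Context {R : realType} {d : measure_display} {T : measurableType d}.
Variable P : probability T R.

Local Notation L1 f := (P.-integrable setT (EFin \o f)).
Local Notation "'E[' f ]" := (Rintegral P setT f).

Lemma exp4_lipschitz (L x y : R) : `|x| <= L -> `|y| <= L ->
  x ^+ 4 <= y ^+ 4 + 4 * L ^+ 3 * `|x - y|.
Proof.
move=> xL yL; have L0 : 0 <= L := le_trans (normr_ge0 x) xL.
rewrite -lerBlDl.
have -> : x ^+ 4 - y ^+ 4 = (x ^+ 3 + x ^+ 2 * y + x * y ^+ 2 + y ^+ 3) * (x - y) by ring.
apply: le_trans (ler_norm _) _; rewrite normrM ler_wpM2r//.
have h i j : (i + j = 3)%N -> `|x ^+ i * y ^+ j| <= L ^+ 3.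
  move=> <-; rewrite normrM !normrX exprD ler_pM ?exprn_ge0// lerXn2r ?nnegrE//.
have := (h 3 0 erefl)%N; have := (h 2 1 erefl)%N; have := (h 1 2 erefl)%N;
have := (h 0 3 erefl)%N; rewrite !expr1 !expr0 mulr1 mul1r => h1 h2 h3 h4.
apply: le_trans (ler_normD _ _) _; apply: le_trans (lerD (ler_normD _ _) (lexx _)) _.
apply: le_trans (lerD (lerD (ler_normD _ _) (lexx _)) (lexx _)) _.
by lra.
Qed.

Section fourth_moment_bound.
Variables (Y_ : nat -> T -> R) (Y : T -> R) (C : R).
Hypothesis mY_ : forall n, finite_moment4 P (Y_ n).
Hypothesis mY : measurable_fun setT Y.
Hypothesis YC : forall n, E[fun w => Y_ n w ^+ 4] <= C.
Hypothesis cY : cvg_prob0 P (fun n w => Y_ n w - Y w).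

(** A form of Fatou's lemma: after clamping, all values lie in a bounded set where the fourth power
    is Lipschitz, so convergence in probability becomes convergence in mean; and clamping does not
    increase [Y_ n w ^+ 4]. *)
Let clamp_moment4 (L : R) : 0 <= L -> E[fun w => clamp L (Y w) ^+ 4] <= C.
Proof.
move=> L0.
have mcl (g : T -> R) : measurable_fun setT g ->
  finite_moment4 P (fun w => clamp L (g w)).
  move=> mg; have h := measurable_clamp L mg.
  apply: (finite_moment4_le h _ (finite_moment4_cst P L)) => w.
  by rewrite (ger0_norm L0) clamp_le.
pose D n w := clamp L (Y_ n w) - clamp L (Y w).
have mD n : finite_moment4 P (D n).
  by apply: finite_moment4B; apply: mcl => //; case: (mY_ n).
have DL n w : `|D n w| <= L + L.
  by apply: le_trans (ler_normB _ _) _; apply: lerD; exact: clamp_le.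
have cD : E[fun w => `|D n w|] @[n --> \oo] --> 0.
  apply: (@cvg_prob0_expect_norm _ _ _ _ _ ((L + L) ^+ 2)).
  - by move=> n; exact: integrable_rvX.
  - by move=> n; case: (mD n).
  - move=> n; rewrite -[leRHS](expect_cst P); apply: expect_le.
    + exact: integrable_rvX.
    + exact: integrable_rv_cst.
    + move=> w; rewrite -real_normK ?num_real// lerXn2r ?nnegrE//.
      by rewrite addr_ge0.
  - apply: (cvg_prob0_le _ _ _ cY) => n; first by case: (mD n).
    + by apply: measurable_funB => //; case: (mY_ n).
    + by apply: aeW => w; exact: clamp_lipschitz.
have cC : C + 4 * L ^+ 3 * E[fun w => `|D n w|] @[n --> \oo] --> C.
  rewrite -[X in _ --> X]addr0; apply: cvgD; first exact: cvg_cst.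
  by rewrite -[X in _ --> X](mulr0 (4 * L ^+ 3)); apply: cvgM => //; exact: cvg_cst.
rewrite -(cvg_lim _ cC)//; apply: limr_ge; first by apply/cvg_ex; exists C.
apply: nearW => n.
have LD : L1 (fun w => 4 * L ^+ 3 * `|D n w|).
  by apply: integrable_rvZ; apply: integrable_rv_norm; exact: integrable_rv4.
rewrite -expectZ; last by apply: integrable_rv_norm; exact: integrable_rv4.
have L4 : L1 (fun w => Y_ n w ^+ 4) by case: (mY_ n).
apply: le_trans (lerD (YC n) (lexx _)).
rewrite -expectD//; apply: expect_le.
- by case: (mcl _ mY).
- exact: integrable_rvD.
- move=> w; apply: le_trans (exp4_lipschitz (clamp_le _ L0) (clamp_le (Y_ n w) L0)) _.
  rewrite (distrC (clamp L (Y w))) lerD2r.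
  rewrite -[leLHS]ger0_norm ?exprn_even_ge0// -[leRHS]ger0_norm ?exprn_even_ge0//.
  by rewrite !normrX lerXn2r ?nnegrE ?clamp_norm_le.
Qed.

(** The clamp level is sent to infinity: the clamped fourth powers increase to [Y w ^+ 4], and
    monotone convergence carries the bound [C] to the limit. *)
Lemma cvg_prob0_moment4 : finite_moment4 P Y /\ E[fun w => Y w ^+ 4] <= C.
Proof.
have C0 : 0 <= C.
  by apply: le_trans (YC 0); apply: Rintegral_ge0 => w _; exact: exprn_even_ge0.
pose g (n : nat) w := (clamp n%:R (Y w) ^+ 4)%:E.
have pow4E (x : R) : x ^+ 4 = `|x| ^+ 4.
  by rewrite -normrX ger0_norm// exprn_even_ge0.
have normcl (L x : R) : 0 <= L -> `|clamp L x| = Num.min L `|x|.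
  move=> L0; have [xL|Lx] := leP `|x| L; first by rewrite clamp_id.
  rewrite /clamp; case: (ltrP 0 x) => x0.
    rewrite ger0_norm ?(ltW x0)// in Lx; rewrite min_l ?ltW// max_r ?ger0_norm//.
    by rewrite (le_trans _ L0)// oppr_le0.
  rewrite ler0_norm// in Lx; rewrite min_r; last by rewrite (le_trans x0).
  by rewrite max_l ?normrN ?ger0_norm// lerNr ltW.
have mg n : measurable_fun setT (g n).
  by apply/measurable_EFinP; apply: measurable_funX; exact: measurable_clamp.
have g0 n w : setT w -> (0 <= g n w)%E.
  by move=> _; rewrite lee_fin exprn_even_ge0.
have ndg w : setT w -> {homo g^~ w : n m / (n <= m)%N >-> (n <= m)%E}.
  move=> _ n m nm; rewrite lee_fin pow4E [leRHS]pow4E lerXn2r ?nnegrE//.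
  by rewrite !normcl// le_min2// ler_nat.
have limg w : limn (g^~ w) = (Y w ^+ 4)%:E.
  apply/cvg_lim => //; apply: cvg_near_cst.
  near=> n; rewrite /g clamp_id//.
  apply: le_trans (_ : (Num.bound `|Y w|)%:R <= _).
    by apply/ltW; rewrite (le_lt_trans _ (archi_boundP _)).
  rewrite ler_nat; near: n; exact: nbhs_infty_ge.
have iY : (\int[P]_w (Y w ^+ 4)%:E <= C%:E)%E.
  have := monotone_convergence P measurableT mg g0 ndg.
  under eq_integral do rewrite limg.
  move=> ->; apply: lime_le.
    apply: ereal_nondecreasing_is_cvgn => n m nm.
    apply: ge0_le_integral => // w wT; [exact: g0|exact: ndg nm].
  apply: nearW => n; rewrite -(fineK (_ : (\int[P]_w g n w)%E \is a fin_num)).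
    by rewrite lee_fin; exact: clamp_moment4.
  apply: integrable_fin_num => //.
  apply: (@integrable_rv_bounded _ _ _ P (fun w => clamp n%:R (Y w) ^+ 4) (n%:R ^+ 4)).
    by apply: measurable_funX; exact: measurable_clamp.
  by move=> w; rewrite normrX lerXn2r ?nnegrE// clamp_le.
have L4 : L1 (fun w => Y w ^+ 4).
  apply/integrableP; split; first by apply/measurable_EFinP; exact: measurable_funX.
  under eq_integral do rewrite /= ger0_norm ?exprn_even_ge0//.
  by apply: le_lt_trans iY _; rewrite ltry.
split=> //; rewrite -lee_fin fineK//.
exact: integrable_fin_num.
Unshelve. all: end_near.
Qed.

(** The squared differences tend to [0] in probability, and their second moments are fourth moments
    of differences, bounded by [8 * C + 8 * C]; hence they tend to [0] in mean. *)
Lemma cvg_prob0_cvg_L2 : E[fun w => (Y_ n w - Y w) ^+ 2] @[n --> \oo] --> 0.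
Proof.
have [hY EY] := cvg_prob0_moment4.
have hD n := finite_moment4B (mY_ n) hY.
have mD n : measurable_fun setT (fun w => Y_ n w - Y w) by case: (hD n).
have := @cvg_prob0_expect_norm _ _ _ P (fun n w => (Y_ n w - Y w) ^+ 2) (8 * C + 8 * C).
have -> : (fun n => E[fun w => `|(Y_ n w - Y w) ^+ 2|]) =
          (fun n => E[fun w => (Y_ n w - Y w) ^+ 2]).
  by apply/funext => n; apply: eq_Rintegral => w _; rewrite ger0_norm ?sqr_ge0.
have E4 n : (fun w => ((Y_ n w - Y w) ^+ 2) ^+ 2) = (fun w => (Y_ n w - Y w) ^+ 4).
  by apply/funext => w; rewrite -exprM.
apply.
- by move=> n; rewrite E4; case: (hD n).
- by move=> n; exact: measurable_funX.
- move=> n; rewrite E4.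
  have [[_ l1] [_ l2]] := (mY_ n, hY).
  apply: le_trans (lerD (ler_wpM2l _ (YC n)) (ler_wpM2l _ EY)) => //.
  rewrite -!expectZ// -expectD//; try exact: integrable_rvZ.
  apply: expect_le; first by case: (hD n).
    by apply: integrable_rvD; exact: integrable_rvZ.
  move=> w; apply: le_trans (exprD4_le _ _) _.
  by rewrite exprNn (_ : (-1) ^+ 4 = 1) ?mul1r//; ring.
- exact: cvg_prob0_sqr.
Qed.

End fourth_moment_bound.

End convergence_in_probability.

(** * Moments of the normal law *)

Section gaussian_moments.
Context {R : realType}.
Variable s : R.
Hypothesis s0 : 0 < s.
Local Notation mu := (@lebesgue_measure R).
Local Notation p := (normal_pdf 0 s).

Let sneq0 : s != 0. Proof. exact: lt0r_neq0. Qed.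
Let s2neq0 : 2 * s != 0. Proof. by rewrite mulf_neq0 ?pnatr_eq0. Qed.

Let pE z : p z = normal_peak s * expR (- (2 * s ^+ 2)^-1 * z ^+ 2).
Proof.
rewrite normal_pdfE// /normal_fun subr0; congr (_ * expR _).
by rewrite -mulr_natl mulNr mulrC mulNr.
Qed.

Let p2E z : normal_pdf 0 (2 * s) z =
  normal_peak (2 * s) * expR (- (8 * s ^+ 2)^-1 * z ^+ 2).
Proof.
rewrite normal_pdfE// /normal_fun subr0; congr (_ * expR _).
rewrite -mulr_natl mulNr mulrC mulNr exprMn; congr (- (_^-1 * _)); ring.
Qed.

(** A centred Gaussian density of twice the deviation dominates [z ^+ k * p z] for [k <= 4]. The
    surplus exponent is [u = 3 z^2 / (8 s^2)], and [z ^+ 4 = 128 / 9 * s ^+ 4 * (u ^+ 2 / 2)] is at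
    most [128 / 9 * s ^+ 4 * expR u]. *)
Let C := normal_peak s * (1 + 128 / 9 * s ^+ 4) / normal_peak (2 * s).

Let pow_pdf_le k z : (k <= 4)%N -> `|z ^+ k * p z| <= C * normal_pdf 0 (2 * s) z.
Proof.
move=> k4; rewrite normrM (ger0_norm (normal_pdf_ge0 _ _ _)) normrX.
apply: le_trans (ler_wpM2r (normal_pdf_ge0 _ _ _) (exp_le_1exp4 z k4)) _.
rewrite pE p2E /C.
have pk : 0 < normal_peak s by exact: normal_peak_gt0.
have pk2 : 0 < normal_peak (2 * s) by exact: normal_peak_gt0.
rewrite [leRHS](_ : _ = normal_peak s * ((1 + 128 / 9 * s ^+ 4) * expR (- (8 * s ^+ 2)^-1 * z ^+ 2))); last first.
  by field; rewrite gt_eqF.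
rewrite mulrCA ler_pM2l//.
pose u := 3 * (8 * s ^+ 2)^-1 * z ^+ 2.
have -> : expR (- (8 * s ^+ 2)^-1 * z ^+ 2) = expR u * expR (- (2 * s ^+ 2)^-1 * z ^+ 2).
  rewrite -expRD; congr expR; rewrite /u; field.
  by rewrite sneq0.
rewrite [leRHS]mulrA ler_wpM2r ?expR_ge0//.
have u0 : 0 <= u.
  by rewrite /u mulr_ge0 ?sqr_ge0// divr_ge0// mulr_ge0 ?sqr_ge0.
have h := expR_ge1Dxn 1 u0.
have h1 : 1 <= expR u by rewrite -expR0 ler_expR.
have hz : z ^+ 4 <= 128 / 9 * s ^+ 4 * expR u.
  have -> : z ^+ 4 = 128 / 9 * s ^+ 4 * (u ^+ 2 / 2).
    by rewrite /u; field; rewrite sneq0.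
  rewrite ler_wpM2l//; first by rewrite mulr_ge0 ?exprn_even_ge0// divr_ge0.
  by apply: le_trans h; rewrite lerDr.
by rewrite mulrDl mul1r lerD.
Qed.

Lemma integrable_pow_normal_pdf k : (k <= 4)%N ->
  mu.-integrable setT (EFin \o (fun z => z ^+ k * p z)).
Proof.
move=> k4.
have h : mu.-integrable setT (fun z => (C%:E * (normal_pdf 0 (2 * s) z)%:E)%E).
  by apply: integrableZl => //; exact: integrable_normal_pdf.
apply: (le_integrable measurableT _ _ h).
  apply/measurable_EFinP; apply: measurable_funM; last exact: measurable_normal_pdf.
  exact: measurable_funX.
move=> z _ /=; rewrite lee_fin (le_trans (pow_pdf_le z k4))//.
exact: ler_norm.
Qed.

(** Only the absolute value of [e n] is prescribed, so that both boundary terms of an integration by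
    parts over a symmetric interval are covered. *)
Lemma cvg_pow_normal_pdf k (e : nat -> R) : (k <= 4)%N -> (forall n, `|e n| = n.+1%:R) ->
  (e n) ^+ k * p (e n) @[n --> \oo] --> 0.
Proof.
move=> k4 he; apply/norm_cvg0P.
have pk2 : 0 < normal_peak (2 * s) by exact: normal_peak_gt0.
have C0 : 0 <= C.
  have pk := normal_peak_ge0 s.
  rewrite /C mulr_ge0 ?invr_ge0 ?normal_peak_ge0// mulr_ge0 ?normal_peak_ge0//.
  by rewrite addr_ge0// mulr_ge0 ?exprn_even_ge0// divr_ge0.
pose B := C * normal_peak (2 * s) * (8 * s ^+ 2).
have B0 : B * n.+1%:R^-1 @[n --> \oo] --> 0.
  rewrite -[X in _ --> X](mulr0 B); apply: cvgM; first exact: cvg_cst.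
  exact: cvg_harmonic.
apply: (squeeze_cvgr _ (cvg_cst 0) B0); apply: nearW => n.
rewrite normr_ge0/=; apply: le_trans (pow_pdf_le (e n) k4) _.
rewrite p2E /B [leLHS]mulrA -[leRHS]mulrA.
rewrite ler_wpM2l ?(mulr_ge0 C0) ?normal_peak_ge0//.
rewrite mulNr expRN -(real_normK (num_real (e n))) he.
have s8 : 0 < 8 * s ^+ 2 by rewrite mulr_gt0 ?exprn_gt0.
apply: le_trans (_ : ((8 * s ^+ 2)^-1 * n.+1%:R ^+ 2)^-1 <= _).
  rewrite lef_pV2 ?posrE ?expR_gt0 ?mulr_gt0 ?invr_gt0 ?exprn_gt0//.
  by apply: le_trans (expR_ge1Dx _); rewrite lerDr.
rewrite invfM invrK ler_wpM2l ?(ltW s8)//.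
by rewrite lef_pV2 ?posrE ?exprn_gt0// expr2 -natrM ler_nat leq_pmulr.
Qed.

Lemma cvg_Rintegral_symitv (f : R -> R) : mu.-integrable setT (EFin \o f) ->
  \int[mu]_(x in `[- n.+1%:R, n.+1%:R]) f x @[n --> \oo] --> \int[mu]_x f x.
Proof.
move=> If.
have mf : measurable_fun setT f by apply/measurable_EFinP; exact: (measurable_int mu).
pose g n := f \_ `[- (n.+1%:R : R), n.+1%:R].
have mg n : measurable_fun setT (EFin \o g n).
  apply/measurable_EFinP; apply/(measurable_restrictT _ _).1 => //.
  exact: measurable_funTS.
have cg : \forall x \ae mu, setT x -> (fun n => (EFin \o g n) x) @ \oo --> (EFin \o f) x.
  apply: aeW => x _; apply: cvg_near_cst; near=> n.
  rewrite /g /= patchE ifT// inE/= in_itv/= -ler_norml.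
  apply: le_trans (_ : (Num.bound `|x|)%:R <= _).
    by apply/ltW; rewrite (le_lt_trans _ (archi_boundP _)).
  by rewrite ler_nat; apply: leqW; near: n; exact: nbhs_infty_ge.
have dg : \forall x \ae mu, forall n, setT x ->
    (`|(EFin \o g n) x| <= (EFin \o (Num.norm \o f)) x)%E.
  apply: aeW => x n _; rewrite /= lee_fin /g patchE; case: ifP => // _.
  by rewrite normr0.
have [_ _ cv] := @dominated_convergence _ _ _ mu setT measurableT
  (fun n => EFin \o g n) (EFin \o f) (EFin \o (Num.norm \o f))
  mg (measurable_int mu If) cg (integrable_norm If) dg.
have -> : (fun n => \int[mu]_(x in `[- n.+1%:R, n.+1%:R]) f x) =
   fine \o (fun n => \int[mu]_x (EFin \o g n) x)%E.
  apply/funext => n /=; rewrite /Rintegral integral_mkcond; congr fine.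
  by apply: eq_integral => x _; rewrite /g /= !patchE; case: ifP.
apply: fine_cvg; rewrite fineK//; exact: integrable_fin_num.
Unshelve. all: end_near.
Qed.

Lemma is_derive_normal_pdf (z : R) : is_derive z 1 p (- z / s ^+ 2 * p z).
Proof.
have -> : p = fun z => normal_peak s * expR (- (2 * s ^+ 2)^-1 * z ^+ 2).
  by apply/funext => x; exact: pE.
apply: is_derive_eq.
rewrite /GRing.scale/=; field.
by rewrite sneq0.
Qed.


End gaussian_moments.

Section real_derivatives.
Context {R : realType}.
Implicit Types f g : R -> R.

Lemma is_derive1M f g (x df dg : R) : is_derive x 1 f df -> is_derive x 1 g dg ->
  is_derive x 1 (fun z => f z * g z) (df * g x + f x * dg).
Proof.
move=> hf hg; apply: (is_derive_eq (is_deriveM hf hg)).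
by rewrite /GRing.scale/= addrC (mulrC df).
Qed.

Lemma is_derive1Z f (c x df : R) : is_derive x 1 f df ->
  is_derive x 1 (fun z => c * f z) (c * df).
Proof.
move=> hf; apply: (is_derive_eq (is_derive1M (is_derive_cst c x 1) hf)).
by rewrite mul0r add0r.
Qed.

Lemma is_derive1X (x : R) n : is_derive x 1 (fun z => z ^+ n) (n%:R * x ^+ n.-1).
Proof.
rewrite (_ : (fun z => _) = (@id R) ^+ n); last by rewrite exprfctE.
apply: (is_derive_eq (is_deriveX n (is_derive_id x 1))).
by rewrite /GRing.scale/= mulr1.
Qed.

Lemma is_derive1_derivable f (x df : R) : is_derive x 1 f df -> derivable f x 1.
Proof. by case. Qed.

Lemma is_derive1_continuous f (x df : R) : is_derive x 1 f df -> {for x, continuous f}.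
Proof. by case=> /derivable1_diffP/differentiable_continuous. Qed.

Lemma is_derive1_derive1 f (x df : R) : is_derive x 1 f df -> (f^`())%classic x = df.
Proof. by move=> hf; rewrite derive1E derive_val. Qed.

Lemma Rintegral_is_derive F f (a b : R) : a <= b ->
  (forall x, a <= x <= b -> is_derive x 1 F (f x)) ->
  {within `[a, b], continuous f} ->
  \int[lebesgue_measure]_(x in `[a, b]) f x = F b - F a.
Proof.
rewrite le_eqVlt => /predU1P[<- _ _|ab dF cf].
  by rewrite set_itv1 Rintegral_set1 subrr.
have cF x : a <= x <= b -> {for x, continuous F}.
  by move=> /dF; exact: is_derive1_continuous.
rewrite /Rintegral (@continuous_FTC2 _ f F)//.
- split.
  + move=> x; rewrite in_itv/= => /andP[ax xb].
    by apply: (is_derive1_derivable (dF _ _)); rewrite !ltW.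
  + by apply: cvg_at_right_filter; apply: cF; rewrite lexx ltW.
  + by apply: cvg_at_left_filter; apply: cF; rewrite lexx ltW.
- move=> x; rewrite in_itv/= => /andP[ax xb].
  by apply: is_derive1_derive1; apply: dF; rewrite !ltW.
Qed.
End real_derivatives.

Section gaussian_moment_values.
Context {R : realType}.
Variable s : R.
Hypothesis s0 : 0 < s.
Local Notation mu := (@lebesgue_measure R).
Local Notation p := (normal_pdf 0 s).

Let sneq0 : s != 0. Proof. exact: lt0r_neq0. Qed.

Let moment k := \int[mu]_z (z ^+ k * p z).

(** Integration by parts: the derivative of [- s ^+ 2 * (z ^+ k * p z)] is the difference of the two
    integrands, and the boundary values vanish at infinity. For [k = 0] the truncated index [k.-1]
    is killed by the factor [k%:R]. *)
Let moment_rec k : (k <= 3)%N -> moment k.+1 = s ^+ 2 * (k%:R * moment k.-1).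
Proof.
move=> k3.
pose f (z : R) := z ^+ k.+1 * p z - s ^+ 2 * (k%:R * (z ^+ k.-1 * p z)).
pose F (z : R) := - s ^+ 2 * (z ^+ k * p z).
have If1 := @integrable_pow_normal_pdf R s s0 k.+1 k3.
have If2 : mu.-integrable setT (EFin \o (fun z : R => s ^+ 2 * (k%:R * (z ^+ k.-1 * p z)))).
  apply: (@integrableZl _ (measurableTypeR R) R mu setT measurableT (s ^+ 2)
     (EFin \o (fun z : R => k%:R * (z ^+ k.-1 * p z)))).
  apply: (@integrableZl _ (measurableTypeR R) R mu setT measurableT k%:R
     (EFin \o (fun z : R => z ^+ k.-1 * p z))).
  by apply: (integrable_pow_normal_pdf s0); rewrite (leq_trans (leq_pred k))// ltnW.
have If : mu.-integrable setT (EFin \o f).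
  exact: (@integrableB _ (measurableTypeR R) R mu setT measurableT _ _ If1 If2).
have dF (z : R) : is_derive z 1 F (f z).
  have dp := is_derive_normal_pdf s0 z.
  apply: (is_derive_eq (is_derive1Z _ (is_derive1M (is_derive1X z k) dp))).
  rewrite /f; case: (k) => [|m]/=.
    by rewrite expr1 expr0; field; rewrite sneq0.
  by rewrite !exprS; field; rewrite sneq0.
have cf : continuous f.
  have cp := @continuous_normal_pdf R 0 s sneq0.
  have cX m : continuous (fun z : R => z ^+ m * p z).
    by move=> z; apply: cvgM; [exact: exprn_continuous|exact: cp].
  move=> z; apply: cvgB; first exact: cX.
  by apply: cvgM; [exact: cvg_cst|apply: cvgM; [exact: cvg_cst|exact: cX]].
have k4 : (k <= 4)%N by exact: ltnW.
have cF : \int[mu]_(x in `[- n.+1%:R, n.+1%:R]) f x @[n --> \oo] --> (0 : R).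
  have -> : (fun n => \int[mu]_(x in `[- n.+1%:R, n.+1%:R]) f x) =
     (fun n => F n.+1%:R - F (- n.+1%:R)).
    apply/funext => n; rewrite (@Rintegral_is_derive _ F)//.
    - by rewrite (le_trans (_ : _ <= 0))// oppr_le0.
    - exact: continuous_subspaceT.
  rewrite -[X in _ --> X](subr0 0); apply: cvgB.
    rewrite -[X in _ --> X](mulr0 (- s ^+ 2)); apply: cvgM; first exact: cvg_cst.
    by apply: cvg_pow_normal_pdf => // n; rewrite ger0_norm.
  rewrite -[X in _ --> X](mulr0 (- s ^+ 2)); apply: cvgM; first exact: cvg_cst.
  by apply: cvg_pow_normal_pdf => // n; rewrite normrN ger0_norm.
have /eqP : \int[mu]_z f z = 0.
  rewrite -(cvg_lim (@Rhausdorff R) (cvg_Rintegral_symitv If)).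
  exact: cvg_lim cF.
rewrite /f RintegralB// subr_eq0 => /eqP; rewrite -/(moment k.+1) => ->.
rewrite RintegralZl//; last first.
  apply: (@integrableZl _ (measurableTypeR R) R mu setT measurableT k%:R
     (EFin \o (fun z : R => z ^+ k.-1 * p z))).
  by apply: (integrable_pow_normal_pdf s0); rewrite (leq_trans (leq_pred k)).
rewrite RintegralZl//.
by apply: (integrable_pow_normal_pdf s0); rewrite (leq_trans (leq_pred k)).
Qed.

Let moment0 : moment 0 = 1.
Proof.
rewrite /moment (_ : (fun z => _) = p); last by apply/funext => z; rewrite mul1r.
by rewrite /Rintegral integral_normal_pdf.
Qed.

Lemma normal_pdf_moment1 : \int[mu]_z (z ^+ 1 * p z) = 0.
Proof. by rewrite -/(moment 1) moment_rec// mul0r mulr0. Qed.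

Lemma normal_pdf_moment2 : \int[mu]_z (z ^+ 2 * p z) = s ^+ 2.
Proof. by rewrite -/(moment 2) moment_rec//= moment0 !mulr1. Qed.

Lemma normal_pdf_moment3 : \int[mu]_z (z ^+ 3 * p z) = 0.
Proof. by rewrite -/(moment 3) moment_rec//= (normal_pdf_moment1 : moment 1 = 0) !mulr0. Qed.

Lemma normal_pdf_moment4 : \int[mu]_z (z ^+ 4 * p z) = 3 * s ^+ 4.
Proof.
rewrite -/(moment 4) moment_rec//= (normal_pdf_moment2 : moment 2 = _).
by ring.
Qed.

(** The normal law is dominated by Lebesgue measure; its Radon-Nikodym derivative and [normal_pdf]
    have the same integral over every measurable set, hence agree almost everywhere. *)
Lemma integral_normal_prob (f : R -> \bar R) : measurable_fun setT f ->
  (forall z, 0 <= f z)%E ->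
  (\int[normal_prob 0 s]_z f z = \int[mu]_z (f z * (p z)%:E))%E.
Proof.
move=> mf f0.
have dom := @normal_prob_dominates R 0 s.
rewrite -(Radon_Nikodym_SigmaFinite.change_of_variables dom)//.
have mg := Radon_Nikodym_SigmaFinite.f_integrable dom.
apply: ae_eq_integral => //.
- by apply: emeasurable_funM => //; exact: (measurable_int mu).
- apply: emeasurable_funM => //; apply/measurable_EFinP; exact: measurable_normal_pdf.
- apply: ae_eqe_mul2l.
  apply: integral_ae_eq => //.
  + by apply/measurable_EFinP; exact: measurable_normal_pdf.
  + by move=> E _ mE; rewrite -Radon_Nikodym_SigmaFinite.f_integral.
Qed.

End gaussian_moment_values.

Section normal_prob_moments.
Context {R : realType}.
Variable s : R.
Hypothesis s0 : 0 < s.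
Local Notation mu := (@lebesgue_measure R).
Local Notation p := (normal_pdf 0 s).
Local Notation nu := (normal_prob 0 s).

Let expect_normal_ge0 (f : R -> R) : measurable_fun setT f -> (forall z, 0 <= f z) ->
  \int[nu]_z f z = \int[mu]_z (f z * p z).
Proof.
move=> mf f0; rewrite /Rintegral integral_normal_prob//; exact/measurable_EFinP.
Qed.

Lemma finite_moment4_normal_prob : finite_moment4 nu (@id R).
Proof.
split; first exact: measurable_id.
have mX : measurable_fun setT (fun z : R => z ^+ 4) by exact: measurable_funX.
apply/integrableP; split; first exact/measurable_EFinP.
have x4 (z : R) : 0 <= z ^+ 4 by exact: exprn_even_ge0.
under eq_integral do rewrite /= ger0_norm//.
rewrite integral_normal_prob//; last exact/measurable_EFinP.
under eq_integral do rewrite -EFinM.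
by apply: integrable_lty => //; exact: (integrable_pow_normal_pdf s0).
Qed.

Lemma expect_normal_prob k : (k <= 4)%N ->
  \int[nu]_z z ^+ k = \int[mu]_z (z ^+ k * p z).
Proof.
move=> k4.
have h4 := finite_moment4_normal_prob.
have I k' : (k' <= 4)%N -> nu.-integrable setT (EFin \o (fun z : R => z ^+ k')).
  by move=> h; exact: (integrable_rvX h h4).
have mX k' : measurable_fun setT (fun z : R => z ^+ k') by exact: measurable_funX.
have x4 (z : R) : 0 <= 1 + z ^+ 4 by rewrite addr_ge0// exprn_even_ge0.
have I4 : nu.-integrable setT (EFin \o (fun z : R => 1 + z ^+ 4)).
  by apply: integrable_rvD; [exact: integrable_rv_cst|exact: I].
(* The passage to the density is available for nonnegative functions; adding [1 + z ^+ 4], which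
   dominates [|z ^+ k|], makes the integrand nonnegative and is undone afterwards. *)
have -> : \int[nu]_z z ^+ k = \int[nu]_z (z ^+ k + (1 + z ^+ 4)) - \int[nu]_z (1 + z ^+ 4).
  by rewrite expectD ?addrK//; exact: I.
rewrite !expect_normal_ge0//.
- have J k' : (k' <= 4)%N -> mu.-integrable setT (EFin \o (fun z : R => z ^+ k' * p z)).
    exact: integrable_pow_normal_pdf.
  have J4 : mu.-integrable setT (EFin \o (fun z : R => (1 + z ^+ 4) * p z)).
    have := @integrableD _ (measurableTypeR R) R mu setT measurableT _ _
      (J 0%N isT) (J 4%N isT).
    apply: eq_integrable => // z _ /=; rewrite -EFinD; congr EFin.
    by rewrite expr0 mul1r mulrDl mul1r.
  have -> : (fun z : R => (z ^+ k + (1 + z ^+ 4)) * p z) =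
            (fun z : R => z ^+ k * p z + (1 + z ^+ 4) * p z).
    by apply/funext => z; rewrite mulrDl.
  by rewrite RintegralD// ?addrK//; exact: J.
- by apply: measurable_funD => //; exact: mX.
- by apply: measurable_funD => //; apply: measurable_funD => //; exact: mX.
- move=> z; have := exp_le_1exp4 z k4; rewrite -normrX ler_norml => /andP[h _].
  by rewrite -lerBlDr sub0r.
Qed.

Lemma normal_prob_moment1 : \int[nu]_z z = 0.
Proof.
exact: etrans (@expect_normal_prob 1 isT) (normal_pdf_moment1 s0).
Qed.

Lemma normal_prob_moment2 : \int[nu]_z z ^+ 2 = s ^+ 2.
Proof. exact: etrans (@expect_normal_prob 2 isT) (normal_pdf_moment2 s0). Qed.

Lemma normal_prob_moment3 : \int[nu]_z z ^+ 3 = 0.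
Proof. exact: etrans (@expect_normal_prob 3 isT) (normal_pdf_moment3 s0). Qed.

Lemma normal_prob_moment4 : \int[nu]_z z ^+ 4 = 3 * s ^+ 4.
Proof. exact: etrans (@expect_normal_prob 4 isT) (normal_pdf_moment4 s0). Qed.
End normal_prob_moments.

(** * Expectations of products of independent variables *)

Section independent_increment.
Context {R : realType} {d : measure_display} {T : measurableType d}.
Variable P : probability T R.
Variables (G : set (set T)) (Z : T -> R) (nu : probability (measurableTypeR R) R).
Hypothesis GS : G `<=` measurable.
Hypothesis mZ : measurable_fun setT Z.
Hypothesis indepZ : forall (A : set T) (B : set R), G A -> measurable B ->
  P (A `&` Z @^-1` B) = (P A * nu B)%E.

Local Notation L1 f := (P.-integrable setT (EFin \o f)).
Local Notation "'E[' f ]" := (Rintegral P setT f).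

Lemma measurable_wrt_measurable (eta : T -> R) :
  measurable_wrt G eta -> measurable_fun setT eta.
Proof. by move=> h _ B mB; rewrite setTI; exact/GS/h. Qed.

(** The joint law of [(eta, Z)] and the product of the law of [eta] with [nu] agree on rectangles,
    hence everywhere, and Tonelli factors the integral. The absolute value in [g] makes the
    integrand nonnegative on the whole plane, not only on the range of [eta]. *)
Let indep_ge0 (eta : T -> R) (phi : R -> R) : measurable_wrt G eta ->
  measurable_fun setT phi -> (forall w, 0 <= eta w) -> (forall z, 0 <= phi z) ->
  (\int[P]_w (eta w * phi (Z w))%:E =
   \int[P]_w (eta w)%:E * \int[nu]_z (phi z)%:E)%E.
Proof.
move=> Geta mphi eta0 phi0.
have meta := measurable_wrt_measurable Geta.
pose eta' : {mfun T >-> R} := mfun_Sub (mem_set meta).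
pose J (w : T) : R * measurableTypeR R := (eta w, Z w).
have mJ : measurable_fun setT J by exact: measurable_fun_pair.
pose J' : {mfun T >-> (R * measurableTypeR R)%type} := mfun_Sub (mem_set mJ).
pose g (yz : R * measurableTypeR R) : \bar R := (`|yz.1| * phi yz.2)%:E.
have mg : measurable_fun setT g.
  apply/measurable_EFinP; apply: measurable_funM.
    by apply: measurableT_comp => //; exact: measurable_fst.
  by apply: measurableT_comp => //; exact: measurable_snd.
have g0 yz : (0 <= g yz)%E by rewrite lee_fin mulr_ge0.
have prodE := @product_measure_unique _ _ _ _ R (distribution P eta') nu
  (distribution P J') .
transitivity (\int[distribution P J']_yz g yz)%E.
  rewrite ge0_integral_distribution//.
  by apply: eq_integral => w _; rewrite /g /= ger0_norm.
transitivity (\int[(distribution P eta') \x nu]_yz g yz)%E.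
  apply: eq_measure_integral => A mA _; apply/esym; apply: prodE => // A1 A2 mA1 mA2.
  exact: (indepZ (Geta _ mA1) mA2).
rewrite fubini_tonelli1//.
rewrite (eq_integral (fun y : R => `|y|%:E * \int[nu]_z (phi z)%:E)%E); last first.
  move=> y _; rewrite /fubini_F /g/=.
  under eq_integral do rewrite EFinM.
  rewrite ge0_integralZl//; first exact/measurable_EFinP.
  by move=> z _; rewrite lee_fin.
have mabs : measurable_fun setT (fun y : R => `|y|%:E).
  by apply/measurable_EFinP; exact: normr_measurable.
have abs0 (y : R) : setT y -> (0 <= `|y|%:E)%E by rewrite lee_fin.
have phi_ge0 : (0 <= \int[nu]_z (phi z)%:E)%E.
  by apply: integral_ge0 => z _; rewrite lee_fin.
rewrite (ge0_integralZr _ _ mabs abs0 phi_ge0)//.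
congr (_ * _)%E; rewrite ge0_integral_distribution//.
by apply: eq_integral => w _; rewrite /= ger0_norm.
Qed.

Lemma expect_indepM (eta : T -> R) (phi : R -> R) : measurable_wrt G eta -> L1 eta ->
  measurable_fun setT phi -> nu.-integrable setT (EFin \o phi) ->
  L1 (fun w => eta w * phi (Z w)) /\
  E[fun w => eta w * phi (Z w)] = E[eta] * \int[nu]_z phi z.
Proof.
move=> Geta L1eta mphi Iphi.
have GN (f : R -> R) : measurable_fun setT f -> measurable_wrt G (fun w => f (eta w)).
  move=> mf B mB; rewrite (_ : _ @^-1` B = eta @^-1` (f @^-1` B))//.
  by apply: Geta; rewrite -[X in measurable X]setTI; exact: mf.
have ge0 (e : R -> R) (f : R -> R) : measurable_fun setT e -> (forall y, 0 <= e y) ->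
    measurable_fun setT f -> (forall y, 0 <= f y) ->
    L1 (fun w => e (eta w)) -> nu.-integrable setT (EFin \o f) ->
    L1 (fun w => e (eta w) * f (Z w)) /\
    E[fun w => e (eta w) * f (Z w)] = E[fun w => e (eta w)] * \int[nu]_z f z.
  move=> me e0 mf f0 Ie If.
  have H := indep_ge0 (GN _ me) mf (fun w => e0 (eta w)) f0.
  have fin : (\int[P]_w (e (eta w) * f (Z w))%:E \is a fin_num)%E.
    by rewrite H fin_numM//; apply: integrable_fin_num.
  split; last by rewrite /Rintegral H fineM//; exact: integrable_fin_num.
  apply/integrableP; split.
    apply/measurable_EFinP; apply: measurable_funM; apply: measurableT_comp => //.
    exact: integrable_measurable L1eta.
  under eq_integral do rewrite /= ger0_norm ?mulr_ge0//.
  by rewrite ltey_eq fin.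
(* Both factors are split into positive and negative parts; the nonnegative case is applied to the
   four products, which are then recombined. *)
pose pos (y : R) := (y + `|y|) / 2.
pose neg (y : R) := (`|y| - y) / 2.
have posneg y : y = pos y - neg y by rewrite /pos /neg; lra.
have pos0 y : 0 <= pos y.
  by rewrite /pos divr_ge0// -lerBlDl sub0r -normrN ler_norm.
have neg0 y : 0 <= neg y by rewrite /neg divr_ge0// subr_ge0 ler_norm.
have mpos : measurable_fun setT pos.
  apply: measurable_funM => //; apply: measurable_funD => //.
have mneg : measurable_fun setT neg.
  apply: measurable_funM => //; apply: measurable_funB => //.
have posle y : `|pos y| <= `|y|.
  by rewrite ger0_norm// /pos; have := ler_norm y; lra.
have negle y : `|neg y| <= `|y|.
  by rewrite ger0_norm// /neg; have := ler_norm (- y); rewrite normrN; lra.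
have meta := integrable_measurable L1eta.
have Lp : L1 (fun w => pos (eta w)).
  exact: (integrable_rv_le (measurableT_comp mpos meta) (fun w => posle _) (integrable_rv_norm L1eta)).
have Ln : L1 (fun w => neg (eta w)).
  exact: (integrable_rv_le (measurableT_comp mneg meta) (fun w => negle _) (integrable_rv_norm L1eta)).
have mpphi : measurable_fun (setT : set (measurableTypeR R)) (pos \o phi).
  exact: (measurableT_comp mpos mphi).
have mnphi : measurable_fun (setT : set (measurableTypeR R)) (neg \o phi).
  exact: (measurableT_comp mneg mphi).
have Ip : nu.-integrable setT (EFin \o (pos \o phi)).
  exact: (@integrable_rv_le _ _ _ nu _ _ mpphi (fun w => posle _) (integrable_rv_norm Iphi)).
have In : nu.-integrable setT (EFin \o (neg \o phi)).
  exact: (@integrable_rv_le _ _ _ nu _ _ mnphi (fun w => negle _) (integrable_rv_norm Iphi)).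
have [Lpp Epp] := ge0 pos (pos \o phi) mpos pos0 mpphi (fun y => pos0 _) Lp Ip.
have [Lpn Epn] := ge0 pos (neg \o phi) mpos pos0 mnphi (fun y => neg0 _) Lp In.
have [Lnp Enp] := ge0 neg (pos \o phi) mneg neg0 mpphi (fun y => pos0 _) Ln Ip.
have [Lnn Enn] := ge0 neg (neg \o phi) mneg neg0 mnphi (fun y => neg0 _) Ln In.
have E : (fun w => eta w * phi (Z w)) =
  (fun w => (pos (eta w) * (pos \o phi) (Z w) - pos (eta w) * (neg \o phi) (Z w)) -
    (neg (eta w) * (pos \o phi) (Z w) - neg (eta w) * (neg \o phi) (Z w))).
  apply/funext => w; rewrite {1}(posneg (eta w)) {1}(posneg (phi (Z w))) /=; ring.
rewrite E; split; first by apply: integrable_rvB; exact: integrable_rvB.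
rewrite !expectB//; try exact: integrable_rvB.
rewrite Epp Epn Enp Enn.
have -> : E[eta] = E[fun w => pos (eta w)] - E[fun w => neg (eta w)].
  by rewrite -expectB//; apply: eq_Rintegral => w _; rewrite -posneg.
have -> : \int[nu]_z phi z = \int[nu]_z (pos \o phi) z - \int[nu]_z (neg \o phi) z.
  by rewrite -expectB//; apply: eq_Rintegral => w _; rewrite [LHS]posneg.
ring.
Qed.

End independent_increment.

(** * Stochastic integrals of simple processes *)

Section measurable_wrt_theory.
Context {R : realType} {d : measure_display} {T : measurableType d}.
Variable G : set (set T).
Hypothesis sG : sigma_algebra setT G.
Implicit Types f g : T -> R.

(** A sigma-algebra is generated by itself, so the closure properties below are inherited from
    measurable functions on [g_sigma_algebraType G]. *)
Lemma measurable_wrtP f :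
  measurable_wrt G f <-> measurable_fun setT (f : g_sigma_algebraType G -> R).
Proof.
have E : <<s G >> = G := sigma_algebra_id sG.
split=> [Gf _ B mB|mf B mB].
  by rewrite setTI; change (<<s G >> (f @^-1` B)); rewrite E; exact: Gf.
have := mf measurableT B mB; rewrite setTI.
by change (<<s G >> (f @^-1` B) -> G (f @^-1` B)); rewrite E.
Qed.

Lemma measurable_wrt_cst (k : R) : measurable_wrt G (fun=> k).
Proof. by apply/measurable_wrtP; exact: measurable_cst. Qed.

Lemma measurable_wrtD f g : measurable_wrt G f -> measurable_wrt G g ->
  measurable_wrt G (fun w => f w + g w).
Proof.
by move=> /measurable_wrtP hf /measurable_wrtP hg; apply/measurable_wrtP;
  exact: measurable_funD.
Qed.

Lemma measurable_wrtB f g : measurable_wrt G f -> measurable_wrt G g ->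
  measurable_wrt G (fun w => f w - g w).
Proof.
by move=> /measurable_wrtP hf /measurable_wrtP hg; apply/measurable_wrtP;
  exact: measurable_funB.
Qed.

Lemma measurable_wrtM f g : measurable_wrt G f -> measurable_wrt G g ->
  measurable_wrt G (fun w => f w * g w).
Proof.
by move=> /measurable_wrtP hf /measurable_wrtP hg; apply/measurable_wrtP;
  exact: measurable_funM.
Qed.

Lemma measurable_wrtX f n : measurable_wrt G f -> measurable_wrt G (fun w => f w ^+ n).
Proof.
by move=> /measurable_wrtP hf; apply/measurable_wrtP; exact: measurable_funX.
Qed.

Lemma measurable_wrt_comp (phi : R -> R) f : measurable_fun setT phi ->
  measurable_wrt G f -> measurable_wrt G (fun w => phi (f w)).
Proof.
move=> mphi Gf B mB; rewrite (_ : _ @^-1` B = f @^-1` (phi @^-1` B))//.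
by apply: Gf; rewrite -[X in measurable X]setTI; exact: mphi.
Qed.

Lemma measurable_wrt_sum n (F : nat -> T -> R) :
  (forall i, (i < n)%N -> measurable_wrt G (F i)) ->
  measurable_wrt G (fun w => \sum_(i < n) F i w).
Proof.
elim: n => [|n IH] GF.
  rewrite (_ : (fun w => _) = fun=> 0); first exact: measurable_wrt_cst.
  by apply/funext => w; rewrite big_ord0.
rewrite (_ : (fun w => _) = fun w => \sum_(i < n) F i w + F n w).
  apply: measurable_wrtD; last exact: GF.
  by apply: IH => i ni; apply: GF; exact: ltnW.
by apply/funext => w; rewrite big_ord_recr.
Qed.

End measurable_wrt_theory.

Section discrete_stochastic_integral.
Context {R : realType} {d : measure_display} {T : measurableType d}.
Variables (P : probability T R) (F : R -> set (set T)) (W : R -> T -> R).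
Hypothesis FP : complete_filtration P F.
Hypothesis WP : brownian_motion P F W.

Local Notation L1 f := (P.-integrable setT (EFin \o f)).
Local Notation "'E[' f ]" := (Rintegral P setT f).

Lemma filtration_sigma_algebra t : 0 <= t -> sigma_algebra setT (F t).
Proof. by case: FP => _ /(_ t) + _ _ => h /h []. Qed.

Lemma filtration_measurable t : 0 <= t -> F t `<=` measurable.
Proof. by case: FP => _ /(_ t) + _ _ => h /h []. Qed.

Lemma filtration_le (s t : R) (f : T -> R) : 0 <= s -> s <= t ->
  measurable_wrt (F s) f -> measurable_wrt (F t) f.
Proof. by case: FP => _ _ H _ s0 st h B mB; apply: (H s t) => //; exact: h. Qed.

Lemma adapted_measurable (X : R -> T -> R) t : adapted F X -> 0 <= t ->
  measurable_fun setT (X t).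
Proof.
move=> aX t0; apply: (@measurable_wrt_measurable _ _ _ (F t)); last exact: aX.
exact: filtration_measurable.
Qed.

Let dW s t w := W t w - W s w.

Let aW : adapted F W. Proof. by case: WP. Qed.

Let expect_incr_lt s t (eta : T -> R) k : 0 <= s -> s < t -> (k <= 4)%N ->
  measurable_wrt (F s) eta -> L1 eta ->
  L1 (fun w => eta w * dW s t w ^+ k) /\
  E[fun w => eta w * dW s t w ^+ k] =
    E[eta] * \int[normal_prob 0 (Num.sqrt (t - s))]_z z ^+ k.
Proof.
move=> s0 st k4 Feta Leta.
have t0 : 0 <= t := le_trans s0 (ltW st).
case: WP => _ _ _ /(_ s t s0 st) ind /(_ s t s0 st) law.
have sq0 : 0 < Num.sqrt (t - s) by rewrite sqrtr_gt0 subr_gt0.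
have mdW : measurable_fun setT (dW s t).
  by apply: measurable_funB; exact: adapted_measurable.
have ind' (A : set T) (B : set R) : F s A -> measurable B ->
    P (A `&` (dW s t) @^-1` B) = (P A * normal_prob 0 (Num.sqrt (t - s)) B)%E.
  by move=> FA mB; rewrite -law//; exact: ind.
have mX : measurable_fun setT (fun z : R => z ^+ k) by exact: measurable_funX.
exact: (expect_indepM (filtration_measurable s0) mdW ind' Feta Leta mX
  (integrable_rvX k4 (finite_moment4_normal_prob sq0))).
Qed.

(** The law of an increment is prescribed for [s < t] only. The degenerate case [s = t] has to be
    covered too, since a simple process may repeat times and truncating its partition creates
    repetitions. *)
Lemma expect_incr4 s t (eta : T -> R) : 0 <= s -> s <= t ->
  measurable_wrt (F s) eta -> L1 eta ->
  L1 (fun w => eta w * dW s t w ^+ 4) /\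
  E[fun w => eta w * dW s t w ^+ 4] = E[eta] * (3 * (t - s) ^+ 2).
Proof.
move=> s0; rewrite le_eqVlt => /predU1P[<- _ Leta|st Feta Leta].
  rewrite subrr expr0n !mulr0 (_ : (fun w => _) = fun=> 0).
    by split; [exact: integrable_rv_cst|exact: expect_cst].
  by apply/funext => w; rewrite /dW subrr expr0n mulr0.
have [? ->] := expect_incr_lt s0 st (isT : 4 <= 4)%N Feta Leta; split=> //.
have st0 : 0 < t - s by rewrite subr_gt0.
rewrite normal_prob_moment4 ?sqrtr_gt0//.
by rewrite (_ : 4%N = 2 * 2)%N// exprM sqr_sqrtr// ltW.
Qed.

Lemma expect_incr3 s t (eta : T -> R) : 0 <= s -> s <= t ->
  measurable_wrt (F s) eta -> L1 eta ->
  L1 (fun w => eta w * dW s t w ^+ 3) /\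
  E[fun w => eta w * dW s t w ^+ 3] = 0.
Proof.
move=> s0; rewrite le_eqVlt => /predU1P[<- _ Leta|st Feta Leta].
  rewrite (_ : (fun w => _) = fun=> 0).
    by split; [exact: integrable_rv_cst|exact: expect_cst].
  by apply/funext => w; rewrite /dW subrr expr0n mulr0.
have [? ->] := expect_incr_lt s0 st (isT : 3 <= 4)%N Feta Leta; split=> //.
by rewrite normal_prob_moment3 ?mulr0// sqrtr_gt0 subr_gt0.
Qed.

Lemma expect_incr2 s t (eta : T -> R) : 0 <= s -> s <= t ->
  measurable_wrt (F s) eta -> L1 eta ->
  L1 (fun w => eta w * dW s t w ^+ 2) /\
  E[fun w => eta w * dW s t w ^+ 2] = E[eta] * (t - s).
Proof.
move=> s0; rewrite le_eqVlt => /predU1P[<- _ Leta|st Feta Leta].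
  rewrite subrr !mulr0 (_ : (fun w => _) = fun=> 0).
    by split; [exact: integrable_rv_cst|exact: expect_cst].
  by apply/funext => w; rewrite /dW subrr expr0n mulr0.
have [? ->] := expect_incr_lt s0 st (isT : 2 <= 4)%N Feta Leta; split=> //.
have st0 : 0 < t - s by rewrite subr_gt0.
by rewrite normal_prob_moment2 ?sqrtr_gt0// sqr_sqrtr// ltW.
Qed.

Lemma expect_incr1 s t (eta : T -> R) : 0 <= s -> s <= t ->
  measurable_wrt (F s) eta -> L1 eta ->
  L1 (fun w => eta w * dW s t w) /\ E[fun w => eta w * dW s t w] = 0.
Proof.
move=> s0; rewrite le_eqVlt => /predU1P[<- _ Leta|st Feta Leta].
  rewrite (_ : (fun w => _) = fun=> 0).
    by split; [exact: integrable_rv_cst|exact: expect_cst].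
  by apply/funext => w; rewrite /dW subrr mulr0.
have [? E] := expect_incr_lt s0 st (isT : 1 <= 4)%N Feta Leta; split=> //.
apply: etrans E _.
have m1 := normal_prob_moment1 (_ : 0 < Num.sqrt (t - s)).
by rewrite [X in _ * X]m1 ?mulr0// sqrtr_gt0 subr_gt0.
Qed.

Lemma finite_moment4_incr s t : 0 <= s -> s <= t -> finite_moment4 P (fun w => W t w - W s w).
Proof.
move=> s0 st; split.
  by apply: measurable_funB; apply: adapted_measurable => //; exact: le_trans st.
have F1 : measurable_wrt (F s) (fun=> 1 : R).
  exact: (measurable_wrt_cst (filtration_sigma_algebra s0)).
have [+ _] := expect_incr4 s0 st F1 (integrable_rv_cst P 1).
by under eq_fun do rewrite mul1r.
Qed.

Section step_integral.
Variables (u : nat -> R) (v : nat -> T -> R) (K : R).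
Hypothesis u0 : 0 <= u 0%N.
Hypothesis uS : forall i, u i <= u i.+1.
Hypothesis Fv : forall i, measurable_wrt (F (u i)) (v i).
Hypothesis vK : forall i w, `|v i w| <= K.

Let J k w := \sum_(i < k) v i w * (W (u i.+1) w - W (u i) w).

Let u_le i j : (i <= j)%N -> u i <= u j.
Proof. by move/nondecreasing_seqP : uS; exact. Qed.

Let u_ge0 i : 0 <= u i. Proof. exact: le_trans (u_le (leq0n i)). Qed.

Let JS k w : J k.+1 w = J k w + v k w * dW (u k) (u k.+1) w.
Proof. by rewrite /J big_ord_recr. Qed.

Let FJ k : measurable_wrt (F (u k)) (J k).
Proof.
have sG := filtration_sigma_algebra (u_ge0 k).
apply: (measurable_wrt_sum sG (F := fun i w => v i w * (W (u i.+1) w - W (u i) w))).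
move=> i ik.
apply: (measurable_wrtM sG); first exact: (filtration_le (u_ge0 i) (u_le (ltnW ik))).
by apply: (measurable_wrtB sG); [apply: (filtration_le (u_ge0 i.+1) (u_le ik))|
  apply: (filtration_le (u_ge0 i) (u_le (ltnW ik)))]; exact: aW.
Qed.

Let mv i : measurable_fun setT (v i).
Proof. exact: measurable_wrt_measurable (filtration_measurable (u_ge0 i)) _ (Fv i). Qed.

Let K0 : 0 <= K. Proof. exact: le_trans (normr_ge0 _) (vK 0 point). Qed.

Lemma finite_moment4_step k : finite_moment4 P (J k).
Proof.
apply: finite_moment4_sum => i; apply: (finite_moment4Mb _ (vK i)) => //.
exact: finite_moment4_incr.
Qed.

(** The weight [xi] stands for conditioning: testing against bounded [F (u 0)]-measurable variables
    expresses that the step integral is a martingale increment. *)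
Lemma expect_step (xi : T -> R) (L : R) k : measurable_wrt (F (u 0%N)) xi ->
  (forall w, `|xi w| <= L) -> E[fun w => xi w * J k w] = 0.
Proof.
move=> Fxi xiL; elim: k => [|k IH].
  rewrite (_ : (fun w => _) = fun=> 0) ?expect_cst//.
  by apply/funext => w; rewrite /J big_ord0 mulr0.
have sG := filtration_sigma_algebra (u_ge0 k).
have Fxik : measurable_wrt (F (u k)) xi by exact: (filtration_le u0 (u_le (leq0n k))).
have mxi := measurable_wrt_measurable (filtration_measurable (u_ge0 k)) Fxik.
have Fk : measurable_wrt (F (u k)) (fun w => xi w * v k w).
  exact: (measurable_wrtM sG).
have Lk : L1 (fun w => xi w * v k w).
  apply: (integrable_rvMb mxi xiL); exact: (integrable_rv_bounded P (mv k) (vK k)).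
have [L1k E1k] := expect_incr1 (u_ge0 k) (uS k) Fk Lk.
rewrite -[RHS]addr0 -{1}IH -E1k -expectD//.
  by apply: eq_Rintegral => w _; rewrite JS mulrDr mulrA.
by apply: (integrable_rvMb mxi xiL); exact: integrable_rv4 (finite_moment4_step k).
Qed.

(** Ito's isometry, conditionally on [F (u 0)]. In the induction the cross term vanishes because
    [v k] and [J k] are known before the increment, and the squared increment averages to the length
    of the step. *)
Lemma expect_step_sqr (xi : T -> R) (L : R) k : measurable_wrt (F (u 0%N)) xi ->
  (forall w, `|xi w| <= L) ->
  E[fun w => xi w * J k w ^+ 2] =
  E[fun w => xi w * \sum_(i < k) v i w ^+ 2 * (u i.+1 - u i)].
Proof.
move=> Fxi xiL; elim: k => [|k IH].
  by apply: eq_Rintegral => w _; rewrite /J !big_ord0 expr0n.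
have sG := filtration_sigma_algebra (u_ge0 k).
have Fxik : measurable_wrt (F (u k)) xi by exact: (filtration_le u0 (u_le (leq0n k))).
have mxi := measurable_wrt_measurable (filtration_measurable (u_ge0 k)) Fxik.
have Fv2 : measurable_wrt (F (u k)) (fun w => xi w * v k w ^+ 2).
  by apply: (measurable_wrtM sG) => //; exact: measurable_wrtX.
have Lv2 : L1 (fun w => xi w * v k w ^+ 2).
  apply: (integrable_rvMb mxi xiL); apply: (@integrable_rv_bounded _ _ _ _ _ (K ^+ 2)).
    exact: measurable_funX.
  by move=> w; rewrite normrX lerXn2r ?nnegrE.
have FJv : measurable_wrt (F (u k)) (fun w => xi w * (v k w * J k w)).
  by apply: (measurable_wrtM sG) => //; exact: measurable_wrtM.
have LJv : L1 (fun w => xi w * (v k w * J k w)).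
  apply: (integrable_rvMb mxi xiL); apply: (integrable_rvMb _ (vK k)) => //.
  exact: integrable_rv4 (finite_moment4_step k).
have LJ2 : L1 (fun w => xi w * J k w ^+ 2).
  by apply: (integrable_rvMb mxi xiL); exact: (integrable_rvX _ (finite_moment4_step k)).
have [L1k E1k] := expect_incr1 (u_ge0 k) (uS k) FJv LJv.
have [L2k E2k] := expect_incr2 (u_ge0 k) (uS k) Fv2 Lv2.
have LQ : L1 (fun w => xi w * \sum_(i < k) v i w ^+ 2 * (u i.+1 - u i)).
  apply: (integrable_rvMb mxi xiL); apply: integrable_rv_sum => i.
  apply: (@integrable_rv_bounded _ _ _ _ _ (K ^+ 2 * (u i.+1 - u i))).
    by apply: measurable_funM => //; exact: measurable_funX.
  move=> w; rewrite normrM (ger0_norm (_ : 0 <= u i.+1 - u i)) ?subr_ge0//.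
  by rewrite ler_wpM2r ?subr_ge0// normrX lerXn2r ?nnegrE.
transitivity (E[fun w => xi w * J k w ^+ 2 +
   (2 * (xi w * (v k w * J k w) * dW (u k) (u k.+1) w) +
    xi w * v k w ^+ 2 * dW (u k) (u k.+1) w ^+ 2)]).
  by apply: eq_Rintegral => w _; rewrite JS; ring.
have L2' := integrable_rvZ 2 L1k.
rewrite expectD//; last exact: integrable_rvD.
rewrite expectD// expectZ// E1k mulr0 add0r E2k IH mulrC -expectZ// -expectD//.
  by apply: eq_Rintegral => w _; rewrite big_ord_recr/=; ring.
exact: integrable_rvZ.
Qed.

(** In the expansion of [(J k + v k * D) ^+ 4] the odd powers of [D] have mean zero, the square
    contributes at most [6 * K ^+ 4 * t * dt] by the isometry, and the fourth power at most
    [3 * K ^+ 4 * dt ^+ 2]: exactly what completes [3 * K ^+ 4 * t ^+ 2] to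
    [3 * K ^+ 4 * (t + dt) ^+ 2]. *)
Lemma expect_step_exp4 k : E[fun w => J k w ^+ 4] <= 3 * K ^+ 4 * (u k - u 0%N) ^+ 2.
Proof.
elim: k => [|k IH].
  rewrite (_ : (fun w => _) = fun=> 0).
    by rewrite expect_cst subrr expr0n mulr0.
  by apply/funext => w; rewrite /J big_ord0 expr0n.
have sG := filtration_sigma_algebra (u_ge0 k).
have hJ := finite_moment4_step k.
have mJ : measurable_fun setT (J k) by case: hJ.
have vX i w : `|v k w ^+ i| <= K ^+ i by rewrite normrX lerXn2r ?nnegrE.
have mvX i : measurable_fun setT (fun w => v k w ^+ i) by exact: measurable_funX.
have LvJ i j : (j <= 4)%N -> L1 (fun w => v k w ^+ i * J k w ^+ j).
  by move=> j4; apply: (integrable_rvMb (mvX i) (vX i)); exact: (integrable_rvX j4 hJ).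
have FvJ i j : measurable_wrt (F (u k)) (fun w => v k w ^+ i * J k w ^+ j).
  by apply: (measurable_wrtM sG); exact: measurable_wrtX.
have [L1k E1k] := expect_incr1 (u_ge0 k) (uS k) (FvJ 1 3)%N (@LvJ 1 3 isT)%N.
have [L2k E2k] := expect_incr2 (u_ge0 k) (uS k) (FvJ 2 2)%N (@LvJ 2 2 isT)%N.
have [L3k E3k] := expect_incr3 (u_ge0 k) (uS k) (FvJ 3 1)%N (@LvJ 3 1 isT)%N.
have [L4k E4k] := expect_incr4 (u_ge0 k) (uS k) (FvJ 4 0)%N (@LvJ 4 0 isT)%N.
pose D := dW (u k) (u k.+1).
have -> : (fun w => J k.+1 w ^+ 4) = (fun w => J k w ^+ 4 +
   (4 * (v k w ^+ 1 * J k w ^+ 3 * D w) + (6 * (v k w ^+ 2 * J k w ^+ 2 * D w ^+ 2) +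
    (4 * (v k w ^+ 3 * J k w ^+ 1 * D w ^+ 3) + v k w ^+ 4 * J k w ^+ 0 * D w ^+ 4)))).
  by apply/funext => w; rewrite JS -/D; ring.
have L1' := integrable_rvZ 4 L1k.
have L2' := integrable_rvZ 6 L2k.
have L3' := integrable_rvZ 4 L3k.
have L34 := integrable_rvD L3' L4k.
have L234 := integrable_rvD L2' L34.
have L4J : L1 (fun w => J k w ^+ 4) by case: hJ.
rewrite expectD//; last exact: integrable_rvD.
rewrite expectD// expectD// expectD// !expectZ//.
rewrite E1k E2k E3k E4k !mulr0 !add0r.
set dt := u k.+1 - u k.
have dt0 : 0 <= dt by rewrite subr_ge0.
pose t := u k - u 0%N.
have t0 : 0 <= t by rewrite subr_ge0 u_le.
have -> : u k.+1 - u 0%N = t + dt by rewrite /t /dt; lra.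
have B4 : E[fun w => v k w ^+ 4 * J k w ^+ 0] <= K ^+ 4.
  rewrite -[leRHS](expect_cst P); apply: expect_le; first exact: LvJ.
    exact: integrable_rv_cst.
  by move=> w; rewrite expr0 mulr1 (le_trans (ler_norm _)).
have B2 : E[fun w => v k w ^+ 2 * J k w ^+ 2] <= K ^+ 4 * t.
  have LJ2 : L1 (fun w => J k w ^+ 2) by exact: (integrable_rvX _ hJ).
  apply: le_trans (_ : K ^+ 2 * E[fun w => J k w ^+ 2] <= _).
    rewrite -expectZ//; apply: expect_le; [exact: LvJ|exact: integrable_rvZ|].
    by move=> w; rewrite ler_wpM2r ?sqr_ge0// (le_trans (ler_norm _)).
  rewrite (_ : 4 = 2 + 2)%N// exprD -mulrA ler_wpM2l ?sqr_ge0//.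
  have Fone : measurable_wrt (F (u 0%N)) (fun=> 1 : R).
    exact: (measurable_wrt_cst (filtration_sigma_algebra u0)).
  have one1 (w : T) : `|1 : R| <= 1 by rewrite normr1.
  have -> : E[fun w => J k w ^+ 2] = E[fun w => \sum_(i < k) v i w ^+ 2 * (u i.+1 - u i)].
    have := expect_step_sqr k Fone one1.
    rewrite (_ : (fun w => 1 * J k w ^+ 2) = (fun w => J k w ^+ 2)).
      by move=> ->; apply: eq_Rintegral => w _; rewrite mul1r.
    by apply/funext => w; rewrite mul1r.
  rewrite -[leRHS](expect_cst P); apply: expect_le.
  - apply: integrable_rv_sum => i.
    apply: (@integrable_rv_bounded _ _ _ _ _ (K ^+ 2 * (u i.+1 - u i))).
      by apply: measurable_funM => //; exact: measurable_funX.
    move=> w; rewrite normrM (ger0_norm (_ : 0 <= u i.+1 - u i)) ?subr_ge0//.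
    by rewrite ler_wpM2r ?subr_ge0// normrX lerXn2r ?nnegrE.
  - exact: integrable_rv_cst.
  - move=> w; rewrite /t -(telescope_sumr u (leq0n k)) big_mkord mulr_sumr.
    apply: ler_sum => i _; rewrite ler_wpM2r ?subr_ge0//.
    by rewrite -real_normK ?num_real// lerXn2r ?nnegrE.
apply: le_trans (lerD IH (lerD (ler_wpM2l (ler0n _ 6) (ler_wpM2r dt0 B2))
  (ler_wpM2r _ B4))) _.
  by rewrite mulr_ge0 ?sqr_ge0.
rewrite -/t le_eqVlt; apply/orP; left; apply/eqP; ring.
Qed.

End step_integral.

End discrete_stochastic_integral.

(** * Lenglart's inequality for step integrals *)

Section lenglart.
Context {R : realType} {d : measure_display} {T : measurableType d}.
Variables (P : probability T R) (F : R -> set (set T)) (W : R -> T -> R).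
Hypothesis FP : complete_filtration P F.
Hypothesis WP : brownian_motion P F W.

Local Notation L1 f := (P.-integrable setT (EFin \o f)).
Local Notation "'E[' f ]" := (Rintegral P setT f).

Variables (u : nat -> R) (v : nat -> T -> R) (K : R).
Hypothesis u0 : 0 <= u 0%N.
Hypothesis uS : forall i, u i <= u i.+1.
Hypothesis Fv : forall i, measurable_wrt (F (u i)) (v i).
Hypothesis vK : forall i w, `|v i w| <= K.

Let J k w := \sum_(i < k) v i w * (W (u i.+1) w - W (u i) w).
Let Q k w := \sum_(i < k) v i w ^+ 2 * (u i.+1 - u i).

Lemma chebyshev2 (f : T -> R) (e : R) : 0 < e -> finite_moment4 P f ->
  (P [set w | (e < `|f w|)%R] <= (E[fun w => f w ^+ 2] / e ^+ 2)%:E)%E.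
Proof.
move=> e0 hf; have [mf _] := hf.
have mA : measurable [set w | e < `|f w|] by exact: measurable_gt_norm.
have L2 : L1 (fun w => f w ^+ 2) by exact: (integrable_rvX _ hf).
rewrite -[leLHS]fineK ?fin_num_measure// lee_fin -expect_indic// mulrC -expectZ//.
apply: expect_le; [exact: integrable_rv_indic|exact: integrable_rvZ|move=> w].
rewrite indicE; case: (boolP (w \in _)) => [|_]; last first.
  by rewrite mulr_ge0 ?invr_ge0 ?sqr_ge0.
rewrite inE/= => ef; rewrite ler_pdivlMl ?exprn_gt0// mulr1.
by rewrite -[leRHS]real_normK ?num_real// lerXn2r ?nnegrE// ltW.
Qed.

(** The integrand is switched off before its quadratic variation exceeds [del]; the stopped integral
    has second moment at most [del] and coincides with [J k] unless [del < Q k]. The estimate does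
    not involve [K], so it is uniform along a sequence of integrands without common bound. *)
Lemma prob_step_le k (e del : R) : 0 < e -> 0 < del ->
  (P [set w | (e < `|J k w|)%R] <=
   P [set w | (del < `|Q k w|)%R] + (del / e ^+ 2)%:E)%E.
Proof.
move=> e0 del0.
have K0 : 0 <= K by exact: le_trans (normr_ge0 _) (vK 0 point).
have u_le i j : (i <= j)%N -> u i <= u j by move/nondecreasing_seqP : uS; exact.
have u_ge0 i : 0 <= u i by exact: le_trans (u_le _ _ (leq0n i)).
have Q0 j w : 0 <= Q j w.
  by apply: sumr_ge0 => i _; rewrite mulr_ge0 ?sqr_ge0// subr_ge0.
have QS j w : Q j.+1 w = Q j w + v j w ^+ 2 * (u j.+1 - u j).
  by rewrite /Q big_ord_recr.
have Qle i j w : (i <= j)%N -> Q i w <= Q j w.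
  have : nondecreasing_seq (Q ^~ w).
    apply/nondecreasing_seqP => m; rewrite QS lerDl mulr_ge0 ?sqr_ge0//.
    by rewrite subr_ge0.
  exact.
have FQ i : measurable_wrt (F (u i)) (Q i.+1).
  have sG := filtration_sigma_algebra FP (u_ge0 i).
  apply: (measurable_wrt_sum sG (F := fun i w => v i w ^+ 2 * (u i.+1 - u i))).
  move=> j; rewrite ltnS => ji; apply: (measurable_wrtM sG).
    by apply: (measurable_wrtX sG); exact: (filtration_le FP (u_ge0 j) (u_le _ _ ji)).
  exact: (measurable_wrt_cst sG).
(* The test uses [Q i.+1], not [Q i]: it already counts the current step, is still
   [F (u i)]-measurable because [v i] is, and so prevents any overshoot above [del]. *)
pose v' i w := v i w * (Q i.+1 w <= del)%R%:R.
have Fv' i : measurable_wrt (F (u i)) (v' i).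
  have sG := filtration_sigma_algebra FP (u_ge0 i).
  apply: (measurable_wrtM sG) => //.
  rewrite (_ : (fun w => _) = fun w => \1_(`]-oo, del] : set R) (Q i.+1 w)).
    exact: measurable_wrt_comp.
  by apply/funext => w; rewrite indicE mem_setE in_itv.
have v'K i w : `|v' i w| <= K.
  rewrite /v'; case: (Q i.+1 w <= del); rewrite ?mulr1//.
  by rewrite mulr0 normr0.
pose J' k w := \sum_(i < k) v' i w * (W (u i.+1) w - W (u i) w).
have Q'del w j : \sum_(i < j) v' i w ^+ 2 * (u i.+1 - u i) <= del.
  elim: j => [|j IH]; first by rewrite big_ord0 ltW.
  have [Qd|Qd] := leP (Q j.+1 w) del.
    apply: le_trans Qd; apply: ler_sum => i _.
    rewrite ler_wpM2r ?subr_ge0// /v'; case: (Q i.+1 w <= del); rewrite ?mulr1//.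
    by rewrite mulr0 expr0n sqr_ge0.
  have v'0 : v' j w = 0 by rewrite /v' leNgt Qd mulr0.
  by rewrite big_ord_recr/= v'0 expr0n mul0r addr0.
have h4 : finite_moment4 P (J' k) by exact: (finite_moment4_step FP WP u0 uS Fv' v'K).
have hJ : finite_moment4 P (J k) by exact: (finite_moment4_step FP WP u0 uS Fv vK).
have mQ : measurable_fun setT (Q k).
  case: k h4 hJ => [|k] _ _.
    rewrite (_ : Q 0%N = fun=> 0); first exact: measurable_cst.
    by apply/funext => w; rewrite /Q big_ord0.
  exact: (measurable_wrt_measurable (filtration_measurable FP (u_ge0 k)) (FQ k)).
have E2 : E[fun w => J' k w ^+ 2] <= del.
  have Fone : measurable_wrt (F (u 0%N)) (fun=> 1 : R).
    exact: (measurable_wrt_cst (filtration_sigma_algebra FP u0)).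
  have one1 (w : T) : `|1 : R| <= 1 by rewrite normr1.
  have := expect_step_sqr FP WP u0 uS Fv' v'K k Fone one1.
  rewrite (_ : (fun w => 1 * _) = (fun w => J' k w ^+ 2)); last first.
    by apply/funext => w; rewrite mul1r.
  move=> ->; rewrite -[leRHS](expect_cst P); apply: expect_le.
  - apply: (@integrable_rvMb _ _ _ _ (fun=> 1) _ 1) => //.
    apply: integrable_rv_sum => i.
    apply: (@integrable_rv_bounded _ _ _ _ _ (K ^+ 2 * (u i.+1 - u i))).
      apply: measurable_funM => //; apply: measurable_funX.
      exact: (measurable_wrt_measurable (filtration_measurable FP (u_ge0 i)) (Fv' i)).
    move=> w; rewrite normrM (ger0_norm (_ : 0 <= u i.+1 - u i)) ?subr_ge0//.
    by rewrite ler_wpM2r ?subr_ge0// normrX lerXn2r ?nnegrE.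
  - exact: integrable_rv_cst.
  - by move=> w; rewrite mul1r.
have JJ' w : Q k w <= del -> J' k w = J k w.
  move=> Qd; apply: eq_bigr => i _; congr (_ * _).
  by rewrite /v' (le_trans (Qle _ _ w (ltn_ord i)))// mulr1.
have mJ : measurable [set w | e < `|J k w|] by apply: measurable_gt_norm; case: hJ.
have mJ' : measurable [set w | e < `|J' k w|] by apply: measurable_gt_norm; case: h4.
have mQd : measurable [set w | del < `|Q k w|] by exact: measurable_gt_norm.
apply: (@le_trans _ _ (P ([set w | del < `|Q k w|] `|` [set w | e < `|J' k w|]))).
  apply: le_measure; rewrite ?inE//; first exact: measurableU.
  move=> w /= eJ; have [Qd|Qd] := leP (Q k w) del; first by right; rewrite JJ'.
  by left; rewrite ger0_norm.
apply: le_trans (measureU2 _ _ _) _ => //; rewrite leeD2l//.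
apply: le_trans (chebyshev2 e0 h4) _.
by rewrite lee_fin ler_wpM2r ?invr_ge0 ?sqr_ge0.
Qed.

End lenglart.

(** * Paths and increments of simple processes *)

Section simple_process_paths.
Context {R : realType} {d : measure_display} {T : measurableType d}.

(** For [s <= t], the projection onto [[s, t]]. It restricts partitions to a time interval, and
    later keeps the controlled process in [[a, b]]. *)
Definition truncate_to (s t x : R) : R := Num.max s (Num.min t x).

Lemma truncate_to_le (s t x y : R) : x <= y -> truncate_to s t x <= truncate_to s t y.
Proof. by move=> xy; rewrite /truncate_to le_max2// le_min2. Qed.

Lemma truncate_to_ge (s t x : R) : s <= truncate_to s t x.
Proof. by rewrite /truncate_to le_max lexx. Qed.

Lemma truncate_to_le_r (s t x : R) : s <= t -> truncate_to s t x <= t.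
Proof. by move=> st; rewrite /truncate_to ge_max st ge_min lexx. Qed.

(** Successive half-open intervals are disjoint, so at most one term of a simple process is active
    at a time. Hence a function fixing [0] can be applied to the values one by one. *)
Lemma active_interval (t_ : nat -> R) n (s : R) : (forall i, t_ i <= t_ i.+1) ->
  (forall i : 'I_n, \1_(`]t_ i, t_ i.+1] : set R) s = 0 :> R) \/
  exists j : 'I_n, forall i : 'I_n, \1_(`]t_ i, t_ i.+1] : set R) s = (i == j)%:R :> R.
Proof.
move=> tS.
have t_le i j : (i <= j)%N -> t_ i <= t_ j by move/nondecreasing_seqP : tS; exact.
case: (pickP (fun j : 'I_n => s \in `]t_ j, t_ j.+1])) => [j sj|h].
  right; exists j => i; rewrite indicE mem_setE.
  case: (eqVneq i j) => [->|ij]; first by rewrite sj.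
  rewrite (_ : (s \in _) = false)//; apply/negP; rewrite in_itv/= => /andP[si1 si2].
  move: sj; rewrite in_itv/= => /andP[sj1 sj2].
  move: ij; rewrite neq_ltn => /orP[ij|ji].
    by have := lt_le_trans sj1 si2; rewrite ltNge t_le.
  by have := lt_le_trans si1 sj2; rewrite ltNge t_le.
by left=> i; rewrite indicE mem_setE h.
Qed.

Definition map_process (g : nat -> R -> T -> R) (phi : simple_process) : @simple_process R d T :=
  SimpleProcess (sp_size phi) (sp_time phi) (fun i w => g i (sp_val phi i w) w).

Section one_process.
Variable phi : @simple_process R d T.
Hypothesis tS : forall i, sp_time phi i <= sp_time phi i.+1.

Lemma simple_eval_comp (g : R -> R) (s : R) w : g 0 = 0 ->
  simple_eval (map_process (fun _ x _ => g x) phi) s w = g (simple_eval phi s w).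
Proof.
move=> g0; rewrite /simple_eval/=.
have [h|[j h]] := active_interval (sp_size phi) s tS.
  by rewrite !big1 ?g0// => i _; rewrite h mulr0.
rewrite (bigD1 j)//= [in RHS](bigD1 j)//= !h eqxx !mulr1.
by rewrite !big1 ?addr0// => i /negbTE ij; rewrite h ij mulr0.
Qed.

Lemma simple_eval_sqr (s : R) w : simple_eval phi s w ^+ 2 =
  \sum_(i < sp_size phi) sp_val phi i w ^+ 2 * \1_`]sp_time phi i, sp_time phi i.+1] s.
Proof.
have := @simple_eval_comp (fun x => x ^+ 2) s w.
by rewrite expr0n /= => /(_ erefl) <-.
Qed.

Lemma lebesgue_measure_itv_inter (a b s t : R) : a <= b -> s <= t ->
  lebesgue_measure ((`]a, b] : set R) `&` `[s, t]) =
  (truncate_to s t b - truncate_to s t a)%:E.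
Proof.
move=> ab st.
have mI : measurable ((`]a, b] : set R) `&` `[s, t]) by exact: measurableI.
have hc := truncate_to_le s t ab.
have itvm (b0 b1 : bool) : lebesgue_measure
    [set` Interval (BSide b0 (truncate_to s t a)) (BSide b1 (truncate_to s t b))] =
    (truncate_to s t b - truncate_to s t a)%:E.
  rewrite lebesgue_measure_itv/= lte_fin; case: ltP => // hba.
  by rewrite (_ : truncate_to s t b = truncate_to s t a) ?subrr//; apply/le_anti/andP.
apply/eqP; rewrite eq_le; apply/andP; split.
  rewrite -(itvm true false); apply: le_measure; rewrite ?inE//.
  move=> x [/=]; rewrite !in_itv/= => /andP[ax xb] /andP[sx xt].
  by rewrite /truncate_to ge_max sx ge_min (ltW ax) orbT/= le_max le_min xt xb orbT.
rewrite -(itvm false false); apply: le_measure; rewrite ?inE//.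
move=> x /=; rewrite !in_itv/= /truncate_to gt_max gt_min le_max le_min.
move=> /andP[/andP[sx tax] xsb]; have xs : (x <= s) = false by rewrite leNgt sx.
move: xsb; rewrite xs/= => /andP[xt xb].
have tx : (t < x) = false by rewrite ltNge xt.
by move: tax; rewrite tx/= => ax; rewrite ax xb (ltW sx) xt.
Qed.

Lemma integral_simple_eval_sqr (s t : R) w : s <= t ->
  (\int[lebesgue_measure]_(x in `[s, t]) (simple_eval phi x w ^+ 2)%:E)%E =
  (\sum_(i < sp_size phi) sp_val phi i w ^+ 2 *
    (truncate_to s t (sp_time phi i.+1) - truncate_to s t (sp_time phi i)))%:E.
Proof.
move=> st.
under eq_integral do rewrite simple_eval_sqr -sumEFin.
rewrite ge0_integral_sum//=; last 2 first.
- move=> i; apply/measurable_EFinP; exact: measurable_funM.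
- by move=> i x _; rewrite lee_fin mulr_ge0 ?sqr_ge0.
rewrite -sumEFin; apply: eq_bigr => i _.
under eq_integral do rewrite EFinM.
rewrite ge0_integralZl//=.
- by rewrite integral_indic//= lebesgue_measure_itv_inter.
- exact/measurable_EFinP.
- by rewrite lee_fin sqr_ge0.
Qed.

(** This is a step integral along the partition truncated to [[s, t]], which starts no earlier than
    [s]. Values attached to times beyond [t] are replaced by [0]: their truncated time is [t], where
    they may not yet be known, and their increments vanish. *)
Lemma simple_integral_incr (W : R -> T -> R) (s t : R) w : s <= t ->
  simple_integral W phi t w - simple_integral W phi s w =
  \sum_(i < sp_size phi)
    (if sp_time phi i <= t then sp_val phi i w else 0) *
    (W (truncate_to s t (sp_time phi i.+1)) w - W (truncate_to s t (sp_time phi i)) w).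
Proof.
move=> st; rewrite /simple_integral -sumrB; apply: eq_bigr => i _.
have H x : W (Num.min t x) w - W (Num.min s x) w = W (truncate_to s t x) w - W s w.
  rewrite /truncate_to; have [xs|sx] := leP x s.
    have xt := le_trans xs st.
    by rewrite (min_r xt) subrr max_l ?subrr.
  by rewrite max_r// le_min st ltW.
have := H (sp_time phi i.+1); have := H (sp_time phi i).
case: ifPn => [_ h1 h2|]; first by rewrite -mulrBr; congr (_ * _); lra.
rewrite -ltNge => ti; rewrite mul0r => _ _.
have ti' := lt_le_trans ti (tS i).
rewrite !min_l ?ltW//; last 2 first.
- exact: (le_lt_trans st).
- exact: (le_lt_trans st).
by rewrite !(subrr, mulr0).
Qed.

Lemma truncated_val_sqr (s t : R) w : s <= t ->
  \sum_(i < sp_size phi) (if sp_time phi i <= t then sp_val phi i w else 0) ^+ 2 *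
    (truncate_to s t (sp_time phi i.+1) - truncate_to s t (sp_time phi i)) =
  \sum_(i < sp_size phi) sp_val phi i w ^+ 2 *
    (truncate_to s t (sp_time phi i.+1) - truncate_to s t (sp_time phi i)).
Proof.
move=> st; apply: eq_bigr => i _; case: ifPn => //; rewrite -ltNge => ti.
have ti' := lt_le_trans ti (tS i).
by rewrite /truncate_to !min_l ?ltW// !(subrr, mulr0).
Qed.

End one_process.

Lemma measurable_simple_eval (phi : @simple_process R d T) :
  (forall i, measurable_fun setT (sp_val phi i)) ->
  measurable_fun setT (fun p : R * T => simple_eval phi p.1 p.2).
Proof.
move=> mv; rewrite /simple_eval.
apply: (@measurable_sum _ _ _ setT _ (index_enum 'I_(sp_size phi))
  (fun (i : 'I_(sp_size phi)) (p : R * T) =>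
     sp_val phi i p.2 * \1_`]sp_time phi i, sp_time phi i.+1] p.1)) => i.
apply: measurable_funM; first exact: (measurableT_comp (mv i) measurable_snd).
exact: (measurableT_comp _ measurable_fst).
Qed.

Lemma measurable_fun_integral_param (f : R -> T -> R) (t0 s t : R) :
  measurable_fun (`[0, t0] `*` setT) (fun p : R * T => f p.1 p.2) ->
  (forall r w, 0 <= f r w) -> 0 <= s -> t <= t0 ->
  measurable_fun setT (fun w => \int[lebesgue_measure]_(r in `[s, t]) (f r w)%:E)%E.
Proof.
move=> mf f0 s0 tt0.
pose g (p : R * T) : \bar R := ((fun p : R * T => (f p.1 p.2)%:E) \_ (`[s, t] `*` setT)) p.
have mD : measurable (`[s, t] `*` setT : set (R * T)) by exact: measurableX.
have mf' : measurable_fun (`[s, t] `*` setT) (fun p : R * T => f p.1 p.2).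
  apply: (measurable_funS _ _ mf); first exact: measurableX.
  move=> [r w] /= [+ _]; rewrite !in_itv/= => /andP[sr rt].
  by rewrite (le_trans s0 sr) (le_trans rt tt0).
have mg : measurable_fun setT g.
  by apply: (measurable_restrictT _ mD).1; exact: (measurable_EFinP _ _).2 mf'.
have g0 p : (0 <= g p)%E by rewrite /g patchE; case: ifP => // _; rewrite lee_fin.
have := @measurable_fun_fubini_tonelli_G _ _ _ _ R lebesgue_measure g mg g0.
apply: eq_measurable_fun => w _; rewrite /fubini_G [RHS]integral_mkcond.
apply: eq_integral => r _; rewrite /g !patchE.
congr (if _ then _ else _); apply/idP/idP; rewrite !inE/=; first by case.
by [].
Qed.

End simple_process_paths.

Section limit_lemmas.
Context {R : realType} {d : measure_display} {T : measurableType d}.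
Variable P : probability T R.

Local Notation L1 f := (P.-integrable setT (EFin \o f)).
Local Notation "'E[' f ]" := (Rintegral P setT f).

(** The common scheme of the error estimates: [l] is fixed first, the part with the possibly huge
    constant [D] dies as [n] grows, and then [l] is arbitrary. *)
Lemma cvg_linear_bound (a b : nat -> R) (x C : R) : b n @[n --> \oo] --> 0 ->
  (forall l, 0 < l -> exists D, forall n, `|a n - x| <= C * l + D * b n) ->
  a n @[n --> \oo] --> x.
Proof.
move=> b0 H; apply/cvgrPdist_le => /= e e0.
have C1 : 0 < `|C| + 1 by rewrite ltr_wpDl.
pose l := e / 2 / (`|C| + 1).
have l0 : 0 < l by rewrite /l !divr_gt0.
have [D HD] := H _ l0.
have : D * b n @[n --> \oo] --> 0.
  by rewrite -[X in _ --> X](mulr0 D); apply: cvgM => //; exact: cvg_cst.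
move=> /cvgrPdist_le/(_ (e / 2) (divr_gt0 e0 (ltr0n _ 2))); apply: filterS => n.
rewrite sub0r normrN distrC => Db; apply: le_trans (HD n) _.
have Cl : C * l <= e / 2.
  apply: le_trans (ler_wpM2r (ltW l0) (ler_norm C)) _.
  rewrite /l mulrCA ler_piMr ?divr_ge0 ?(ltW e0)// ler_pdivrMr// mul1r lerDl//.
by have := le_trans (ler_norm _) Db; lra.
Qed.

Lemma cvg_prob0D (X Y : nat -> T -> R) :
  (forall n, measurable_fun setT (X n)) -> (forall n, measurable_fun setT (Y n)) ->
  cvg_prob0 P X -> cvg_prob0 P Y -> cvg_prob0 P (fun n w => X n w + Y n w).
Proof.
move=> mX mY cX cY e e0; have e20 : 0 < e / 2 by rewrite divr_gt0.
have cXY : (P [set w | (e / 2 < `|X n w|)%R] + P [set w | (e / 2 < `|Y n w|)%R])%E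
    @[n --> \oo] --> 0%E.
  by rewrite -[X in _ --> X]adde0; apply: cvgeD => //; [exact: cX|exact: cY].
apply: (squeeze_cvge _ (cvg_cst 0%E) cXY); apply: nearW => n.
apply/andP; split=> //.
have m1 : measurable [set w | e / 2 < `|X n w|] by exact: measurable_gt_norm.
have m2 : measurable [set w | e / 2 < `|Y n w|] by exact: measurable_gt_norm.
apply: (@le_trans _ _ (P ([set w | e / 2 < `|X n w|] `|` [set w | e / 2 < `|Y n w|]))).
  apply: le_measure; rewrite ?inE//.
  - by apply: measurable_gt_norm; exact: measurable_funD.
  - exact: measurableU.
  - move=> w /= h; have [xe|xe] := ltP (e / 2) `|X n w|; first by left.
    by right; have := ler_normD (X n w) (Y n w); lra.
exact: measureU2.
Qed.

Lemma norm_le_sqr (l x : R) : 0 < l -> `|x| <= l + l^-1 * x ^+ 2.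
Proof.
move=> l0; have [xl|lx] := leP `|x| l.
  by rewrite ler_wpDr// mulr_ge0 ?sqr_ge0// invr_ge0 ltW.
rewrite ler_wpDl ?(ltW l0)// -(real_normK (num_real x)) ler_pdivlMl//.
by rewrite expr2 ler_wpM2r// ltW.
Qed.

(** For the second limit, with [D] the difference, [Y_ n ^+ 2 - Y ^+ 2 = D ^+ 2 + 2 * Y * D], and
    Young's inequality bounds [|2 * Y * D|] by [l * Y ^+ 2 + l^-1 * D ^+ 2]. *)
Lemma cvg_L2_expect (Y_ : nat -> T -> R) (Y xi : T -> R) (L : R) :
  (forall n, finite_moment4 P (Y_ n)) -> finite_moment4 P Y ->
  measurable_fun setT xi -> (forall w, `|xi w| <= L) ->
  E[fun w => (Y_ n w - Y w) ^+ 2] @[n --> \oo] --> 0 ->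
  E[fun w => xi w * Y_ n w] @[n --> \oo] --> E[fun w => xi w * Y w] /\
  E[fun w => xi w * Y_ n w ^+ 2] @[n --> \oo] --> E[fun w => xi w * Y w ^+ 2].
Proof.
move=> hY_ hY mxi xiL cD.
have L0 : 0 <= L by exact: le_trans (normr_ge0 _) (xiL point).
have hD n : finite_moment4 P (fun w => Y_ n w - Y w) by exact: finite_moment4B.
have LD2 n : L1 (fun w => (Y_ n w - Y w) ^+ 2) by exact: (integrable_rvX _ (hD n)).
have LY2 : L1 (fun w => Y w ^+ 2) by exact: (integrable_rvX _ hY).
split.
- apply: (cvg_linear_bound cD (C := L)) => l l0; exists (L * l^-1) => n.
  have LD := integrable_rv4 (hD n).
  rewrite -expectB; last 2 first.
  + exact: (integrable_rvMb mxi xiL (integrable_rv4 (hY_ n))).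
  + exact: (integrable_rvMb mxi xiL (integrable_rv4 hY)).
  have LB : L1 (fun w => L * l + L * l^-1 * (Y_ n w - Y w) ^+ 2).
    by apply: integrable_rvD; [exact: integrable_rv_cst|exact: integrable_rvZ].
  apply: le_trans (_ : E[fun w => L * l + L * l^-1 * (Y_ n w - Y w) ^+ 2] <= _).
    apply: expect_norm_le => //.
      apply: integrable_rvB; first exact: (integrable_rvMb mxi xiL (integrable_rv4 (hY_ n))).
      exact: (integrable_rvMb mxi xiL (integrable_rv4 hY)).
    apply: aeW => w; rewrite -mulrBr normrM -mulrA -mulrDr.
    by rewrite ler_pM ?norm_le_sqr.
  rewrite expectD ?expect_cst ?expectZ//; first exact: integrable_rv_cst.
  exact: integrable_rvZ.
- apply: (cvg_linear_bound cD (C := L * E[fun w => Y w ^+ 2])) => l l0.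
  exists (L * (1 + l^-1)) => n.
  have LD := integrable_rv4 (hD n).
  have I1 : L1 (fun w => xi w * Y_ n w ^+ 2).
    by apply: (integrable_rvMb mxi xiL); exact: (integrable_rvX _ (hY_ n)).
  have I2 : L1 (fun w => xi w * Y w ^+ 2) by exact: (integrable_rvMb mxi xiL).
  rewrite -expectB//.
  have LB : L1 (fun w => L * l * Y w ^+ 2 + L * (1 + l^-1) * (Y_ n w - Y w) ^+ 2).
    by apply: integrable_rvD; exact: integrable_rvZ.
  apply: le_trans (_ : E[fun w => L * l * Y w ^+ 2 + L * (1 + l^-1) * (Y_ n w - Y w) ^+ 2] <= _).
    apply: expect_norm_le => //; first exact: integrable_rvB.
    apply: aeW => w; rewrite -mulrBr normrM -!mulrA -mulrDr.
    rewrite ler_pM//.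
    set D := Y_ n w - Y w.
    have -> : Y_ n w ^+ 2 - Y w ^+ 2 = D ^+ 2 + 2 * Y w * D by rewrite /D; ring.
    apply: le_trans (ler_normD _ _) _.
    rewrite (ger0_norm (sqr_ge0 _)).
    have -> : l * Y w ^+ 2 + (1 + l^-1) * D ^+ 2 = D ^+ 2 + (l * Y w ^+ 2 + l^-1 * D ^+ 2).
      by ring.
    rewrite lerD2l.
    have ln0 : l != 0 by rewrite gt_eqF.
    have il0 : 0 <= l^-1 by rewrite invr_ge0 ltW.
    rewrite ler_norml; apply/andP; split; rewrite -subr_ge0.
      rewrite (_ : _ - _ = l^-1 * (l * Y w + D) ^+ 2); first by rewrite mulr_ge0 ?sqr_ge0.
      by field.
    rewrite (_ : _ - _ = l^-1 * (l * Y w - D) ^+ 2); first by rewrite mulr_ge0 ?sqr_ge0.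
    by field.
  rewrite expectD ?expectZ//; try exact: integrable_rvZ.
  by rewrite mulrAC.
Qed.

End limit_lemmas.

(** * Ito integrals of bounded processes *)

Section ito_integral_moments.
Context {R : realType} {d : measure_display} {T : measurableType d}.
Variables (P : probability T R) (F : R -> set (set T)) (W : R -> T -> R).
Hypothesis FP : complete_filtration P F.
Hypothesis WP : brownian_motion P F W.

Local Notation L1 f := (P.-integrable setT (EFin \o f)).
Local Notation "'E[' f ]" := (Rintegral P setT f).
Local Notation leb := (@lebesgue_measure R).

Section simple_increment.
Variables (phi : @simple_process R d T) (K : R).
Hypothesis Hphi : simple_predictable F phi.
Hypothesis phiK : forall i w, `|sp_val phi i w| <= K.
Variables (s t : R).
Hypothesis s0 : 0 <= s.
Hypothesis st : s <= t.

Let u i := truncate_to s t (sp_time phi i).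
Let v i w := if sp_time phi i <= t then sp_val phi i w else 0.

Let tS i : sp_time phi i <= sp_time phi i.+1. Proof. by case: Hphi. Qed.
Let t_ge0 i : 0 <= sp_time phi i.
Proof.
elim: i => [|i IH]; first by case: Hphi.
exact: le_trans (tS i).
Qed.

Let u0 : 0 <= u 0%N. Proof. exact: le_trans (truncate_to_ge _ _ _). Qed.

Let uS i : u i <= u i.+1. Proof. exact: truncate_to_le. Qed.

Let Fv i : measurable_wrt (F (u i)) (v i).
Proof.
rewrite /v; have [ti|_] := boolP (sp_time phi i <= t).
  apply: (filtration_le FP (t_ge0 i)); last by case: Hphi.
  by rewrite /u /truncate_to le_max le_min ti lexx orbT.
apply: measurable_wrt_cst; apply: (filtration_sigma_algebra FP).
exact: le_trans (truncate_to_ge _ _ _).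
Qed.

Let vK i w : `|v i w| <= K.
Proof.
rewrite /v; case: ifP => // _; rewrite normr0.
exact: le_trans (normr_ge0 _) (phiK 0 w).
Qed.

Let Y w := simple_integral W phi t w - simple_integral W phi s w.

Let YE : Y = fun w => \sum_(i < sp_size phi) v i w * (W (u i.+1) w - W (u i) w).
Proof. by apply/funext => w; exact: simple_integral_incr. Qed.

Lemma finite_moment4_simple_incr : finite_moment4 P Y.
Proof. by rewrite YE; exact: (finite_moment4_step FP WP u0 uS Fv vK). Qed.

Lemma expect_simple_incr4 : E[fun w => Y w ^+ 4] <= 3 * K ^+ 4 * (t - s) ^+ 2.
Proof.
have K0 : 0 <= K by exact: le_trans (normr_ge0 _) (phiK 0 point).
rewrite YE; apply: le_trans (expect_step_exp4 FP WP u0 uS Fv vK _) _.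
rewrite ler_wpM2l ?mulr_ge0 ?exprn_ge0// lerXn2r ?nnegrE ?subr_ge0//.
  by have /nondecreasing_seqP := uS; exact.
by rewrite lerB// ?truncate_to_ge// truncate_to_le_r.
Qed.

Lemma expect_simple_incr (xi : T -> R) (L : R) : measurable_wrt (F s) xi ->
  (forall w, `|xi w| <= L) -> E[fun w => xi w * Y w] = 0.
Proof.
move=> Fxi xiL; rewrite YE; apply: (expect_step FP WP u0 uS Fv vK _ _ xiL).
exact: (filtration_le FP s0 (truncate_to_ge _ _ _)).
Qed.

Lemma expect_simple_incr_sqr (xi : T -> R) (L : R) : measurable_wrt (F s) xi ->
  (forall w, `|xi w| <= L) ->
  E[fun w => xi w * Y w ^+ 2] =
  E[fun w => xi w * \int[leb]_(r in `[s, t]) (simple_eval phi r w ^+ 2)].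
Proof.
move=> Fxi xiL; rewrite YE (expect_step_sqr FP WP u0 uS Fv vK _ _ xiL); last first.
  exact: (filtration_le FP s0 (truncate_to_ge _ _ _)).
apply: eq_Rintegral => w _; congr (_ * _).
by rewrite /Rintegral integral_simple_eval_sqr// truncated_val_sqr.
Qed.

Lemma prob_simple_incr_le (e del : R) : 0 < e -> 0 < del ->
  (P [set w | (e < `|Y w|)%R] <=
   P [set w | (del%:E < `|\int[leb]_(r in `[s, t]) (simple_eval phi r w ^+ 2)%:E|)%E] +
     (del / e ^+ 2)%:E)%E.
Proof.
move=> e0 del0; rewrite YE.
apply: le_trans (prob_step_le FP WP u0 uS Fv vK _ e0 del0) _.
rewrite leeD2r// le_eqVlt; apply/orP; left; apply/eqP; congr (P _).
apply/seteqP; split => w /=; by rewrite integral_simple_eval_sqr// truncated_val_sqr// lte_fin.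
Qed.

End simple_increment.

Lemma simple_predictable_map (phi : @simple_process R d T) (g : R -> R) (K : R) :
  measurable_fun setT g -> simple_predictable F phi ->
  (forall i w, `|g (sp_val phi i w)| <= K) ->
  simple_predictable F (map_process (fun _ x _ => g x) phi).
Proof.
move=> mg [t0 tS Fv _] gK; split=> //=; last by exists K.
by move=> i; apply: measurable_wrt_comp.
Qed.

Lemma simple_predictable_measurable (phi : @simple_process R d T) :
  simple_predictable F phi -> forall i, measurable_fun setT (sp_val phi i).
Proof.
move=> [t0 tS Fv _] i.
apply: (measurable_wrt_measurable _ (Fv i)); apply: (filtration_measurable FP).
by elim: i => // i; move/le_trans; apply.
Qed.

Lemma simple_integral0 (phi : @simple_process R d T) w :
  simple_predictable F phi -> simple_integral W phi 0 w = 0.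
Proof.
move=> [t0 tS _ _]; rewrite /simple_integral big1// => i _.
have tge0 j : 0 <= sp_time phi j by elim: j => // j; move/le_trans; apply.
by rewrite !min_l// subrr mulr0.
Qed.

Lemma cvg_in_probability0_EFin (Y : nat -> T -> R) :
  cvg_in_probability0 P (fun n w => (Y n w)%:E) -> cvg_prob0 P Y.
Proof.
move=> cY e e0; have := cY e e0.
rewrite (_ : (fun n => _) = (fun n => P [set w | (e < `|Y n w|)%R]))//.
Qed.

Lemma measurable_integral_gt (f : T -> \bar R) (e : R) : measurable_fun setT f ->
  measurable [set w | (e%:E < `|f w|)%E].
Proof.
move=> mf; have mnf : measurable_fun setT (fun w => `|f w|)%E by exact: measurableT_comp.
by have := emeasurable_fun_o_infty measurableT mnf e%:E; rewrite setTI.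
Qed.
End ito_integral_moments.

Section interval_integrals.
Context {R : realType} {d : measure_display} {T : measurableType d}.
Local Notation leb := (@lebesgue_measure R).

Lemma measurable_fun_section (f : R -> T -> R) (t0 : R) w :
  measurable_fun (`[0, t0] `*` setT : set (R * T)) (fun p : R * T => f p.1 p.2) ->
  measurable_fun `[0, t0] (f ^~ w).
Proof.
move=> mf.
apply: (@measurable_comp _ _ _ _ _ _ (`[0, t0] `*` setT : set (R * T))
  (fun p : R * T => f p.1 p.2) _ (fun r => (r, w))) => //.
- exact: measurableX.
- by move=> _ [r /= r0 <-].
- by apply: measurable_funTS; exact: pair2_measurable.
Qed.

Lemma integrable_itv_bounded (g : R -> R) (s t B : R) : measurable_fun `[s, t] g ->
  (forall r, s <= r <= t -> `|g r| <= B) -> leb.-integrable `[s, t] (EFin \o g).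
Proof.
move=> mg gB.
have fin : (lebesgue_measure (`[s, t] : set R) < +oo)%E.
  by rewrite lebesgue_measure_itv/=; case: ifP => // _; rewrite ltry.
apply: measurable_bounded_integrable => //.
exists B; split; first exact: num_real.
move=> x Bx r; rewrite /= in_itv/= => /gB.
by move=> /le_trans; apply; exact: ltW.
Qed.

Lemma Rintegral_itv_bound (g : R -> R) (s t B : R) : s <= t ->
  measurable_fun `[s, t] g -> (forall r, s <= r <= t -> `|g r| <= B) ->
  `|\int[leb]_(r in `[s, t]) g r| <= B * (t - s).
Proof.
move=> st mg gB; have Ig := integrable_itv_bounded mg gB.
apply: le_trans (le_normr_Rintegral _ Ig) _ => //.
apply: le_trans (_ : \int[leb]_(r in `[s, t]) B <= _).
  apply: le_Rintegral => //.
  - exact: (integrable_norm Ig).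
  - by apply: (integrable_itv_bounded (B := `|B|)) => //; exact: measurable_cst.
have lm : lebesgue_measure (`[s, t] : set R) = (t - s)%:E.
  rewrite lebesgue_measure_itv/= lte_fin; case: ltP => // ts.
  by rewrite (_ : t = s) ?subrr//; apply/le_anti/andP.
by rewrite Rintegral_cst// [X in fine X]lm.
Qed.

Lemma measurable_Rintegral_param (f : R -> T -> R) (t0 s t : R) :
  measurable_fun (`[0, t0] `*` setT : set (R * T)) (fun p : R * T => f p.1 p.2) ->
  (forall r w, 0 <= f r w) -> 0 <= s -> t <= t0 ->
  measurable_fun setT (fun w => \int[leb]_(r in `[s, t]) f r w).
Proof.
move=> mf f0 s0 tt0.
exact: (measurableT_comp _ (measurable_fun_integral_param mf f0 s0 tt0)).
Qed.

End interval_integrals.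

(** [clamp L x] is the point of [[-L, L]] closest to [x], and [y] lies in that interval. With [y] a
    value of the integrand, what clamping cuts off an approximation is no larger than the
    approximation error. *)
Lemma clamp_dist_le (R : realType) (L x y : R) : `|y| <= L ->
  `|x - clamp L x| <= `|x - y|.
Proof.
rewrite /clamp ler_norml => /andP[y1 y2].
have := ler_norm (x - y); have := ler_norm (- (x - y)); rewrite normrN => h1 h2.
rewrite ler_norml /Num.max /Num.min; do ! case: ifPn; rewrite -?leNgt => *;
  by apply/andP; split; lra.
Qed.

Section ito_limit.
Context {R : realType} {d : measure_display} {T : measurableType d}.
Variables (P : probability T R) (F : R -> set (set T)) (W : R -> T -> R).
Hypothesis FP : complete_filtration P F.
Hypothesis WP : brownian_motion P F W.

Local Notation L1 f := (P.-integrable setT (EFin \o f)).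
Local Notation "'E[' f ]" := (Rintegral P setT f).
Local Notation leb := (@lebesgue_measure R).

Variables (H M : R -> T -> R) (K : R).
Hypothesis HM : ito_integral P F W H M.
Hypothesis mH : forall t : R, 0 <= t ->
  measurable_fun (`[0, t] `*` setT : set (R * T)) (fun p : R * T => H p.1 p.2).
Hypothesis K0 : 0 <= K.
Hypothesis HK : {ae P, forall w, forall r, 0 <= r -> `|H r w| <= K}.

(** [H] is bounded almost surely, [H'] for every [w]; they agree at nonnegative times off a null
    set. *)
Let H' r w := clamp K (H r w).

Let aM : adapted F M. Proof. by case: HM. Qed.

Let mclamp : measurable_fun setT (clamp K : R -> R).
Proof. exact: measurable_clamp. Qed.

Let mH' (t : R) : 0 <= t -> measurable_fun (`[0, t] `*` setT : set (R * T)) (fun p : R * T => H' p.1 p.2).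
Proof. by move=> t0; exact: (measurableT_comp mclamp (mH t0)). Qed.

Let H'K r w : `|H' r w| <= K. Proof. exact: clamp_le. Qed.

Lemma measurable_simple_integral (phi : @simple_process R d T) (t : R) :
  simple_predictable F phi -> 0 <= t ->
  measurable_fun setT (fun w => simple_integral W phi t w).
Proof.
move=> hphi t0; have mv := simple_predictable_measurable FP hphi.
have tge0 j : 0 <= sp_time phi j.
  by case: hphi => [h tS _ _]; elim: j => // j; move/le_trans; apply.
have aW : adapted F W by case: WP.
rewrite /simple_integral.
apply: (@measurable_sum _ _ _ setT _ (index_enum 'I_(sp_size phi))
  (fun (i : 'I_(sp_size phi)) w => sp_val phi i w *
    (W (Num.min t (sp_time phi i.+1)) w - W (Num.min t (sp_time phi i)) w))) => i.
apply: measurable_funM => //; apply: measurable_funB;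
  by apply: (adapted_measurable FP) => //; rewrite le_min t0 tge0.
Qed.

(** All approximating simple integrals vanish at time [0], and [M 0] is their limit in
    probability. *)
Lemma ito_integral0 : {ae P, forall w, M 0 w = 0}.
Proof.
case: HM => _ _ _ _ [phi [hphi _ /(_ 0 (lexx 0)) c0]].
have mM : measurable_fun setT (M 0) by exact: (adapted_measurable FP).
have PM e : 0 < e -> P [set w | e < `|M 0 w|] = 0%E.
  move=> e0; have := cvg_in_probability0_EFin c0 e0.
  rewrite (_ : (fun n => _) = (fun=> P [set w | e < `|M 0 w|])); last first.
    apply/funext => n; congr (P _); apply/seteqP.
    by split => w /=; rewrite (simple_integral0 W w (hphi n)) sub0r normrN.
  by move/(cvg_lim (@ereal_hausdorff R)); rewrite lim_cst.
have : P.-negligible (\bigcup_n [set w | n.+1%:R^-1 < `|M 0 w|]).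
  apply: negligible_bigcup => n; exists [set w | n.+1%:R^-1 < `|M 0 w|].
  by split; [exact: measurable_gt_norm|exact: PM|].
apply: negligibleS => w /= /eqP; rewrite -normr_gt0 => M0.
have [n nM] := ltr_add_invr M0.
by exists n => //=; rewrite add0r in nM.
Qed.

Section increment.
Variables s t : R.
Hypothesis s0 : 0 <= s.
Hypothesis st : s <= t.
Let t0 : 0 <= t. Proof. exact: le_trans st. Qed.

(** The simple processes supplied by [ito_integral] have no common bound, so their fourth moments
    could not pass to the limit. Each is split into a clamped part [phiK n] and a residual [psi n];
    the residual is dominated by the approximation error, hence its integrals vanish in probability
    and the clamped parts keep the limit [M]. *)
Lemma ito_increment_approx : exists phi : nat -> @simple_process R d T,
  [/\ forall n, simple_predictable F (phi n),
      forall n i w, `|sp_val (phi n) i w| <= K,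
      cvg_prob0 P (fun n w => simple_integral W (phi n) t w -
        simple_integral W (phi n) s w - (M t w - M s w)) &
      E[fun w => \int[leb]_(r in `[s, t]) (simple_eval (phi n) r w - H' r w) ^+ 2]
        @[n --> \oo] --> 0].
Proof.
case: (HM) => _ _ _ _ [phi [hphi cphi cM]].
have mphi n := simple_predictable_measurable FP (hphi n).
have tS n i : sp_time (phi n) i <= sp_time (phi n) i.+1 by case: (hphi n).
pose phiK n := map_process (fun _ x _ => clamp K x) (phi n).
pose res (x : R) := x - clamp K x.
have mres : measurable_fun setT res by exact: measurable_funB.
have res0 : res 0 = 0 by rewrite /res clamp_id ?subr0// normr0.
pose psi n := map_process (fun _ x _ => res x) (phi n).
have phiK_le n i w : `|sp_val (phiK n) i w| <= K by exact: clamp_le.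
have hphiK n : simple_predictable F (phiK n).
  exact: (simple_predictable_map mclamp (hphi n) (phiK_le n)).
have psi_bd n : exists B, forall i w, `|sp_val (psi n) i w| <= B.
  case: (hphi n) => _ _ _ [B HB]; exists (B + B) => i w /=.
  apply: le_trans (ler_normB _ _) _; apply: lerD (HB i w) _.
  exact: le_trans (clamp_norm_le _ K0) (HB i w).
have hpsi n : simple_predictable F (psi n).
  by have [B HB] := psi_bd n; exact: (simple_predictable_map mres (hphi n) HB).
have evalK n r w : simple_eval (phiK n) r w = clamp K (simple_eval (phi n) r w).
  by rewrite simple_eval_comp// clamp_id// normr0.
have evalpsi n r w : simple_eval (psi n) r w = res (simple_eval (phi n) r w).
  by rewrite simple_eval_comp.
have mdiff (t1 : R) n : 0 <= t1 -> measurable_fun (`[0, t1] `*` setT : set (R * T))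
    (fun p : R * T => (simple_eval (phi n) p.1 p.2 - H p.1 p.2) ^+ 2).
  move=> t10; apply: measurable_funX; apply: measurable_funB; last exact: mH.
  by apply: measurable_funTS; exact: measurable_simple_eval.
have mI (t1 : R) n : 0 <= t1 -> measurable_fun setT (fun w =>
    \int[leb]_(r in `[0%R, t1]) ((simple_eval (phi n) r w - H r w) ^+ 2)%:E)%E.
  move=> t10.
  apply: (measurable_fun_integral_param
    (f := fun r w => (simple_eval (phi n) r w - H r w) ^+ 2) (mdiff _ _ t10)) => //.
  by move=> r w; exact: sqr_ge0.
have cI (t1 : R) : 0 <= t1 -> forall e, 0 < e -> fine (P [set w | (e%:E <
    `|\int[leb]_(r in `[0%R, t1]) ((simple_eval (phi n) r w - H r w) ^+ 2)%:E|)%E])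
    @[n --> \oo] --> 0.
  by move=> t10 e e0; apply: fine_cvg; exact: cphi.
(* One comparison used twice, for the squared residual and for the squared error of the clamped
   process: both are dominated by the squared error of [phi n], whose integral tends to [0] in
   probability. *)
have le_prob (t1 t2 e : R) n (f : R -> T -> R) : 0 <= t2 -> 0 <= t1 -> 0 < e ->
    (forall r w, 0 <= f r w) ->
    measurable_fun (`[0, t1] `*` setT : set (R * T)) (fun p : R * T => f p.1 p.2) ->
    {ae P, forall w, forall r, 0 <= r -> f r w <= (simple_eval (phi n) r w - H r w) ^+ 2} ->
    (P [set w | (e%:E < `|\int[leb]_(r in `[t2, t1]) (f r w)%:E|)%E] <=
     P [set w | (e%:E < `|\int[leb]_(r in `[0%R, t1])
        ((simple_eval (phi n) r w - H r w) ^+ 2)%:E|)%E])%E.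
  move=> t20 t10 e0 f0 mf [N [mN N0 HN]].
  have m1 := measurable_integral_gt e (measurable_fun_integral_param mf f0 t20 (lexx t1)).
  have m2 := measurable_integral_gt e (mI t1 n t10).
  apply: (@le_trans _ _ (P ([set w | (e%:E < `|\int[leb]_(r in `[0%R, t1])
        ((simple_eval (phi n) r w - H r w) ^+ 2)%:E|)%E] `|` N))); last first.
    apply: le_trans (measureU2 _ _ _) _ => //.
    by rewrite [X in (_ + X)%E](_ : _ = 0%E) ?adde0.
  apply: le_measure; rewrite ?inE//; first exact: measurableU.
  move=> w /= ew; have [wN|wN] := pselect (N w); [by right|left].
  apply: (lt_le_trans ew).
  have Hw : forall r, 0 <= r -> f r w <= (simple_eval (phi n) r w - H r w) ^+ 2.
    by apply: contrapT => h; apply: wN; apply: HN.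
  have fm := measurable_fun_section w mf.
  have gm := measurable_fun_section
    (f := fun r w => (simple_eval (phi n) r w - H r w) ^+ 2) w (mdiff t1 n t10).
  rewrite !gee0_abs; try by apply: integral_ge0 => r _; rewrite lee_fin ?sqr_ge0.
  apply: (@le_trans _ _ (\int[leb]_(r in `[0%R, t1]) (f r w)%:E)%E).
    apply: ge0_subset_integral => //.
    - exact/measurable_EFinP.
    - by move=> r _; rewrite lee_fin.
    - by move=> r /=; rewrite !in_itv/= => /andP[h ->]; rewrite (le_trans t20 h).
  apply: ge0_le_integral => //.
  - by move=> r _; rewrite lee_fin.
  - exact/measurable_EFinP.
  - exact/measurable_EFinP.
  - by move=> r /=; rewrite in_itv/= => /andP[r0 _]; rewrite lee_fin; exact: Hw.
have mSIpsi (t1 : R) n (e : R) : 0 <= t1 ->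
    measurable [set w | e < `|simple_integral W (psi n) t1 w|].
  by move=> t10; apply: measurable_gt_norm; exact: measurable_simple_integral.
have cpsi (t1 : R) : 0 <= t1 -> cvg_prob0 P (fun n w => simple_integral W (psi n) t1 w).
  move=> t10 e e0; apply: cvg_EFin; first by apply: nearW => n; apply: fin_num_measure; exact: mSIpsi.
  apply/cvgrPdist_le => /= a a0.
  (* With this choice the term [del / e ^+ 2] of Lenglart's inequality is [a / 2]; the other one
     falls below [a / 2] for large [n]. *)
  pose del := a / 2 * e ^+ 2.
  have del0 : 0 < del by rewrite mulr_gt0 ?exprn_gt0 ?divr_gt0.
  have /cvgrPdist_le/(_ (a / 2) (divr_gt0 a0 (ltr0n _ 2))) := cI _ t10 _ del0.
  apply: filterS => n; rewrite !sub0r !normrN !ger0_norm ?fine_ge0// => h.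
  have [B HB] := psi_bd n.
  have := prob_simple_incr_le FP WP (hpsi n) HB (lexx 0) t10 e0 del0.
  rewrite (_ : [set w | e < `|simple_integral W (psi n) t1 w - simple_integral W (psi n) 0 w|] =
     [set w | e < `|simple_integral W (psi n) t1 w|]); last first.
    by apply/seteqP; split => w /=; rewrite (simple_integral0 W w (hpsi n)) subr0.
  move=> h1.
  have mpsi : measurable_fun (`[0, t1] `*` setT : set (R * T))
      (fun p : R * T => simple_eval (psi n) p.1 p.2 ^+ 2).
    apply: measurable_funTS; apply: measurable_funX; apply: measurable_simple_eval.
    exact: (simple_predictable_measurable FP (hpsi n)).
  have h2 := @le_prob t1 0 del n (fun r w => simple_eval (psi n) r w ^+ 2)
     (lexx 0) t10 del0 (fun r w => sqr_ge0 _) mpsi.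
  have h3 : {ae P, forall w, forall r, 0 <= r ->
      simple_eval (psi n) r w ^+ 2 <= (simple_eval (phi n) r w - H r w) ^+ 2}.
    apply: filterS HK => w Hw r r0; rewrite evalpsi /res.
    rewrite -(real_normK (num_real (_ - clamp _ _))) -[leRHS]real_normK ?num_real//.
    by rewrite lerXn2r ?nnegrE//; apply: clamp_dist_le; exact: Hw.
  have := le_trans h1 (leeD2r _ (h2 h3)).
  rewrite -[X in (_ <= X + _)%E -> _]fineK; last first.
    by apply: fin_num_measure; apply: measurable_integral_gt; exact: mI.
  rewrite -EFinD -[X in (X <= _)%E -> _]fineK; last first.
    by apply: fin_num_measure; exact: mSIpsi.
  rewrite lee_fin => /le_trans; apply.
  have -> : a = a / 2 + del / e ^+ 2.
    by rewrite /del; field; rewrite gt_eqF.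
  by rewrite lerD2r.
have cK (t1 : R) : 0 <= t1 -> cvg_prob0 P (fun n w => simple_integral W (phiK n) t1 w - M t1 w).
  move=> t10.
  have -> : (fun n w => simple_integral W (phiK n) t1 w - M t1 w) =
     (fun n w => (simple_integral W (phi n) t1 w - M t1 w) +
        - simple_integral W (psi n) t1 w).
    apply/funext => n; apply/funext => w; rewrite addrAC; congr (_ - _).
    rewrite /simple_integral -sumrB; apply: eq_bigr => i _ /=.
    by rewrite -mulrBl /res subKr.
  have mM : measurable_fun setT (M t1) by exact: (adapted_measurable FP).
  apply: cvg_prob0D.
  - by move=> n; apply: measurable_funB => //; exact: measurable_simple_integral.
  - by move=> n; apply: measurableT_comp => //; exact: measurable_simple_integral.
  - by apply: cvg_in_probability0_EFin; exact: cM.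
  - move=> e e0; have := cpsi _ t10 e e0.
    by under eq_fun do (under eq_set do rewrite -normrN).
exists phiK; split=> //.
- have -> : (fun n w => simple_integral W (phiK n) t w -
      simple_integral W (phiK n) s w - (M t w - M s w)) =
     (fun n w => (simple_integral W (phiK n) t w - M t w) +
        - (simple_integral W (phiK n) s w - M s w)).
    by apply/funext => n; apply/funext => w; ring.
  have m1 (r : R) n : 0 <= r ->
      measurable_fun setT (fun w => simple_integral W (phiK n) r w - M r w).
    move=> r0; apply: measurable_funB; first exact: measurable_simple_integral.
    exact: (adapted_measurable FP).
  apply: cvg_prob0D.
  - by move=> n; exact: m1.
  - by move=> n; apply: measurableT_comp => //; exact: m1.
  - exact: cK.
  - move=> e e0; have := cK _ s0 e e0.
    by under eq_fun do (under eq_set do rewrite -normrN).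
- pose q n w := \int[leb]_(r in `[s, t]) (simple_eval (phiK n) r w - H' r w) ^+ 2.
  have mq0 n : measurable_fun (`[0, t] `*` setT : set (R * T))
      (fun p : R * T => (simple_eval (phiK n) p.1 p.2 - H' p.1 p.2) ^+ 2).
    apply: measurable_funX; apply: measurable_funB; last exact: mH'.
    apply: measurable_funTS; apply: measurable_simple_eval.
    exact: (simple_predictable_measurable FP (hphiK n)).
  have mq n : measurable_fun setT (q n).
    apply: (measurable_Rintegral_param
      (f := fun r w => (simple_eval (phiK n) r w - H' r w) ^+ 2) (mq0 n)) => //.
    by move=> r w; exact: sqr_ge0.
  have bd n r w : `|(simple_eval (phiK n) r w - H' r w) ^+ 2| <= (K + K) ^+ 2.
    rewrite normrX lerXn2r ?nnegrE ?addr_ge0//.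
    by apply: le_trans (ler_normB _ _) _; rewrite lerD// evalK clamp_le.
  have sect n w : measurable_fun `[s, t]
      (fun r => (simple_eval (phiK n) r w - H' r w) ^+ 2).
    have := measurable_fun_section
      (f := fun r w => (simple_eval (phiK n) r w - H' r w) ^+ 2) w (mq0 n).
    apply: measurable_funS => // r; rewrite /= !in_itv/= => /andP[sr ->].
    by rewrite (le_trans s0 sr).
  have qb n w : `|q n w| <= (K + K) ^+ 2 * (t - s).
    by apply: Rintegral_itv_bound => // r _; exact: bd.
  have q0 n w : 0 <= q n w by apply: Rintegral_ge0 => r _; exact: sqr_ge0.
  have cq : E[fun w => `|q n w|] @[n --> \oo] --> 0.
    have qb2 n w : `|q n w ^+ 2| <= ((K + K) ^+ 2 * (t - s)) ^+ 2.
      have B0 : 0 <= (K + K) ^+ 2 * (t - s) by exact: le_trans (normr_ge0 _) (qb n w).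
      by rewrite normrX lerXn2r ?nnegrE.
    have Lq2 n : L1 (fun w => q n w ^+ 2).
      by apply: (integrable_rv_bounded _ _ (qb2 n)); exact: measurable_funX.
    apply: (@cvg_prob0_expect_norm _ _ _ _ _ (((K + K) ^+ 2 * (t - s)) ^+ 2)) => //.
    + move=> n; rewrite -[leRHS](expect_cst P); apply: expect_le => //.
        exact: integrable_rv_cst.
      by move=> w; exact: le_trans (ler_norm _) (qb2 n w).
    + move=> e e0; apply: (squeeze_cvge _ (cvg_cst 0%E) (cphi t t0 e e0)).
      apply: nearW => n; apply/andP; split=> //.
      have := @le_prob t s e n (fun r w => (simple_eval (phiK n) r w - H' r w) ^+ 2)
        s0 t0 e0 (fun r w => sqr_ge0 _) (mq0 n).
      have h : {ae P, forall w, forall r, 0 <= r -> (simple_eval (phiK n) r w - H' r w) ^+ 2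
          <= (simple_eval (phi n) r w - H r w) ^+ 2}.
        apply: aeW => w r _; rewrite evalK.
        rewrite -[leLHS]real_normK ?num_real// -[leRHS]real_normK ?num_real//.
        by rewrite lerXn2r ?nnegrE// clamp_lipschitz.
      move=> /(_ h); congr (P _ <= _)%E.
      apply/seteqP; split => w /=.
        rewrite -[X in `|X|%E]fineK ?lte_fin//.
        by apply: integrable_fin_num => //; apply: integrable_itv_bounded => // r _; exact: bd.
      rewrite -[X in (_ < `|X|)%E]fineK ?lte_fin//.
      by apply: integrable_fin_num => //; apply: integrable_itv_bounded => // r _; exact: bd.
  rewrite (_ : (fun n => _) = (fun n => E[fun w => `|q n w|]))//.
  by apply/funext => n; apply: eq_Rintegral => w _; rewrite ger0_norm.
Qed.

Lemma ito_increment_moment4 : finite_moment4 P (fun w => M t w - M s w) /\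
  E[fun w => (M t w - M s w) ^+ 4] <= 3 * K ^+ 4 * (t - s) ^+ 2.
Proof.
have [phi [hphi phiK cphi _]] := ito_increment_approx.
apply: (cvg_prob0_moment4 _ _ _ cphi).
- by move=> n; exact: (finite_moment4_simple_incr FP WP (hphi n) (phiK n) s0 st).
- by apply: measurable_funB; exact: (adapted_measurable FP).
- by move=> n; exact: (expect_simple_incr4 FP WP (hphi n) (phiK n) s0 st).
Qed.

(** Both identities hold for simple integrals and are carried over by convergence in mean square;
    the fourth moment bound is what upgrades convergence in probability to it. *)
Lemma expect_ito_increment (xi : T -> R) (L : R) : measurable_wrt (F s) xi ->
  (forall w, `|xi w| <= L) ->
  E[fun w => xi w * (M t w - M s w)] = 0 /\
  E[fun w => xi w * (M t w - M s w) ^+ 2] =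
  E[fun w => xi w * \int[leb]_(r in `[s, t]) (H' r w ^+ 2)].
Proof.
move=> Fxi xiL; have [phi [hphi phiK cphi cH]] := ito_increment_approx.
have L0 : 0 <= L by exact: le_trans (normr_ge0 _) (xiL point).
have h4 n := finite_moment4_simple_incr FP WP (hphi n) (phiK n) s0 st.
have mxi := measurable_wrt_measurable (filtration_measurable FP s0) Fxi.
have mM : measurable_fun setT (fun w => M t w - M s w).
  by apply: measurable_funB; exact: (adapted_measurable FP).
have b4 n := expect_simple_incr4 FP WP (hphi n) (phiK n) s0 st.
have cL2 := cvg_prob0_cvg_L2 h4 mM b4 cphi.
have [hM _] := ito_increment_moment4.
have [c1 c2] := cvg_L2_expect h4 hM mxi xiL cL2.
split.
  rewrite -(cvg_lim (@Rhausdorff R) c1).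
  rewrite (_ : (fun n => _) = (fun=> 0)) ?lim_cst//.
  by apply/funext => n; exact: (expect_simple_incr FP WP (hphi n) (phiK n) s0 st Fxi xiL).
rewrite -(cvg_lim (@Rhausdorff R) c2); apply/cvg_lim; first exact: Rhausdorff.
rewrite (_ : (fun n => _) = (fun n => E[fun w => xi w *
    \int[leb]_(r in `[s, t]) (simple_eval (phi n) r w ^+ 2)])); last first.
  by apply/funext => n; exact: (expect_simple_incr_sqr FP WP (hphi n) (phiK n) s0 st Fxi xiL).
have tS n i : sp_time (phi n) i <= sp_time (phi n) i.+1 by case: (hphi n).
have evK n r w : `|simple_eval (phi n) r w| <= K.
  rewrite /simple_eval; have [h1|[j h1]] := active_interval (sp_size (phi n)) r (tS n).
    by rewrite big1 ?normr0// => i _; rewrite h1 mulr0.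
  rewrite (bigD1 j)//= h1 eqxx mulr1 big1 ?addr0//.
  by move=> i /negbTE ij; rewrite h1 ij mulr0.
have sub0t : (`[s, t] : set R) `<=` `[0, t].
  by move=> r; rewrite /= !in_itv/= => /andP[sr ->]; rewrite (le_trans s0 sr).
have mev n w : measurable_fun `[s, t] (fun r => simple_eval (phi n) r w).
  have := @measurable_fun_section _ _ _ (simple_eval (phi n)) t w.
  move=> /(_ (measurable_funTS (measurable_simple_eval
     (simple_predictable_measurable FP (hphi n))))).
  exact: measurable_funS.
have mHw w : measurable_fun `[s, t] (fun r => H' r w).
  by have := measurable_fun_section w (mH' t0); exact: measurable_funS.
have I1 n w : leb.-integrable `[s, t] (EFin \o (fun r => simple_eval (phi n) r w ^+ 2)).
  apply: (integrable_itv_bounded (B := K ^+ 2)); first exact: measurable_funX.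
  by move=> r _; rewrite normrX lerXn2r ?nnegrE.
have I2 w : leb.-integrable `[s, t] (EFin \o (fun r => H' r w ^+ 2)).
  apply: (integrable_itv_bounded (B := K ^+ 2)); first exact: measurable_funX.
  by move=> r _; rewrite normrX lerXn2r ?nnegrE.
have I3 n w : leb.-integrable `[s, t] (EFin \o (fun r => (simple_eval (phi n) r w - H' r w) ^+ 2)).
  apply: (integrable_itv_bounded (B := (K + K) ^+ 2)).
    by apply: measurable_funX; exact: measurable_funB.
  move=> r _; rewrite normrX lerXn2r ?nnegrE ?addr_ge0//.
  by apply: le_trans (ler_normB _ _) _; exact: lerD.
pose A n w := \int[leb]_(r in `[s, t]) (simple_eval (phi n) r w ^+ 2).
pose B w := \int[leb]_(r in `[s, t]) (H' r w ^+ 2).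
pose q n w := \int[leb]_(r in `[s, t]) (simple_eval (phi n) r w - H' r w) ^+ 2.
have mev2 n : measurable_fun (`[0, t] `*` setT : set (R * T))
    (fun p : R * T => simple_eval (phi n) p.1 p.2).
  apply: measurable_funTS; apply: measurable_simple_eval.
  exact: (simple_predictable_measurable FP (hphi n)).
have mA n : measurable_fun setT (A n).
  apply: (measurable_Rintegral_param (f := fun r w => simple_eval (phi n) r w ^+ 2)
    (t0 := t)) => //; first exact: measurable_funX.
  by move=> r w; exact: sqr_ge0.
have mB : measurable_fun setT B.
  apply: (measurable_Rintegral_param (f := fun r w => H' r w ^+ 2) (t0 := t)) => //.
    by apply: measurable_funX; exact: mH'.
  by move=> r w; exact: sqr_ge0.
have mq n : measurable_fun setT (q n).
  apply: (measurable_Rintegral_param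
    (f := fun r w => (simple_eval (phi n) r w - H' r w) ^+ 2) (t0 := t)) => //.
    by apply: measurable_funX; apply: measurable_funB => //; exact: mH'.
  by move=> r w; exact: sqr_ge0.
have LA n : L1 (fun w => xi w * A n w).
  apply: (integrable_rvMb mxi xiL).
  apply: (@integrable_rv_bounded _ _ _ _ _ (K ^+ 2 * (t - s))) => // w.
  apply: Rintegral_itv_bound => //; first exact: measurable_funX.
  by move=> r _; rewrite normrX lerXn2r ?nnegrE.
have LB : L1 (fun w => xi w * B w).
  apply: (integrable_rvMb mxi xiL).
  apply: (@integrable_rv_bounded _ _ _ _ _ (K ^+ 2 * (t - s))) => // w.
  apply: Rintegral_itv_bound => //; first exact: measurable_funX.
  by move=> r _; rewrite normrX lerXn2r ?nnegrE.
have Lq n : L1 (q n).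
  apply: (@integrable_rv_bounded _ _ _ _ _ ((K + K) ^+ 2 * (t - s))) => // w.
  apply: Rintegral_itv_bound => //.
    by apply: measurable_funX; exact: measurable_funB.
  move=> r _; rewrite normrX lerXn2r ?nnegrE ?addr_ge0//.
  by apply: le_trans (ler_normB _ _) _; exact: lerD.
have Icst (k : R) : leb.-integrable `[s, t] (EFin \o (fun=> k)).
  by apply: (integrable_itv_bounded (B := `|k|)) => //; exact: measurable_cst.
have I12 n w : leb.-integrable `[s, t]
    (EFin \o (fun r => simple_eval (phi n) r w ^+ 2 - H' r w ^+ 2)).
  exact: (@integrableB _ (measurableTypeR R) R leb _ (measurable_itv `[s, t]) _ _
    (I1 n w) (I2 w)).
(* From [x ^+ 2 - y ^+ 2 = (x + y) * (x - y)], with [|x + y| <= 2 * K] and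
   [|x - y| <= l + l^-1 * (x - y) ^+ 2]. *)
have ABq n w l : 0 < l -> `|A n w - B w| <= 2 * K * (l * (t - s) + l^-1 * q n w).
  move=> l0; rewrite /A /B -RintegralB//.
  apply: le_trans (le_normr_Rintegral _ _) _ => //.
  have I5 : leb.-integrable `[s, t]
     (EFin \o (fun r => l^-1 * (simple_eval (phi n) r w - H' r w) ^+ 2)).
    exact: (@integrableZl _ (measurableTypeR R) R leb _ (measurable_itv `[s, t]) l^-1
      (EFin \o (fun r => (simple_eval (phi n) r w - H' r w) ^+ 2))).
  have I6 : leb.-integrable `[s, t]
     (EFin \o (fun r => l + l^-1 * (simple_eval (phi n) r w - H' r w) ^+ 2)).
    exact: (@integrableD _ (measurableTypeR R) R leb _ (measurable_itv `[s, t]) _ _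
      (Icst l) I5).
  have I4 : leb.-integrable `[s, t]
     (EFin \o (fun r => 2 * K * (l + l^-1 * (simple_eval (phi n) r w - H' r w) ^+ 2))).
    exact: (@integrableZl _ (measurableTypeR R) R leb _ (measurable_itv `[s, t]) (2 * K)
      (EFin \o (fun r => l + l^-1 * (simple_eval (phi n) r w - H' r w) ^+ 2))).
  apply: (@le_trans _ _ (\int[leb]_(r in `[s, t])
     (2 * K * (l + l^-1 * (simple_eval (phi n) r w - H' r w) ^+ 2)))).
    apply: le_Rintegral => //.
      exact: (integrable_norm (I12 n w)).
    move=> r _; rewrite subr_sqr normrM mulrC ler_pM ?norm_le_sqr//.
    by apply: le_trans (ler_normD _ _) _; rewrite mulr2n mulrDl mul1r lerD.
  rewrite RintegralZl// RintegralD// RintegralZl//.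
  rewrite ler_wpM2l ?mulr_ge0// lerD2r.
  apply: le_trans (ler_norm _) _; apply: Rintegral_itv_bound => //.
    by move=> r _; rewrite ger0_norm // ltW.
apply: (cvg_linear_bound cH (C := L * (2 * K * (t - s)))) => l l0.
exists (L * (2 * K * l^-1)) => n.
rewrite -(expectB (LA n) LB).
have Lb : L1 (fun w => L * (2 * K * (t - s)) * l + L * (2 * K * l^-1) * q n w).
  by apply: integrable_rvD; [exact: integrable_rv_cst|exact: integrable_rvZ].
apply: le_trans (_ : E[fun w => L * (2 * K * (t - s)) * l + L * (2 * K * l^-1) * q n w] <= _).
  apply: expect_norm_le; [exact: (integrable_rvB (LA n) LB)|exact: Lb|].
  apply: aeW => w; rewrite -mulrBr normrM.
  apply: le_trans (ler_pM _ _ (xiL w) (ABq n w l l0)) _ => //.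
  by rewrite le_eqVlt; apply/orP; left; apply/eqP; ring.
rewrite expectD ?expect_cst ?expectZ//; first exact: integrable_rv_cst.
exact: integrable_rvZ.
Qed.

End increment.
End ito_limit.

(** * Joint measurability of right-continuous processes *)

Section joint_measurability.
Context {R : realType} {d : measure_display} {T : measurableType d}.

(* A right-continuous process is the limit of the processes frozen, on each
   [k/(n+1), (k+1)/(n+1)[, at their value at the right end point. *)
Lemma right_continuous_jointly_measurable (X : R -> T -> R) (t : R) :
  (forall r : R, 0 <= r -> measurable_fun setT (X r)) ->
  (forall w (r : R), 0 <= r -> X q w @[q --> r^'+] --> X r w) ->
  measurable_fun (`[0, t] `*` setT : set (R * T)) (fun p : R * T => X p.1 p.2).
Proof.
move=> mX rcX.
pose grid n (k : nat) : R := k%:R / n.+1%:R.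
have n1 n : 0 < n.+1%:R^-1 :> R by rewrite invr_gt0.
pose frozen n (p : R * T) := \sum_(k < (Num.truncn (t * n.+1%:R)).+1)
  X (grid n k.+1) p.2 * \1_(`[grid n k, grid n k.+1[ : set R) p.1.
have mfrozen n : measurable_fun setT (frozen n).
  apply: (@measurable_sum _ _ _ setT _ (index_enum 'I_(Num.truncn (t * n.+1%:R)).+1)
    (fun k (p : R * T) => X (grid n k.+1) p.2 * \1_(`[grid n k, grid n k.+1[ : set R) p.1)) => k.
  apply: measurable_funM.
    by apply: (measurableT_comp (mX _ _) measurable_snd); rewrite /grid divr_ge0.
  exact: (measurableT_comp _ measurable_fst).
have frozenE n s w : 0 <= s <= t ->
    frozen n (s, w) = X (grid n (Num.truncn (s * n.+1%:R)).+1) w.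
  move=> /andP[s0 st]; pose k0 := Num.truncn (s * n.+1%:R).
  have sn0 : 0 <= s * n.+1%:R by rewrite mulr_ge0.
  have k0t : (k0 < (Num.truncn (t * n.+1%:R)).+1)%N.
    by rewrite ltnS le_truncn// ler_wpM2r.
  rewrite /frozen (bigD1 (Ordinal k0t))//= big1 ?addr0.
    rewrite indicE mem_setE in_itv/= /grid ler_pdivrMr// ltr_pdivlMr//.
    by rewrite -truncn_eq// eqxx mulr1.
  move=> k /negbTE kk0; rewrite indicE mem_setE in_itv/= /grid ler_pdivrMr// ltr_pdivlMr//.
  rewrite -truncn_eq// -/k0 (_ : (k0 == k) = false) ?mulr0//.
  by apply/negbTE/eqP => k0k; move/eqP: kk0; apply; apply/val_inj; rewrite /= k0k.
have mD : measurable (`[0, t] `*` setT : set (R * T)) by exact: measurableX.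
apply/measurable_EFinP.
apply: (emeasurable_fun_cvg (fun n p => (frozen n p)%:E)).
  by move=> n; apply/measurable_EFinP; exact: measurable_funTS.
move=> [s w] [/=]; rewrite in_itv/= => /[dup] s0t /andP[s0 st] _.
apply: cvg_EFin; first exact: nearW.
rewrite (_ : _ \o _ = (fun n => X (grid n (Num.truncn (s * n.+1%:R)).+1) w)); last first.
  by apply/funext => n /=; rewrite frozenE.
apply: (cvg_comp _ (fun q => X q w)); last exact: rcX.
move=> A [e /= e0 sA]; near=> n.
have sn0 : 0 <= s * n.+1%:R by rewrite mulr_ge0.
have /andP[h1 h2] := truncn_itv sn0.
have gs : s < grid n (Num.truncn (s * n.+1%:R)).+1 by rewrite /grid ltr_pdivlMr.
apply: sA => //=; rewrite ltr0_norm ?subr_lt0// opprB ltrBlDl.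
apply: le_lt_trans (_ : s + n.+1%:R^-1 < _).
  by rewrite /grid -natr1 mulrDl mul1r lerD2r ler_pdivrMr.
rewrite ltrD2l; near: n; exact: near_infty_natSinv_lt (PosNum e0).
Unshelve. all: end_near.
Qed.

End joint_measurability.

(** * Discretized paths of a reflected process *)

Section uniform_continuity.
Context {R : realType}.

Lemma within_itv_continuousP (f : R -> R) (A : set R) (x e : R) :
  {within A, continuous f} -> A x -> 0 < e ->
  exists2 r, 0 < r & forall y, A y -> `|x - y| < r -> `|f x - f y| < e.
Proof.
move=> /subspace_continuousP/(_ x) cf Ax e0.
have /cvgrPdist_lt/(_ e e0) := cf Ax.
rewrite near_withinE => -[r /= r0 H]; exists r => // y Ay xy.
exact: (H y xy Ay).
Qed.

Lemma itv_unif_continuous (f : R -> R) (a b e : R) : {within `[a, b], continuous f} ->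
  0 < e -> exists2 r, 0 < r &
  forall x y, a <= x <= b -> a <= y <= b -> `|x - y| < r -> `|f x - f y| < e.
Proof.
move=> cf e0.
pose Q (r x : R) := a <= x <= b -> forall y, a <= y <= b -> `|x - y| < r -> `|f x - f y| < e.
have H : \forall r \near 0^'+, `[a, b]%classic `<=` Q r.
  (* Heine's theorem by compactness: a uniform radius has to be found only near each point, where
     half the radius of continuity for [e / 2] works. *)
  apply: (proj1 (compact_near_coveringP _) (@segment_compact R a b)) => x xab.
  have e20 : 0 < e / 2 by rewrite divr_gt0.
  have [r r0 Hr] := within_itv_continuousP cf xab e20.
  have r20 : 0 < r / 2 by rewrite divr_gt0.
  exists (ball x (r / 2), [set r' | r' < r / 2]).
    split; first exact: nbhsx_ballx.
    exact: nbhs_right_lt.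
  move=> [z r'] /= [xz r'r] zab y yab zy.
  have h1 : `|f x - f z| < e / 2.
    apply: Hr; first by rewrite /= in_itv.
    by apply: lt_trans xz _; rewrite ltr_pdivrMr// ltr_pMr// ltr1n.
  have h2 : `|f x - f y| < e / 2.
    apply: Hr; first by rewrite /= in_itv.
    have := ler_normD (x - z) (z - y); rewrite subrKA.
    rewrite /ball/= in xz; lra.
  have := ler_normD (f z - f x) (f x - f y); rewrite subrKA (distrC (f z) (f x)); lra.
have [r [/= HQ r0]] : exists r, (`[a, b]%classic `<=` Q r) /\ 0 < r.
  have H2 : \forall r \near 0^'+, (`[a, b]%classic `<=` Q r) /\ 0 < r.
    exact: (filterI H (nbhs_right_gt (0 : R))).
  by have [r Hr] := @filter_ex _ _ (at_right_proper_filter 0) _ H2; exists r.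
by exists r => // x y xab yab; apply: (HQ x) => //=; rewrite in_itv.
Qed.

Lemma itv_continuous_bounded (f : R -> R) (a b : R) : {within `[a, b], continuous f} ->
  exists2 B, 0 <= B & forall x, a <= x <= b -> `|f x| <= B.
Proof.
move=> cf.
have [ab|ba] := leP a b; last first.
  by exists 0 => // x /andP[ax xb]; have := lt_le_trans ba (le_trans ax xb); rewrite ltxx.
have cn : {within `[a, b], continuous (fun x => `|f x|)}.
  by move=> x; apply: continuous_comp; [exact: cf|exact: norm_continuous].
have [c cab Hc] := EVT_max ab cn.
by exists `|f c| => // x xab; apply: Hc; rewrite in_itv.
Qed.

End uniform_continuity.

Section stopped_sums.
Context {R : realType}.

(* The step that crosses the level N is the only one with weight 1 that escapes
   the bound by k and V; there is at most one, and z bounds it. *)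
Lemma stopped_sum_le (n : nat) (V e k : nat -> R) (N y z : R) :
  0 <= V 0%N -> 0 <= N -> 0 <= y -> 0 <= z ->
  (forall i, V i <= V i.+1) -> (forall i, 0 <= k i) ->
  (forall i, (i < n)%N -> V i.+1 <= N -> e i <= y * (k i + (V i.+1 - V i))) ->
  (forall i, (i < n)%N -> e i <= z) ->
  \sum_(i < n) (V i <= N)%R%:R * e i <= y * (\sum_(i < n) k i + N) + z.
Proof.
move=> V0 N0 y0 z0 VS k0 He Hz.
have Vge0 i : 0 <= V i by elim: i => // i; move/le_trans; apply.
suff H : forall m, (m <= n)%N -> \sum_(i < m) (V i <= N)%R%:R * e i <=
    y * (\sum_(i < m) k i + Num.min (V m) N) + (N < V m)%R%:R * z.
  apply: le_trans (H n (leqnn n)) _; rewrite lerD//.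
    by rewrite ler_wpM2l// lerD2l ge_min lexx orbT.
  by case: (N < V n); rewrite ?mul1r ?mul0r.
elim=> [_|m IH mn].
  rewrite !big_ord0 add0r addr_ge0 ?mulr_ge0// le_min V0 N0//.
have {}IH := IH (ltnW mn).
rewrite !big_ord_recr/=.
have [VN|NV] := leP (V m) N; last first.
  have NV' := lt_le_trans NV (VS m).
  rewrite mul0r addr0 NV' min_r ?(ltW NV')//.
  move: IH; rewrite NV min_r ?(ltW NV)// => /le_trans; apply.
  by rewrite lerD2r ler_wpM2l// lerD2r lerDl.
move: IH; rewrite mul1r (ltNge N) VN/= mul0r addr0 min_l// => IH.
have [VN'|NV'] := leP (V m.+1) N.
  rewrite mul0r addr0.
  apply: le_trans (lerD IH (He m mn VN')) _.
  by rewrite -mulrDr le_eqVlt; apply/orP; left; apply/eqP; congr (_ * _); lra.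
rewrite mul1r.
apply: lerD (Hz m mn); apply: le_trans IH _.
rewrite ler_wpM2l//.
by have := k0 m; lra.
Qed.

(** Since [V] is nondecreasing, the weights are ones followed by zeros, and the sum telescopes up to
    the crossing index. *)
Lemma stopped_telescope (n : nat) (V h : nat -> R) (N : R) : (forall i, V i <= V i.+1) ->
  exists2 j, (j <= n)%N & \sum_(i < n) (V i <= N)%R%:R * (h i.+1 - h i) = h j - h 0%N
  /\ (V n <= N -> j = n).
Proof.
move=> VS; elim: n => [|n [j jn [E VN]]].
  by exists 0%N => //; rewrite big_ord0 subrr.
rewrite big_ord_recr/= E.
have [Vn|Vn] := leP (V n) N.
  exists n.+1 => //; split=> //.
  by rewrite (VN Vn) mul1r; lra.
exists j; first exact: leqW.
rewrite mul0r addr0; split=> // Vn1.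
by have := lt_le_trans Vn (le_trans (VS n) Vn1); rewrite ltxx.
Qed.

(** To be read with [x = dX], [m = dM], [x - m = dA]: powers of [dX] are traded for powers of [dM],
    whose moments are known, at the price of a cross term [|dX| * |dA|]. *)
Lemma sqr_le_normM (x m : R) : x ^+ 2 <= 2 * (`|x| * `|x - m|) + m ^+ 2.
Proof.
rewrite -(real_normK (num_real x)) -(real_normK (num_real m)).
have h : `|x| <= `|m| + `|x - m|.
  by have := ler_normD m (x - m); rewrite addrC subrK.
have [x0 m0 d0] := And3 (normr_ge0 x) (normr_ge0 m) (normr_ge0 (x - m)).
set X := `|x| in h x0 *; set Y := `|m| in h m0 *; set Z := `|x - m| in h d0 *.
have := sqr_ge0 (X - Y).
have : X * X <= X * (Y + Z) by rewrite ler_wpM2l.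
by rewrite !expr2; lra.
Qed.

Lemma exp4_le_normM (x m c : R) : `|x| <= c ->
  x ^+ 4 <= 4 * c ^+ 2 * (`|x| * `|x - m|) + m ^+ 4.
Proof.
move=> xc; have h := sqr_le_normM x m.
have x2c : x ^+ 2 <= c ^+ 2.
  rewrite -(real_normK (num_real x)) lerXn2r ?nnegrE//.
  exact: le_trans xc.
have p0 : 0 <= `|x| * `|x - m| by rewrite mulr_ge0.
have h1 := ler_wpM2l (sqr_ge0 x) h.
have h2 := ler_wpM2r p0 x2c.
have h3 := sqr_ge0 (x ^+ 2 - m ^+ 2).
have E4 (y : R) : y ^+ 4 = y ^+ 2 * y ^+ 2 by rewrite -exprD.
rewrite !E4; set p := `|x| * _ in p0 h1 h2 *.
set u := x ^+ 2 in h1 h2 h3 x2c *; set v := m ^+ 2 in h1 h3 *.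
set w := c ^+ 2 in h2 x2c *.
rewrite mulrDr [X in _ <= X + _]mulrCA in h1.
have : (u - v) ^+ 2 = u * u - 2 * (u * v) + v * v by ring.
move=> E; rewrite E in h3.
have -> : 4 * w * p = 4 * (w * p) by ring.
lra.
Qed.

End stopped_sums.

Section grid.
Context {R : realType}.
Variable T : R.
Hypothesis T0 : 0 < T.

Definition grid (T : R) (n i : nat) : R := T * i%:R / n.+1%:R.

Lemma grid0 n : grid T n 0 = 0.
Proof. by rewrite /grid mulr0 mul0r. Qed.

Lemma gridT n : grid T n n.+1 = T.
Proof. by rewrite /grid mulfK. Qed.

Lemma grid_le n i j : (i <= j)%N -> grid T n i <= grid T n j.
Proof. by move=> ij; rewrite /grid ler_pM2r ?invr_gt0// ler_pM2l// ler_nat. Qed.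

Lemma grid_ge0 n i : 0 <= grid T n i.
Proof. by rewrite -(grid0 n) grid_le. Qed.

Lemma grid_leT n i : (i <= n.+1)%N -> grid T n i <= T.
Proof. by move=> /(grid_le n); rewrite gridT. Qed.

Lemma gridS n i : grid T n i.+1 - grid T n i = T / n.+1%:R.
Proof. by rewrite /grid -natr1 mulrDr mulrDl mulr1 addrC addKr. Qed.

Lemma grid_unif_continuous (X : R -> R) (e : R) : {within `[0, T], continuous X} ->
  0 < e -> \forall n \near \oo, forall i r, (i <= n)%N ->
    grid T n i <= r <= grid T n i.+1 -> `|X r - X (grid T n i)| < e.
Proof.
move=> cX e0; have [d d0 Hd] := itv_unif_continuous cX e0.
near=> n => i r ni /andP[ir rS].
have gi0 := grid_ge0 n i; have giT := grid_leT (ni : (i.+1 <= n.+1)%N).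
apply: Hd.
- by rewrite (le_trans gi0 ir) (le_trans rS giT).
- by rewrite gi0 (le_trans (le_trans ir rS) giT).
rewrite ger0_norm ?subr_ge0//; apply: le_lt_trans (_ : T / n.+1%:R < _).
  by rewrite -(gridS n i) lerB.
rewrite -ltr_pdivlMl// mulrC; near: n.
have dT : 0 < d / T by rewrite divr_gt0.
exact: near_infty_natSinv_lt (PosNum dT).
Unshelve. all: end_near.
Qed.

End grid.

Section controlled_path.
Context {R : realType}.
Local Notation leb := (@lebesgue_measure R).

Lemma integrable_itv_continuous (f : R -> R) (s t : R) : {within `[s, t], continuous f} ->
  leb.-integrable `[s, t] (EFin \o f).
Proof. by move=> cf; apply: continuous_compact_integrable => //; exact: segment_compact. Qed.

Lemma within_subitv (f : R -> R) (s t s' t' : R) : s <= s' -> t' <= t ->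
  {within `[s, t], continuous f} -> {within `[s', t'], continuous f}.
Proof.
move=> ss tt; apply: continuous_subspaceW => r.
by rewrite /= !in_itv/= => /andP[h1 h2]; rewrite (le_trans ss h1) (le_trans h2 tt).
Qed.

Lemma Rintegral_itv_split (f : R -> R) (q s t : R) : q <= s -> s <= t ->
  {within `[q, t], continuous f} ->
  \int[leb]_(r in `[q, t]) f r - \int[leb]_(r in `[q, s]) f r = \int[leb]_(r in `[s, t]) f r.
Proof.
move=> qs st cf.
have I0 := integrable_itv_continuous cf.
have cst' := within_subitv qs (lexx t) cf.
rewrite (Rintegral_itvB I0) ?bnd_simp// Rintegral_itv_obnd_cbnd//.
apply: (integrableS _ _ _ (integrable_itv_continuous cst')) => //.
by apply: subset_itvr; rewrite bnd_simp.
Qed.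

Lemma RintegralB_itv (f g : R -> R) (s t : R) : {within `[s, t], continuous f} ->
  {within `[s, t], continuous g} ->
  \int[leb]_(r in `[s, t]) (f r - g r) =
  \int[leb]_(r in `[s, t]) f r - \int[leb]_(r in `[s, t]) g r.
Proof. by move=> cf cg; rewrite RintegralB//; exact: integrable_itv_continuous. Qed.

Lemma RintegralD_itv (f g : R -> R) (s t : R) : {within `[s, t], continuous f} ->
  {within `[s, t], continuous g} ->
  \int[leb]_(r in `[s, t]) (f r + g r) =
  \int[leb]_(r in `[s, t]) f r + \int[leb]_(r in `[s, t]) g r.
Proof. by move=> cf cg; rewrite RintegralD//; exact: integrable_itv_continuous. Qed.

Lemma RintegralZ_itv (f : R -> R) (k s t : R) : {within `[s, t], continuous f} ->
  \int[leb]_(r in `[s, t]) (k * f r) = k * \int[leb]_(r in `[s, t]) f r.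
Proof. by move=> cf; rewrite RintegralZl//; exact: integrable_itv_continuous. Qed.

Lemma Rintegral_itv_cont_bound (g : R -> R) (s t B : R) : s <= t ->
  {within `[s, t], continuous g} -> (forall r, s <= r <= t -> `|g r| <= B) ->
  `|\int[leb]_(r in `[s, t]) g r| <= B * (t - s).
Proof.
move=> st cg; apply: Rintegral_itv_bound => //.
have := measurable_int leb (integrable_itv_continuous cg).
by move/measurable_EFinP.
Qed.

Lemma within_itv_comp (f g : R -> R) (s t : R) : continuous f ->
  {within `[s, t], continuous g} -> {within `[s, t], continuous (fun r => f (g r))}.
Proof. by move=> cf cg r; apply: continuous_comp; [exact: cg|exact: cf]. Qed.

Variables (a b T x : R) (X M U D mu sig2 hp hpp : R -> R) (qu qd Kmu : R).
Hypothesis T0 : 0 < T.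
Hypothesis Xab : forall t, 0 <= t -> a <= X t <= b.
Hypothesis cX : {within `[0, T], continuous X}.
Hypothesis Umon : forall s t, s <= t -> U s <= U t.
Hypothesis Dmon : forall s t, s <= t -> D s <= D t.
Hypothesis U0 : U 0 = 0.
Hypothesis D0 : D 0 = 0.
Hypothesis Uflat : forall s t, 0 <= s -> s <= t ->
  (forall r, s < r <= t -> X r <> a) -> U t = U s.
Hypothesis Dflat : forall s t, 0 <= s -> s <= t ->
  (forall r, s < r <= t -> X r <> b) -> D t = D s.
Hypothesis XE : forall t, 0 <= t ->
  X t = x + \int[leb]_(r in `[0, t]) mu (X r) + M t + U t - D t.
Hypothesis cmu : continuous mu.
Hypothesis csig : continuous sig2.
Hypothesis chp : continuous hp.
Hypothesis chpp : continuous hpp.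
Hypothesis hpa : hp a = - qu.
Hypothesis hpb : hp b = qd.
Hypothesis qu0 : 0 <= qu.
Hypothesis qd0 : 0 <= qd.
Hypothesis muK : forall y, a <= y <= b -> `|mu y| <= Kmu.

Let V t := U t + D t.
Let t_ := grid T.
Let dA n i := X (t_ n i.+1) - X (t_ n i) - (M (t_ n i.+1) - M (t_ n i)).
Let dB n i := \int[leb]_(r in `[t_ n i, t_ n i.+1]) mu (X r).
Let dU n i := U (t_ n i.+1) - U (t_ n i).
Let dD n i := D (t_ n i.+1) - D (t_ n i).

Let cXi n i : (i <= n)%N -> {within `[t_ n i, t_ n i.+1], continuous X}.
Proof. by move=> ni; apply: within_subitv cX; [exact: grid_ge0|exact: grid_leT]. Qed.

Let tS n i : t_ n i <= t_ n i.+1. Proof. exact: grid_le. Qed.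

Let dt n i : t_ n i.+1 - t_ n i = T / n.+1%:R. Proof. exact: gridS. Qed.

Let dAE n i : (i <= n)%N -> dA n i = dB n i + dU n i - dD n i.
Proof.
move=> ni; have ge0 := grid_ge0 T0 n.
have cI := within_subitv (lexx 0) (grid_leT T0 (ni : (i.+1 <= n.+1)%N)) (within_itv_comp cmu cX).
have /esym dBE := Rintegral_itv_split (ge0 i) (tS n i) cI.
rewrite /dA (XE (ge0 i)) (XE (ge0 i.+1)) /dB dBE.
by rewrite /dU /dD; ring.
Qed.

Let Xgrid n i : a <= X (t_ n i) <= b. Proof. by apply: Xab; exact: grid_ge0. Qed.

Let dB_le n i : (i <= n)%N -> `|dB n i| <= Kmu * (T / n.+1%:R).
Proof.
move=> ni; rewrite -(dt n i); apply: Rintegral_itv_cont_bound => //.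
  exact: (within_itv_comp cmu (cXi ni)).
move=> r /andP[r1 _]; apply: muK; apply: Xab; exact: le_trans (grid_ge0 T0 n i) r1.
Qed.

Let dU0 n i : 0 <= dU n i. Proof. by rewrite subr_ge0 Umon. Qed.
Let dD0 n i : 0 <= dD n i. Proof. by rewrite subr_ge0 Dmon. Qed.

(** The drift is bounded by [Kmu] per unit of time and the pushing by the increment of [V]. The
    factor [1] gives the estimate the shape expected by [stopped_sum_le]. *)
Lemma path_increment_bound n i : (i <= n)%N ->
  `|dA n i| <= 1 * (Kmu * (T / n.+1%:R) + (V (t_ n i.+1) - V (t_ n i))).
Proof.
move=> ni; rewrite dAE// mul1r.
apply: le_trans (ler_normB _ _) _; rewrite (ger0_norm (dD0 n i)).
have := ler_normD (dB n i) (dU n i); rewrite (ger0_norm (dU0 n i)).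
move=> h; have -> : V (t_ n i.+1) - V (t_ n i) = dU n i + dD n i by rewrite /V /dU /dD; ring.
by rewrite [leRHS]addrA lerD2r (le_trans h)// lerD2r dB_le.
Qed.

Let sumU n : \sum_(i < n.+1) dU n i = U T.
Proof.
rewrite -(big_mkord xpredT (dU n)) telescope_sumr//.
by rewrite /t_ gridT grid0 U0 subr0.
Qed.

Let sumD n : \sum_(i < n.+1) dD n i = D T.
Proof.
rewrite -(big_mkord xpredT (dD n)) telescope_sumr//.
by rewrite /t_ gridT grid0 D0 subr0.
Qed.

(** If [U] moves during a step, then [X] visits [a] in that step, where [hp] equals [- qu]; as the
    grid is fine, [hp] at the left end of the step is close to [- qu]. Likewise for [D], with [b]
    and [qd]. *)
Let hpU e : 0 < e -> \forall n \near \oo, forall i, (i <= n)%N ->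
  `|hp (X (t_ n i)) * dU n i + qu * dU n i| <= e * dU n i /\
  `|hp (X (t_ n i)) * dD n i - qd * dD n i| <= e * dD n i.
Proof.
move=> e0.
have [d d0 Hd] := itv_unif_continuous (continuous_subspaceT chp) e0 (a := a) (b := b).
have := grid_unif_continuous T0 cX d0; apply: filterS => n Hn i ni.
have ti0 := grid_ge0 T0 n i; have ab := Xgrid n i.
split.
  rewrite -mulrDl normrM (ger0_norm (dU0 n i)).
  have [->|dUn0] := eqVneq (dU n i) 0; first by rewrite !mulr0.
  rewrite ler_wpM2r//.
  have [r /andP[r1 r2] Xr] : exists2 r, t_ n i < r <= t_ n i.+1 & X r = a.
    apply: contrapT => h; move/eqP: dUn0; apply.
    rewrite /dU (@Uflat (t_ n i)) ?subrr//.
    by move=> r r12 Xr; apply: h; exists r.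
  have r0 := le_trans ti0 (ltW r1).
  rewrite -[qu]opprK -hpa -Xr ltW//; apply: Hd => //; first exact: Xab.
  by rewrite distrC; apply: Hn => //; rewrite r2 ltW.
rewrite -mulrBl normrM (ger0_norm (dD0 n i)).
have [->|dDn0] := eqVneq (dD n i) 0; first by rewrite !mulr0.
rewrite ler_wpM2r//.
have [r /andP[r1 r2] Xr] : exists2 r, t_ n i < r <= t_ n i.+1 & X r = b.
  apply: contrapT => h; move/eqP: dDn0; apply.
  rewrite /dD (@Dflat (t_ n i)) ?subrr//.
  by move=> r r12 Xr; apply: h; exists r.
have r0 := le_trans ti0 (ltW r1).
rewrite -hpb -Xr ltW//; apply: Hd => //; first exact: Xab.
by rewrite distrC; apply: Hn => //; rewrite r2 ltW.
Qed.

(** Up to [e], the pushing contributes [- qu * dU - qd * dD <= 0] in each step. Whatever steps the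
    weights keep, the upper bound therefore contains only the drift, and the lower one at most the
    full cost [qu * U T + qd * D T]. The choice of [n] is uniform in [N]. *)
Lemma path_sum_bounds (B e : R) : (forall y, a <= y <= b -> `|hp y| <= B) -> 0 < e ->
  \forall n \near \oo, forall N : R,
  let S := \sum_(i < n.+1) (V (t_ n i) <= N)%R%:R * (hp (X (t_ n i)) * dA n i) in
  S <= B * Kmu * T + e * V T /\
  - S <= B * Kmu * T + (qu * U T + qd * D T) + e * V T.
Proof.
move=> hpB e0; have := hpU e0; apply: filterS => n Hn N /=.
have bnd (i : 'I_n.+1) : `|hp (X (t_ n i)) * dB n i| <= B * Kmu * (T / n.+1%:R).
  by rewrite normrM -mulrA ler_pM// ?hpB// ?dB_le// -ltnS.
have sumT : \sum_(i < n.+1) (B * Kmu * (T / n.+1%:R)) = B * Kmu * T.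
  by rewrite sumr_const card_ord -[LHS]mulr_natr -[LHS]mulrA divfK.
rewrite -sumrN -(sumU n) -(sumD n) /V mulrDr -(sumU n) -(sumD n) !mulr_sumr -sumT.
rewrite -!big_split/=.
have chi01 i : ((V (t_ n i) <= N)%R%:R == 0 :> R) || ((V (t_ n i) <= N)%R%:R == 1 :> R).
  by case: (_ <= N); rewrite eqxx ?orbT.
split; apply: ler_sum => i _; have ni : (i <= n)%N by rewrite -ltnS.
- have [h1 h2] := Hn i ni; have h3 := bnd i; rewrite (dAE ni).
  move: h1 h2 h3; rewrite !ler_norml => /andP[h1 h1'] /andP[h2 h2'] /andP[h3 h3'].
  have h4 := mulr_ge0 qu0 (dU0 n i); have h5 := mulr_ge0 qd0 (dD0 n i).
  have h6 := mulr_ge0 (ltW e0) (dU0 n i); have h7 := mulr_ge0 (ltW e0) (dD0 n i).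
  move: (chi01 i) h1 h1' h2 h2' h3 h3' h4 h5 h6 h7.
  move: (_%:R) (T / _) (hp _) (dU n i) (dD n i) (dB n i) => chi p y u v w.
  by move=> /orP[/eqP ->|/eqP ->]; rewrite ?mul0r ?mul1r => *; lra.
- have [h1 h2] := Hn i ni; have h3 := bnd i; rewrite (dAE ni).
  move: h1 h2 h3; rewrite !ler_norml => /andP[h1 h1'] /andP[h2 h2'] /andP[h3 h3'].
  have h4 := mulr_ge0 qu0 (dU0 n i); have h5 := mulr_ge0 qd0 (dD0 n i).
  have h6 := mulr_ge0 (ltW e0) (dU0 n i); have h7 := mulr_ge0 (ltW e0) (dD0 n i).
  move: (chi01 i) h1 h1' h2 h2' h3 h3' h4 h5 h6 h7.
  move: (_%:R) (T / _) (hp _) (dU n i) (dD n i) (dB n i) => chi p y u v w.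
  by move=> /orP[/eqP ->|/eqP ->]; rewrite ?mul0r ?mul1r => *; lra.
Qed.

Let psi y := hp y * mu y + hpp y / 2 * sig2 y.

Lemma path_sum_cvg (e : R) : 0 < e -> \forall n \near \oo,
  `|\sum_(i < n.+1) (hp (X (t_ n i)) * dA n i +
       hpp (X (t_ n i)) / 2 * \int[leb]_(r in `[t_ n i, t_ n i.+1]) sig2 (X r)) -
    (\int[leb]_(r in `[0, T]) psi (X r) - (qu * U T + qd * D T))| <= e.
Proof.
move=> e0.
have cpsi : continuous psi.
  move=> y; apply: cvgD; first by apply: cvgM; [exact: chp|exact: cmu].
  apply: cvgM; last exact: csig.
  by apply: cvgM; [exact: chpp|exact: cvg_cst].
have [Ks Ks0 sK] := itv_continuous_bounded (a := a) (b := b) (continuous_subspaceT csig).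
have aX0 := Xab (lexx 0).
have Kmu0 : 0 <= Kmu by exact: le_trans (normr_ge0 _) (muK aX0).
have VT0 : 0 <= U T + D T.
  by rewrite -U0 -[U 0]addr0 -{2}D0 lerD ?Umon ?Dmon// ltW.
(* The local errors are [e1] times the length of the step, weighted by the bounds of [mu] and
   [sig2], plus [e1] times the pushing; [c] dominates their total mass, and [+ 1] makes it
   positive. *)
pose c := T * (Kmu + Ks) + (U T + D T) + 1.
have c0 : 0 < c by rewrite ltr_wpDl// addr_ge0// mulr_ge0 ?addr_ge0// ltW.
pose e1 := e / c.
have e10 : 0 < e1 by rewrite divr_gt0.
have [d1 d10 Hd1] := itv_unif_continuous (continuous_subspaceT chp) e10 (a := a) (b := b).
have [d2 d20 Hd2] := itv_unif_continuous (continuous_subspaceT chpp) e10 (a := a) (b := b).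
have H1 := grid_unif_continuous T0 cX d10.
have H2 := grid_unif_continuous T0 cX d20.
have H3 := hpU e10.
apply: filterS (filterI H1 (filterI H2 H3)) => n [H1n [H2n H3n]].
have -> : \int[leb]_(r in `[0, T]) psi (X r) =
    \sum_(i < n.+1) \int[leb]_(r in `[t_ n i, t_ n i.+1]) psi (X r).
  pose Psi t := \int[leb]_(r in `[0, t]) psi (X r).
  transitivity (\sum_(i < n.+1) (Psi (t_ n i.+1) - Psi (t_ n i))).
    rewrite -(big_mkord xpredT (fun i => Psi (t_ n i.+1) - Psi (t_ n i))).
    rewrite telescope_sumr// /t_ gridT grid0 /Psi.
    by rewrite set_itv1 Rintegral_set1 subr0.
  apply: eq_bigr => i _; apply: Rintegral_itv_split => //; first exact: grid_ge0.
  apply: (within_subitv (lexx 0) _ (within_itv_comp cpsi cX)).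
  exact: grid_leT.
rewrite -(sumU n) -(sumD n) !mulr_sumr -big_split/= -!sumrB.
apply: le_trans (ler_norm_sum _ _ _) _.
apply: (@le_trans _ _ (\sum_(i < n.+1) (e1 * ((Kmu + Ks) * (T / n.+1%:R)) +
   e1 * (dU n i + dD n i)))).
  apply: ler_sum => i _; have ni : (i <= n)%N by rewrite -ltnS.
  have [h1 h2] := H3n i ni.
  set I2 := \int[leb]_(r in _) sig2 (X r).
  set I3 := \int[leb]_(r in _) psi (X r).
  have key : `|hp (X (t_ n i)) * dB n i + hpp (X (t_ n i)) / 2 * I2 - I3| <=
      e1 * ((Kmu + Ks) * (T / n.+1%:R)).
    have c1 := within_itv_comp cmu (cXi ni).
    have c2 := within_itv_comp csig (cXi ni).
    have c3 := within_itv_comp cpsi (cXi ni).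
    have c1' : {within `[t_ n i, t_ n i.+1], continuous (fun r => hp (X (t_ n i)) * mu (X r))}.
      by apply: (within_itv_comp (f := fun y => hp (X (t_ n i)) * mu y) _ (cXi ni)) => y; apply: cvgM; [exact: cvg_cst|exact: cmu].
    have c2' : {within `[t_ n i, t_ n i.+1], continuous (fun r => hpp (X (t_ n i)) / 2 * sig2 (X r))}.
      by apply: (within_itv_comp (f := fun y => hpp (X (t_ n i)) / 2 * sig2 y) _ (cXi ni)) => y; apply: cvgM; [exact: cvg_cst|exact: csig].
    have c12 : {within `[t_ n i, t_ n i.+1], continuous (fun r =>
        hp (X (t_ n i)) * mu (X r) + hpp (X (t_ n i)) / 2 * sig2 (X r))}.
      by move=> r; apply: cvgD; [exact: c1'|exact: c2'].
    rewrite /dB /I2 /I3 -RintegralZ_itv// -RintegralZ_itv// -RintegralD_itv// -RintegralB_itv//.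
    rewrite mulrA -(dt n i); apply: Rintegral_itv_cont_bound => //.
      by move=> r; apply: cvgB; [exact: c12|exact: c3].
    move=> r rin; have r0 : 0 <= r.
      by case/andP: rin => r1 _; exact: le_trans (grid_ge0 T0 n i) r1.
    have := Xab r0 => Xr; have Xi := Xgrid n i.
    have k1 : `|hp (X (t_ n i)) - hp (X r)| <= e1.
      by rewrite ltW// Hd1// distrC H1n.
    have k2 : `|hpp (X (t_ n i)) - hpp (X r)| <= e1.
      by rewrite ltW// Hd2// distrC H2n.
    have -> : hp (X (t_ n i)) * mu (X r) + hpp (X (t_ n i)) / 2 * sig2 (X r) - psi (X r) =
      (hp (X (t_ n i)) - hp (X r)) * mu (X r) +
      ((hpp (X (t_ n i)) - hpp (X r)) * sig2 (X r)) / 2 by rewrite /psi; field.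
    apply: le_trans (ler_normD _ _) _; rewrite mulrDr lerD//.
      by rewrite normrM ler_pM// muK.
    have k3 : `|(hpp (X (t_ n i)) - hpp (X r)) * sig2 (X r)| <= e1 * Ks.
      by rewrite normrM ler_pM// sK.
    rewrite normrM (ger0_norm (_ : 0 <= 2^-1 :> R)) ?invr_ge0//.
    have := normr_ge0 ((hpp (X (t_ n i)) - hpp (X r)) * sig2 (X r)); lra.
  move: h1 h2 key; rewrite (dAE ni) !ler_norml; clearbody I2 I3.
  move: (hp _) (hpp _) (dU n i) (dD n i) (dB n i) (T / _) => y z u v w p.
  by move=> /andP[h1 h1'] /andP[h2 h2'] /andP[k k']; apply/andP; split; lra.
rewrite big_split/= -!mulr_sumr big_split/= sumU sumD.
rewrite sumr_const card_ord -(mulr_natr _^-1) mulVf// mulr1.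
rewrite -mulrDr /e1 -[leRHS]mulr1 -mulrA ler_pM2l// mulrC ler_pdivrMr// mul1r /c.
by rewrite (mulrC T) lerDl.
Qed.

End controlled_path.

(** * Discretization errors along a grid *)

Section bigmax.
Context {R : realType} {d : measure_display} {T : measurableType d}.

Lemma measurable_bigmax n (F : nat -> T -> R) : (forall i, measurable_fun setT (F i)) ->
  measurable_fun setT (fun w => \big[Num.max/0]_(i < n) F i w).
Proof.
elim: n F => [|n IHn] F mF.
  by under eq_fun do rewrite big_ord0; exact: measurable_cst.
under eq_fun do rewrite big_ord_recl/=.
by apply: measurable_maxr => //; apply: (IHn (fun i => F i.+1)).
Qed.

Lemma norm_le_exp4 (l x : R) : 0 < l -> `|x| <= l + l ^- 3 * x ^+ 4.
Proof.
move=> l0; have l3 : 0 < l ^+ 3 by rewrite exprn_gt0.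
have x4 : `|x| ^+ 4 = x ^+ 4 by rewrite -normrX ger0_norm// (@exprM _ x 2 2) sqr_ge0.
have [xl|/ltW lx] := leP `|x| l.
  by rewrite (le_trans xl)// lerDl mulr_ge0 ?invr_ge0 ?(ltW l3)// -x4 exprn_ge0.
apply: (@le_trans _ _ (l ^- 3 * x ^+ 4)); last by rewrite lerDr ltW.
rewrite mulrC ler_pdivlMr// -x4 (exprS _ 3) ler_wpM2l//.
by apply: lerXn2r; rewrite ?nnegrE// ltW.
Qed.

Lemma sqr_le_exp4 (l x : R) : 0 < l -> x ^+ 2 <= l + l^-1 * x ^+ 4.
Proof.
move=> l0; rewrite (@exprM _ x 2 2) -[leLHS]ger0_norm ?sqr_ge0//.
exact: norm_le_sqr.
Qed.

End bigmax.

Section discretization.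
Context {R : realType}.
Variables (n : nat) (X M V : nat -> R) (a b N k Kt : R).
Hypothesis Xab : forall i, a <= X i <= b.
Hypothesis V0 : 0 <= V 0%N.
Hypothesis N0 : 0 <= N.
Hypothesis k0 : 0 <= k.
Hypothesis Vmon : forall i, V i <= V i.+1.
Hypothesis ktE : k *+ n = Kt.
Let dX i := X i.+1 - X i.
Let dM i := M i.+1 - M i.
Let dA i := dX i - dM i.
Hypothesis Ainc : forall i, (i < n)%N -> `|dA i| <= 1 * (k + (V i.+1 - V i)).
Let chi i : R := (V i <= N)%R%:R.
Let q := \sum_(i < n) dM i ^+ 4.
Let x := \big[Num.max/0]_(i < n) `|dX i|.

Let q_ge i : (i < n)%N -> dM i ^+ 4 <= q.
Proof.
move=> ni; rewrite /q (bigD1 (Ordinal ni))//= lerDl sumr_ge0// => j _.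
by rewrite (@exprM _ _ 2 2) sqr_ge0.
Qed.

Let x_ge i : (i < n)%N -> `|dX i| <= x.
Proof. by move=> ni; rewrite /x (bigmax_sup (Ordinal ni)). Qed.

Let q0 : 0 <= q.
Proof. by apply: sumr_ge0 => i _; rewrite (@exprM _ _ 2 2) sqr_ge0. Qed.

Let x0 : 0 <= x.
Proof. by rewrite /x; elim/big_ind: _ => // u v u0 v0; rewrite le_max u0. Qed.

Let dXab i : `|dX i| <= b - a.
Proof.
have := Xab i; have := Xab i.+1; rewrite ler_norml /dX => /andP[h1 h2] /andP[h3 h4].
by apply/andP; split; lra.
Qed.

Let ba : 0 <= b - a. Proof. exact: le_trans (dXab 0). Qed.

Let sumk : \sum_(i < n) k = Kt. Proof. by rewrite sumr_const card_ord. Qed.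

Let Kt0 : 0 <= Kt. Proof. by rewrite -ktE mulrn_wge0. Qed.

Let dA_le i : `|dA i| <= `|dX i| + `|dM i|. Proof. exact: ler_normB. Qed.

(* The last step satisfies no bound by dV, but there |dA| <= |dX| + |dM|. *)
Lemma discrete_cross_le l : 0 < l ->
  \sum_(i < n) chi i * ((`|dX i| + `|dM i|) * `|dA i|) <=
  (Kt + N + 2) * l + (Kt + N + 2 * (b - a) + (Kt + N) * l ^- 3 + 2 * l^-1) * (x + q).
Proof.
move=> l0.
have l3 : 0 <= l ^- 3 by rewrite invr_ge0 exprn_ge0// ltW.
have l1 : 0 <= l^-1 by rewrite invr_ge0 ltW.
have m1 i : (i < n)%N -> `|dM i| <= l + l ^- 3 * q.
  by move=> /q_ge h; apply: le_trans (norm_le_exp4 _ l0) _; rewrite lerD2l ler_wpM2l.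
have m2 i : (i < n)%N -> dM i ^+ 2 <= l + l^-1 * q.
  by move=> /q_ge h; apply: le_trans (sqr_le_exp4 _ l0) _; rewrite lerD2l ler_wpM2l.
have y0 : 0 <= x + (l + l ^- 3 * q) by rewrite !addr_ge0 ?mulr_ge0// ltW.
have z0 : 0 <= 2 * (b - a) * x + 2 * (l + l^-1 * q).
  by rewrite addr_ge0// !mulr_ge0// addr_ge0 ?mulr_ge0// ltW.
apply: le_trans (@stopped_sum_le _ n V (fun i => (`|dX i| + `|dM i|) * `|dA i|)
  (fun=> k) N _ _ V0 N0 y0 z0 Vmon (fun=> k0) _ _) _.
- move=> i ni _; apply: ler_pM; rewrite ?addr_ge0//.
    by rewrite lerD ?x_ge ?m1.
  by have := Ainc ni; rewrite mul1r.
- move=> i ni; apply: (@le_trans _ _ ((`|dX i| + `|dM i|) ^+ 2)).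
    by rewrite expr2 ler_wpM2l ?addr_ge0.
  apply: (@le_trans _ _ (2 * `|dX i| ^+ 2 + 2 * `|dM i| ^+ 2)).
    by have := sqr_ge0 (`|dX i| - `|dM i|); rewrite sqrrB sqrrD; lra.
  apply: lerD; last by rewrite ler_wpM2l// real_normK ?num_real// m2.
  by rewrite -mulrA ler_wpM2l// expr2 ler_pM// x_ge.
rewrite sumk.
have h1 : 0 <= (b - a) * q by rewrite mulr_ge0.
have h2 : 0 <= (Kt + N) * l ^- 3 * x by rewrite !mulr_ge0 ?addr_ge0.
have h3 : 0 <= l^-1 * x by rewrite mulr_ge0.
have h4 : 0 <= (Kt + N) * q by rewrite mulr_ge0 ?addr_ge0.
move: h1 h2 h3 h4; move: (l ^- 3) (l^-1) => u v; lra.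
Qed.

(** The crossing step is bounded by [|dX| + |dM| <= (b - a) + (1 + q)], so the stopped variation is
    at most a constant plus [q], whose mean will tend to [0]. *)
Lemma discrete_variation_le :
  \sum_(i < n) chi i * `|dA i| <= Kt + N + (b - a) + 1 + q.
Proof.
apply: le_trans (@stopped_sum_le _ n V (fun i => `|dA i|)
  (fun=> k) N 1 (b - a + (1 + q)) V0 N0 ler01 _ Vmon (fun=> k0) _ _) _.
- by apply: addr_ge0 => //; apply: addr_ge0.
- by move=> i ni _; exact: Ainc.
- move=> i ni; apply: le_trans (dA_le i) _; apply: lerD => //.
  apply: le_trans (norm_le_exp4 _ ltr01) _.
  by rewrite expr1n invr1 mul1r lerD2l q_ge.
by rewrite sumk mul1r; lra.
Qed.

Variables (h hp hpp : R -> R) (e C B : R).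
Hypothesis e0 : 0 <= e.
Hypothesis C0 : 0 <= C.
Hypothesis taylor : forall y z, a <= y <= b -> a <= z <= b ->
  `|h z - h y - hp y * (z - y) - hpp y / 2 * (z - y) ^+ 2| <=
  e * (z - y) ^+ 2 + C * (z - y) ^+ 4.
Hypothesis hppB : forall y, a <= y <= b -> `|hpp y / 2| <= B.
Let Y := \sum_(i < n) chi i * ((`|dX i| + `|dM i|) * `|dA i|).

(** Taylor's formula speaks of [dX], the martingale estimates of [dM]. The mismatch in the quadratic
    term is exactly [dX ^+ 2 - dM ^+ 2 = (dX + dM) * dA], which the cross sum [Y] absorbs. *)
Lemma discrete_taylor_error :
  `|\sum_(i < n) chi i * (h (X i.+1) - h (X i) - hp (X i) * dA i - hp (X i) * dM i
      - hpp (X i) / 2 * dM i ^+ 2)| <=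
  e * \sum_(i < n) dM i ^+ 2 + (2 * e + 4 * C * (b - a) ^+ 2 + B) * Y + C * q.
Proof.
apply: le_trans (ler_norm_sum _ _ _) _.
rewrite /Y /q !mulr_sumr -!big_split/=; apply: ler_sum => i _.
rewrite normrM /chi; case: (V i <= N); rewrite /= ?normr0 ?normr1 ?mul0r ?mul1r; last first.
  rewrite mulr0 addr0 addr_ge0// mulr_ge0// ?sqr_ge0//.
  by rewrite (@exprM _ _ 2 2) sqr_ge0.
have t1 := taylor (Xab i) (Xab i.+1).
have t2 := sqr_le_normM (dX i) (dM i).
have t3 := exp4_le_normM (dM i) (dXab i).
rewrite -/(dX i) -/(dA i) in t1 t2 t3.
set u := `|dX i| * `|dA i| in t2 t3.
have uw : 0 <= `|dM i| * `|dA i| by rewrite mulr_ge0.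
have -> : h (X i.+1) - h (X i) - hp (X i) * dA i - hp (X i) * dM i - hpp (X i) / 2 * dM i ^+ 2
  = (h (X i.+1) - h (X i) - hp (X i) * dX i - hpp (X i) / 2 * dX i ^+ 2) +
    hpp (X i) / 2 * ((dX i + dM i) * dA i) by rewrite /dA; ring.
apply: le_trans (ler_normD _ _) _.
have t4 : `|hpp (X i) / 2 * ((dX i + dM i) * dA i)| <= B * ((`|dX i| + `|dM i|) * `|dA i|).
  rewrite normrM ler_pM ?hppB// normrM ler_wpM2r//; exact: ler_normD.
have t5 : e * dX i ^+ 2 <= e * (2 * u + dM i ^+ 2) by rewrite ler_wpM2l.
have t6 : C * dX i ^+ 4 <= C * (4 * (b - a) ^+ 2 * u + dM i ^+ 4) by rewrite ler_wpM2l.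
have t7 : 0 <= (2 * e + 4 * C * (b - a) ^+ 2) * (`|dM i| * `|dA i|).
  by rewrite mulr_ge0// addr_ge0// ?mulr_ge0// sqr_ge0.
apply: le_trans (lerD t1 t4) _.
move: t5 t6 t7; rewrite (mulrDl `|dX i|) -/u; lra.
Qed.

End discretization.

Lemma clamp_excess (R : realType) (L r x : R) : 0 <= L -> 0 <= r -> `|x| <= L + r ->
  `|x - clamp L x| <= r.
Proof.
rewrite /clamp !ler_norml => L0 r0 /andP[x1 x2].
by rewrite /Num.max /Num.min; do ! case: ifPn; rewrite -?leNgt => *; apply/andP; split; lra.
Qed.

Lemma clamp_le_ge0 (R : realType) (L x y : R) : 0 <= L -> 0 <= y -> x <= y -> clamp L x <= y.
Proof.
by rewrite /clamp /Num.max /Num.min => *; do ! case: ifPn; rewrite -?leNgt => *; lra.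
Qed.

Lemma clampN (R : realType) (L x : R) : 0 <= L -> clamp L (- x) = - clamp L x.
Proof.
by rewrite /clamp /Num.max /Num.min => *; do ! case: ifPn; rewrite -?leNgt => *; lra.
Qed.

(** * Ito's formula for the reflected diffusion *)

Section reflected_ito.
Context {R : realType} {d : measure_display} {T : measurableType d}.
Variables (P : probability T R) (F : R -> set (set T)) (W : R -> T -> R).
Hypothesis FP : complete_filtration P F.
Hypothesis WP : brownian_motion P F W.
Local Notation L1 f := (P.-integrable setT (EFin \o f)).
Local Notation "'E[' f ]" := (Rintegral P setT f).
Local Notation leb := (@lebesgue_measure R).

Variables (H M : R -> T -> R) (K : R).
Hypothesis HM : ito_integral P F W H M.
Hypothesis mH : forall t : R, 0 <= t ->
  measurable_fun (`[0, t] `*` setT : set (R * T)) (fun p : R * T => H p.1 p.2).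
Hypothesis K0 : 0 <= K.
Hypothesis HK : {ae P, forall w, forall r, 0 <= r -> `|H r w| <= K}.

Variables (X U D : R -> T -> R) (a b S x : R).
Variables (mu sig2 h hp hpp : R -> R) (qu qd Kmu B KP : R) (Psi : T -> R).
Hypothesis S0 : 0 < S.
Hypothesis aX : adapted F X.
Hypothesis aU : adapted F U.
Hypothesis aD : adapted F D.
Hypothesis Xab : forall t w, a <= X t w <= b.
Hypothesis Umon : forall w s t, s <= t -> U s w <= U t w.
Hypothesis Dmon : forall w s t, s <= t -> D s w <= D t w.
Hypothesis Uge0 : forall w t, 0 <= U t w.
Hypothesis Dge0 : forall w t, 0 <= D t w.

(* Psi is a version of the integral that is measurable and bounded for all w. *)
Definition reflected_path w :=
  [/\ {within `[0, S], continuous (X ^~ w)},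
      [/\ U 0 w = 0, D 0 w = 0 & X 0 w = x],
      forall s t, 0 <= s -> s <= t -> (forall r, s < r <= t -> X r w <> a) -> U t w = U s w,
      forall s t, 0 <= s -> s <= t -> (forall r, s < r <= t -> X r w <> b) -> D t w = D s w &
      [/\ forall t, 0 <= t ->
            X t w = x + \int[leb]_(r in `[0, t]) mu (X r w) + M t w + U t w - D t w,
          forall r, 0 <= r -> clamp K (H r w) ^+ 2 = sig2 (X r w) &
          Psi w = \int[leb]_(r in `[0, S])
            (hp (X r w) * mu (X r w) + hpp (X r w) / 2 * sig2 (X r w))]].

Hypothesis good : {ae P, forall w, reflected_path w}.
Hypothesis cmu : continuous mu.
Hypothesis csig : continuous sig2.
Hypothesis ch : continuous h.
Hypothesis chp : continuous hp.
Hypothesis chpp : continuous hpp.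
Hypothesis hpa : hp a = - qu.
Hypothesis hpb : hp b = qd.
Hypothesis qu0 : 0 <= qu.
Hypothesis qd0 : 0 <= qd.
Hypothesis muK : forall y, a <= y <= b -> `|mu y| <= Kmu.
Hypothesis hB : forall y, a <= y <= b -> `|h y| <= B.
Hypothesis hpB : forall y, a <= y <= b -> `|hp y| <= B.
Hypothesis hppB : forall y, a <= y <= b -> `|hpp y / 2| <= B.
Hypothesis taylor : forall e, 0 < e -> exists2 C, 0 <= C & forall y z,
  a <= y <= b -> a <= z <= b ->
  `|h z - h y - hp y * (z - y) - hpp y / 2 * (z - y) ^+ 2| <=
  e * (z - y) ^+ 2 + C * (z - y) ^+ 4.
Hypothesis mPsi : measurable_fun setT Psi.
Hypothesis PsiK : forall w, `|Psi w| <= KP.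

Let t_ := grid S.
Let V t w := U t w + D t w.
Let dX n i w := X (t_ n i.+1) w - X (t_ n i) w.
Let dM n i w := M (t_ n i.+1) w - M (t_ n i) w.
Let dA n i w := dX n i w - dM n i w.
Let q_ n w := \sum_(i < n.+1) dM n i w ^+ 4.
Let x_ n w := \big[Num.max/0]_(i < n.+1) `|dX n i w|.

Let t0 n i : 0 <= t_ n i. Proof. exact: grid_ge0. Qed.
Let tS n i : t_ n i <= t_ n i.+1. Proof. exact: grid_le. Qed.
Let mX t : 0 <= t -> measurable_fun setT (X t). Proof. exact: (adapted_measurable FP aX). Qed.
Let mU t : 0 <= t -> measurable_fun setT (U t). Proof. exact: (adapted_measurable FP aU). Qed.
Let mD t : 0 <= t -> measurable_fun setT (D t). Proof. exact: (adapted_measurable FP aD). Qed.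
Let mV t : 0 <= t -> measurable_fun setT (V t).
Proof. by move=> tge0; apply: measurable_funD; [exact: mU|exact: mD]. Qed.
Let S0' : 0 <= S. Proof. exact: ltW. Qed.
Let ab : a <= b.
Proof.
have PT : (0 < P setT)%E by rewrite probability_setT lte_fin.
have [w _] := @filter_ex _ _ (ae_properfilter_algebraOfSetsType PT) _ good.
by have /andP[h1 h2] := Xab 0 w; exact: le_trans h2.
Qed.
Let B0 : 0 <= B. Proof. by apply: le_trans (hB (y := a) _); rewrite ?lexx. Qed.
Let Kmu0 : 0 <= Kmu. Proof. by apply: le_trans (muK (y := a) _); rewrite ?lexx. Qed.

Let dX_le n i w : `|dX n i w| <= b - a.
Proof.
have := Xab (t_ n i) w; have := Xab (t_ n i.+1) w; rewrite ler_norml /dX => /andP[h1 h2] /andP[h3 h4].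
by apply/andP; split; lra.
Qed.

Let mdX n i : measurable_fun setT (dX n i).
Proof. by apply: measurable_funB; apply: mX; exact: t0. Qed.

Let m4M n i : finite_moment4 P (dM n i).
Proof. exact: (ito_increment_moment4 FP WP HM mH K0 HK (t0 n i) (tS n i)).1. Qed.

Let m4X n i : finite_moment4 P (dX n i).
Proof.
apply: (finite_moment4_le _ _ (finite_moment4_cst P (b - a))) => // w.
by apply: le_trans (dX_le n i w) _; exact: ler_norm.
Qed.

Let m4A n i : finite_moment4 P (dA n i). Proof. exact: finite_moment4B. Qed.

Let m4norm (f : T -> R) : finite_moment4 P f -> finite_moment4 P (fun w => `|f w|).
Proof.
move=> hf; apply: (finite_moment4_le _ _ hf) => [|w]; last by rewrite normr_id.
by apply: measurableT_comp => //; exact: hf.1.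
Qed.

Let q_L1 n : L1 (q_ n).
Proof. by apply: integrable_rv_sum => i; exact: (integrable_rvX (n := 4)). Qed.

(** Each of the [n.+1] terms has mean of order [(S / n.+1%:R) ^+ 2], so the total is of order
    [n.+1%:R^-1]. *)
Let q_cvg : E[q_ n] @[n --> \oo] --> 0.
Proof.
have Eq n : 0 <= E[q_ n] <= 3 * K ^+ 4 * S ^+ 2 * n.+1%:R^-1.
  rewrite (expect_sum (F := fun i : 'I_n.+1 => fun w => dM n i w ^+ 4)); last first.
    by move=> i; exact: (integrable_rvX (n := 4)).
  apply/andP; split.
    apply: sumr_ge0 => i _; apply: Rintegral_ge0 => w _.
    by rewrite (@exprM _ _ 2 2) sqr_ge0.
  apply: (@le_trans _ _ (\sum_(i < n.+1) 3 * K ^+ 4 * (S / n.+1%:R) ^+ 2)).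
    apply: ler_sum => i _; rewrite -(gridS S n i).
    exact: (ito_increment_moment4 FP WP HM mH K0 HK (t0 n i) (tS n i)).2.
  rewrite sumr_const card_ord -(mulr_natr (3 * K ^+ 4 * (S / n.+1%:R) ^+ 2) n.+1).
  have : n.+1%:R != 0 :> R by [].
  move: n.+1%:R => m m0; rewrite le_eqVlt; apply/orP; left; apply/eqP.
  by field.
apply: (@squeeze_cvgr _ _ _ _ (fun=> 0) (fun n => 3 * K ^+ 4 * S ^+ 2 * n.+1%:R^-1)).
- by apply: nearW => n; exact: Eq.
- exact: cvg_cst.
- rewrite -[X in _ --> X](mulr0 (3 * K ^+ 4 * S ^+ 2)).
  by apply: cvgM; [exact: cvg_cst|exact: cvg_harmonic].
Qed.

Let x_ge0 n w : 0 <= x_ n w.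
Proof. by rewrite /x_; elim/big_ind: _ => // u v u0 v0; rewrite le_max u0. Qed.

Let x_le n w y : 0 <= y -> (forall i, (i <= n)%N -> `|dX n i w| <= y) -> x_ n w <= y.
Proof.
move=> y0 hy; rewrite /x_; elim/big_ind: _ => // [u v hu hv|i _].
  by rewrite ge_max hu.
by apply: hy; rewrite -ltnS.
Qed.

Let x_ba n w : `|x_ n w| <= b - a.
Proof. by rewrite ger0_norm// x_le// subr_ge0. Qed.

Let mx n : measurable_fun setT (x_ n).
Proof. by apply: (@measurable_bigmax _ _ _ n.+1 (fun i w => `|dX n i w|)) => i; exact: measurableT_comp. Qed.

Let x_L1 n : L1 (x_ n).
Proof. exact: (integrable_rv_bounded P (mx n) (x_ba n)). Qed.

Let x_cvg : E[x_ n] @[n --> \oo] --> 0.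
Proof.
rewrite -[X in _ --> X](expect_cst P 0).
apply: (bounded_convergence mx _ x_ba) => //.
have := good; apply: filterS => w [cX _ _ _ _].
apply/cvgrPdist_le => /= e e0.
have := grid_unif_continuous S0 cX e0; apply: filterS => n Hn.
rewrite sub0r normrN ger0_norm// x_le ?(ltW e0)// => i ni.
by rewrite ltW// Hn// lexx tS.
Qed.

Section stopped.
Variable N : R.
Hypothesis N0 : 0 <= N.
Let chi n i w : R := (V (t_ n i) w <= N)%R%:R.
Let Y n w := \sum_(i < n.+1) chi n i w * ((`|dX n i w| + `|dM n i w|) * `|dA n i w|).
(** [SS] carries drift and pushing, [GG] the second order correction with [dM ^+ 2] replaced by its
    compensator, and [BB] the increments of [h]. *)
Let SS n w := \sum_(i < n.+1) chi n i w * (hp (X (t_ n i) w) * dA n i w).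
Let intH n i w := \int[leb]_(r in `[t_ n i, t_ n i.+1]) (clamp K (H r w) ^+ 2).
Let GG n w := \sum_(i < n.+1) chi n i w * (hpp (X (t_ n i) w) / 2) * intH n i w.
Let BB n w := \sum_(i < n.+1) chi n i w * (h (X (t_ n i.+1) w) - h (X (t_ n i) w)).

Let chi01 n i w : 0 <= chi n i w <= 1. Proof. by rewrite /chi; case: (_ <= N); rewrite /= ?ler01 ?lexx. Qed.

Let chi_le1 n i w : `|chi n i w| <= 1.
Proof. by have /andP[h1 h2] := chi01 n i w; rewrite ger0_norm. Qed.

Let Fchi n i : measurable_wrt (F (t_ n i)) (chi n i).
Proof.
apply: (measurable_wrt_comp (phi := fun y : R => (y <= N)%R%:R)); last first.
  by apply: (measurable_wrtD (filtration_sigma_algebra FP (t0 n i))); [exact: aU|exact: aD].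
rewrite (_ : (fun y => _) = \1_(`]-oo, N])); first exact: measurable_indic.
by apply/funext => y; rewrite indicE mem_setE in_itv.
Qed.

Let Fcomp n i (phi : R -> R) : continuous phi ->
  measurable_wrt (F (t_ n i)) (fun w => phi (X (t_ n i) w)).
Proof.
move=> cphi; apply: measurable_wrt_comp; last exact: aX.
exact: continuous_measurable_fun.
Qed.

Let Fchicomp n i (phi : R -> R) : continuous phi ->
  measurable_wrt (F (t_ n i)) (fun w => chi n i w * phi (X (t_ n i) w)).
Proof.
move=> cphi; apply: (measurable_wrtM (filtration_sigma_algebra FP (t0 n i))) => //.
exact: Fcomp.
Qed.

Let Fmeas n i (f : T -> R) : measurable_wrt (F (t_ n i)) f -> measurable_fun setT f.
Proof. exact: (measurable_wrt_measurable (filtration_measurable FP (t0 n i))). Qed.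

Let chicomp_le n i (phi : R -> R) w : (forall y, a <= y <= b -> `|phi y| <= B) ->
  `|chi n i w * phi (X (t_ n i) w)| <= B.
Proof.
move=> hphi; rewrite normrM -[leRHS]mul1r ler_pM//; exact: hphi.
Qed.

Let chpp2 : continuous (fun y => hpp y / 2).
Proof. by move=> y; apply: cvgM; [exact: chpp|exact: cvg_cst]. Qed.

Let path_bound w : reflected_path w -> forall n i, (i < n.+1)%N ->
  `|dX n i w - dM n i w| <= 1 * (Kmu * (S / n.+1%:R) + (V (t_ n i.+1) w - V (t_ n i) w)).
Proof.
move=> [cX [U00 D00 X00] Uf Df [XE _ _]] n i ni.
exact: (@path_increment_bound R a b S x (X ^~ w) (M ^~ w) (U ^~ w) (D ^~ w) mu Kmu S0 (fun t _ => Xab t w) cX (@Umon w) (@Dmon w) XE cmu muK n i ni).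
Qed.

Let KtE n : (Kmu * (S / n.+1%:R)) *+ n.+1 = Kmu * S.
Proof. by rewrite -[LHS]mulr_natr -[LHS]mulrA divfK. Qed.

Let V0 t w : 0 <= V t w. Proof. by rewrite addr_ge0. Qed.
Let Vmon n i w : V (t_ n i) w <= V (t_ n i.+1) w. Proof. by rewrite lerD ?Umon ?Dmon. Qed.
Let k0 n : 0 <= Kmu * (S / n.+1%:R). Proof. by rewrite mulr_ge0// divr_ge0// ltW. Qed.

Let Y_le w l n : reflected_path w -> 0 < l ->
  Y n w <= (Kmu * S + N + 2) * l +
    (Kmu * S + N + 2 * (b - a) + (Kmu * S + N) * l ^- 3 + 2 * l^-1) * (x_ n w + q_ n w).
Proof.
move=> gw l0.
refine (@discrete_cross_le R n.+1 (fun i => X (t_ n i) w) (fun i => M (t_ n i) w)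
  (fun i => V (t_ n i) w) a b N _ _ (fun i => Xab (t_ n i) w) (V0 (t_ n 0) w) N0 (k0 n)
  (fun i => Vmon n i w) (KtE n) (path_bound gw (n := n)) l l0).
Qed.

Let Y_L1 n : L1 (Y n).
Proof.
apply: integrable_rv_sum => i.
apply: (integrable_rvMb (K := 1) _ (chi_le1 n i)); first exact: Fmeas (Fchi n i).
by apply: (integrable_rvXM (i := 1) (j := 1)) => //; [apply: finite_moment4D|]; exact: m4norm.
Qed.

Let Y_ge0 n w : 0 <= Y n w.
Proof.
apply: sumr_ge0 => i _; have /andP[c0 _] := chi01 n i w.
by rewrite !mulr_ge0// addr_ge0.
Qed.

Let Y_cvg : E[Y n] @[n --> \oo] --> 0.
Proof.
apply: (@cvg_linear_bound _ _ (fun n => E[x_ n] + E[q_ n]) _ (Kmu * S + N + 2)).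
  by rewrite -[X in _ --> X]addr0; apply: cvgD.
move=> l l0.
exists (Kmu * S + N + 2 * (b - a) + (Kmu * S + N) * l ^- 3 + 2 * l^-1) => n.
set C := (X in _ + X * _); rewrite subr0.
have Lxq : L1 (fun w => x_ n w + q_ n w) by exact: integrable_rvD.
have LC : L1 (fun w => C * (x_ n w + q_ n w)) by exact: integrable_rvZ.
have Lc := integrable_rv_cst P ((Kmu * S + N + 2) * l).
apply: le_trans (expect_norm_le (Y_L1 n) (integrable_rvD Lc LC) _) _.
  have := good; apply: filterS => w gw /=.
  by rewrite ger0_norm//; exact: Y_le.
by rewrite (expectD Lc LC) expect_cst (expectZ C Lxq) expectD.
Qed.

Let Err n w := \sum_(i < n.+1) chi n i w * (h (X (t_ n i.+1) w) - h (X (t_ n i) w)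
  - hp (X (t_ n i) w) * dA n i w - hp (X (t_ n i) w) * dM n i w
  - hpp (X (t_ n i) w) / 2 * dM n i w ^+ 2).
Let Q2 n w := \sum_(i < n.+1) dM n i w ^+ 2.
Let M1 n w := \sum_(i < n.+1) chi n i w * hp (X (t_ n i) w) * dM n i w.
Let M2 n w := \sum_(i < n.+1) chi n i w * (hpp (X (t_ n i) w) / 2) * dM n i w ^+ 2.

Let BBE n w : BB n w = SS n w + M1 n w + M2 n w + Err n w.
Proof. by rewrite /BB /SS /M1 /M2 /Err -!big_split/=; apply: eq_bigr => i _; ring. Qed.

Let mhp n i : measurable_fun setT (fun w => chi n i w * hp (X (t_ n i) w)).
Proof. exact: Fmeas (Fchicomp n i chp). Qed.

Let mhpp n i : measurable_fun setT (fun w => chi n i w * (hpp (X (t_ n i) w) / 2)).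
Proof. exact: Fmeas (Fchicomp n i chpp2). Qed.

Let hp_le n i w : `|chi n i w * hp (X (t_ n i) w)| <= B.
Proof. exact: chicomp_le. Qed.

Let hpp_le n i w : `|chi n i w * (hpp (X (t_ n i) w) / 2)| <= B.
Proof. exact: (@chicomp_le n i (fun y => hpp y / 2) w hppB). Qed.

Let M1i_L1 n i : L1 (fun w => chi n i w * hp (X (t_ n i) w) * dM n i w).
Proof. exact: (integrable_rvMb (mhp n i) (hp_le n i) (integrable_rv4 (m4M n i))). Qed.

Let M2i_L1 n i : L1 (fun w => chi n i w * (hpp (X (t_ n i) w) / 2) * dM n i w ^+ 2).
Proof. by apply: (integrable_rvMb (mhpp n i) (hpp_le n i)); exact: (integrable_rvX (n := 2)). Qed.

Let M1_L1 n : L1 (M1 n).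
Proof. exact: integrable_rv_sum. Qed.

Let M2_L1 n : L1 (M2 n).
Proof. exact: integrable_rv_sum. Qed.

Let SS_L1 n : L1 (SS n).
Proof.
apply: integrable_rv_sum => i.
rewrite (_ : (fun w => _) = fun w => chi n i w * hp (X (t_ n i) w) * dA n i w).
  exact: (integrable_rvMb (mhp n i) (hp_le n i) (integrable_rv4 (m4A n i))).
by apply/funext => w; rewrite mulrA.
Qed.

Let mhX t : 0 <= t -> measurable_fun setT (fun w => h (X t w)).
Proof. by move=> tge0; apply: measurableT_comp; [exact: continuous_measurable_fun|exact: mX]. Qed.

Let hX_L1 t : 0 <= t -> L1 (fun w => h (X t w)).
Proof.
by move=> tge0; apply: (integrable_rv_bounded P (mhX tge0) (K := B)) => w; exact: hB.
Qed.

Let BB_L1 n : L1 (BB n).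
Proof.
apply: integrable_rv_sum => i; apply: (integrable_rvMb (K := 1) (Fmeas (Fchi n i)) (chi_le1 n i)).
by apply: integrable_rvB; apply: hX_L1; exact: t0.
Qed.

Let Err_L1 n : L1 (Err n).
Proof.
rewrite (_ : Err n = fun w => BB n w - (SS n w + M1 n w + M2 n w)).
  by apply: integrable_rvB => //; apply: integrable_rvD => //; exact: integrable_rvD.
by apply/funext => w; rewrite BBE addrC addKr.
Qed.

Let mH2 : measurable_fun (`[0, S] `*` setT : set (R * T))
  (fun p : R * T => clamp K (H p.1 p.2) ^+ 2).
Proof.
apply: (@measurableT_comp _ _ _ _ _ _ (fun y : R => clamp K y ^+ 2)); last exact: mH.
exact: (measurable_funX 2 (measurable_clamp K (@measurable_id _ (measurableTypeR R) setT))).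
Qed.

Let mint n i : (i <= n)%N -> measurable_fun setT (intH n i).
Proof.
move=> ni; apply: (measurable_Rintegral_param (f := fun r w => clamp K (H r w) ^+ 2) mH2) => //.
- by move=> r w; exact: sqr_ge0.
- exact: grid_leT.
Qed.

Let clampK r w : `|clamp K (H r w) ^+ 2| <= K ^+ 2.
Proof. by rewrite normrX lerXn2r ?nnegrE ?clamp_le. Qed.

Let int_le n i w : (i <= n)%N -> `|intH n i w| <= K ^+ 2 * (S / n.+1%:R).
Proof.
move=> ni; rewrite -(gridS S n i); apply: Rintegral_itv_bound => //.
have := measurable_fun_section (f := fun r w => clamp K (H r w) ^+ 2) w mH2.
apply: measurable_funS => //; apply: subset_itv; rewrite bnd_simp; first exact: t0.
exact: grid_leT.
Qed.

Let int_L1 n i : (i <= n)%N -> L1 (intH n i).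
Proof. by move=> ni; apply: (integrable_rv_bounded P (mint ni)) => w; exact: int_le. Qed.

Let isometry n i (xi : T -> R) L : (i <= n)%N -> measurable_wrt (F (t_ n i)) xi ->
  (forall w, `|xi w| <= L) ->
  E[fun w => xi w * dM n i w] = 0 /\
  E[fun w => xi w * dM n i w ^+ 2] = E[fun w => xi w * intH n i w].
Proof.
move=> ni Fxi xiL.
exact: (expect_ito_increment FP WP HM mH K0 HK (t0 n i) (tS n i) Fxi xiL).
Qed.

Let Q2_L1 n : L1 (Q2 n).
Proof. by apply: integrable_rv_sum => i; exact: (integrable_rvX (n := 2)). Qed.

Let sum_step n C : \sum_(i < n.+1) C * (S / n.+1%:R) = C * S.
Proof. by rewrite sumr_const card_ord -[LHS]mulr_natr -[LHS]mulrA divfK. Qed.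

Let EQ2 n : E[Q2 n] <= K ^+ 2 * S.
Proof.
rewrite (expect_sum (F := fun i : 'I_n.+1 => fun w => dM n i w ^+ 2)); last first.
  by move=> i; exact: (integrable_rvX (n := 2)).
rewrite -(sum_step n); apply: ler_sum => i _.
have ni : (i <= n)%N by rewrite -ltnS.
have [|_] := @isometry n i (fun=> 1) 1 ni
  (measurable_wrt_cst (filtration_sigma_algebra FP (t0 n i)) 1); first by move=> _; rewrite normr1.
under [in LHS]eq_Rintegral do rewrite mul1r.
under [in RHS]eq_Rintegral do rewrite mul1r.
move=> ->; rewrite -[leRHS](expect_cst P); apply: expect_le; [exact: int_L1|exact: integrable_rv_cst|].
by move=> w; apply: le_trans (int_le w ni); exact: ler_norm.
Qed.

Let EM1 n : E[M1 n] = 0.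
Proof.
rewrite (expect_sum (F := fun i : 'I_n.+1 => fun w => chi n i w * hp (X (t_ n i) w) * dM n i w))//.
rewrite big1// => i _; have ni : (i <= n)%N by rewrite -ltnS.
exact: (@isometry n i _ B ni (Fchicomp n i chp) (hp_le n i)).1.
Qed.

Let GGi_L1 n i : (i <= n)%N -> L1 (fun w => chi n i w * (hpp (X (t_ n i) w) / 2) * intH n i w).
Proof. by move=> ni; exact: (integrable_rvMb (mhpp n i) (hpp_le n i) (int_L1 ni)). Qed.

Let GG_L1 n : L1 (GG n).
Proof. by apply: integrable_rv_sum => i; apply: GGi_L1; rewrite -ltnS. Qed.

Let EM2 n : E[M2 n] = E[GG n].
Proof.
rewrite (expect_sum (F := fun i : 'I_n.+1 => fun w => chi n i w * (hpp (X (t_ n i) w) / 2) * dM n i w ^+ 2))//.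
rewrite (expect_sum (F := fun i : 'I_n.+1 => fun w => chi n i w * (hpp (X (t_ n i) w) / 2) * intH n i w)); last first.
  by move=> i; apply: GGi_L1; rewrite -ltnS.
apply: eq_bigr => i _; have ni : (i <= n)%N by rewrite -ltnS.
exact: (@isometry n i _ B ni (Fchicomp n i chpp2) (hpp_le n i)).2.
Qed.

Let EBB n : E[BB n] = E[SS n] + E[GG n] + E[Err n].
Proof.
rewrite (_ : BB n = fun w => SS n w + M1 n w + M2 n w + Err n w); last exact/funext/BBE.
have L12 : L1 (fun w => SS n w + M1 n w) by exact: integrable_rvD.
have L123 : L1 (fun w => SS n w + M1 n w + M2 n w) by exact: integrable_rvD.
by rewrite !expectD// EM1 EM2 addr0.
Qed.

Let Err_cvg : E[Err n] @[n --> \oo] --> 0.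
Proof.
apply: (@cvg_linear_bound _ _ (fun n => E[Y n] + E[q_ n]) _ (K ^+ 2 * S)).
  by rewrite -[X in _ --> X]addr0; apply: cvgD.
move=> l l0; have [C C0 hC] := taylor l0.
pose c1 := 2 * l + 4 * C * (b - a) ^+ 2 + B.
have c10 : 0 <= c1.
  apply: addr_ge0 => //; apply: addr_ge0; first by rewrite mulr_ge0// ltW.
  by rewrite mulr_ge0 ?sqr_ge0// mulr_ge0.
exists (c1 + C) => n; rewrite subr0.
have LQ := integrable_rvZ l (Q2_L1 n).
have LY := integrable_rvZ c1 (Y_L1 n).
have Lq := integrable_rvZ C (q_L1 n).
have LQY := integrable_rvD LQ LY.
apply: le_trans (expect_norm_le (Err_L1 n) (integrable_rvD LQY Lq) _) _.
  apply: aeW => w; exact: (@discrete_taylor_error R n.+1 (fun i => X (t_ n i) w)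
    (fun i => M (t_ n i) w) (fun i => V (t_ n i) w) a b N (fun i => Xab (t_ n i) w)
    h hp hpp l C B (ltW l0) C0 hC hppB).
rewrite (expectD LQY Lq) (expectD LQ LY) (expectZ l (Q2_L1 n)) (expectZ c1 (Y_L1 n)) (expectZ C (q_L1 n)).
have EY0 : 0 <= E[Y n] by apply: Rintegral_ge0 => w _; exact: Y_ge0.
have Eq0 : 0 <= E[q_ n].
  by apply: Rintegral_ge0 => w _; apply: sumr_ge0 => i _; rewrite (@exprM _ _ 2 2) sqr_ge0.
have h1 := ler_wpM2l (ltW l0) (EQ2 n).
have h2 := mulr_ge0 c10 Eq0; have h3 := mulr_ge0 C0 EY0.
by move: h1 h2 h3; clearbody c1; lra.
Qed.

Let L w := qu * U S w + qd * D S w.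
Let rho w : R := (V S w <= N)%R%:R.
Let p := E[fun w => 1 - rho w].
Let c1 := Kmu * S + N + (b - a) + 1.
Let k1 := B * Kmu * S.
Let k := k1 + B * K ^+ 2 * S.
(** [SS] is at most [B * c1] up to the random error [B * q_]. Clamping at that level costs a
    quantity vanishing in mean and bounds the sums by a constant, as bounded convergence
    requires. *)
Let ss n w := clamp (B * c1) (SS n w).

Let ba0 : 0 <= b - a. Proof. by rewrite subr_ge0. Qed.
Let KS0 : 0 <= Kmu * S. Proof. exact: mulr_ge0. Qed.
Let k10 : 0 <= k1. Proof. by rewrite /k1 -mulrA mulr_ge0. Qed.
Let kk0 : 0 <= B * K ^+ 2 * S. Proof. by rewrite mulr_ge0// mulr_ge0// sqr_ge0. Qed.
Let c10 : 0 <= c1. Proof. by move: KS0 ba0 N0; rewrite /c1; move: (Kmu * S) => z; lra. Qed.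
Let Bc10 : 0 <= B * c1. Proof. exact: mulr_ge0. Qed.
Let L0 w : 0 <= L w. Proof. by rewrite addr_ge0// mulr_ge0. Qed.
Let rho01 w : rho w = 0 \/ rho w = 1.
Proof. by rewrite /rho; case: (_ <= N); [right|left]. Qed.

Let mle (f : T -> R) : measurable_fun setT f -> measurable_fun setT (fun w => (f w <= N)%R%:R : R).
Proof.
move=> mf; apply: (@measurableT_comp _ _ _ _ _ _ (fun y : R => (y <= N)%R%:R : R)) => //.
rewrite (_ : (fun y => _) = \1_(`]-oo, N])); first exact: measurable_indic.
by apply/funext => y; rewrite indicE mem_setE in_itv.
Qed.

Let mrho : measurable_fun setT rho. Proof. by apply: mle; exact: mV. Qed.
Let mL : measurable_fun setT L.
Proof. by apply: measurable_funD; apply: measurable_funM => //; [exact: mU|exact: mD]. Qed.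

Let rho_le1 w : `|rho w| <= 1.
Proof. by case: (rho01 w) => ->; rewrite ?normr0 ?normr1. Qed.
Let rhoC_le1 w : `|1 - rho w| <= 1.
Proof. by case: (rho01 w) => ->; rewrite ?subr0 ?subrr ?normr0 ?normr1. Qed.
Let mrhoC : measurable_fun setT (fun w => 1 - rho w).
Proof. exact: measurable_funB. Qed.
Let rhoC_L1 : L1 (fun w => 1 - rho w).
Proof. exact: (integrable_rv_bounded P mrhoC rhoC_le1). Qed.

Let SS_le w n : reflected_path w -> `|SS n w| <= B * c1 + B * q_ n w.
Proof.
move=> gw; apply: le_trans (ler_norm_sum _ _ _) _.
apply: (@le_trans _ _ (\sum_(i < n.+1) B * (chi n i w * `|dA n i w|))).
  apply: ler_sum => i _; have /andP[c0 _] := chi01 n i w.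
  by rewrite !normrM mulrCA (ger0_norm c0) ler_wpM2r ?hpB// mulr_ge0.
rewrite -mulr_sumr -mulrDr ler_wpM2l//.
exact: (@discrete_variation_le R n.+1 (fun i => X (t_ n i) w) (fun i => M (t_ n i) w)
  (fun i => V (t_ n i) w) a b N _ _ (fun i => Xab (t_ n i) w) (V0 (t_ n 0) w) N0 (k0 n)
  (fun i => Vmon n i w) (KtE n) (path_bound gw (n := n))).
Qed.

Let ss_le n w : `|ss n w| <= B * c1. Proof. exact: clamp_le. Qed.
Let mss n : measurable_fun setT (ss n).
Proof. by apply: measurable_clamp; exact: integrable_measurable (SS_L1 n). Qed.
Let ss_L1 n : L1 (ss n).
Proof. exact: (integrable_rv_bounded P (mss n) (ss_le n)). Qed.

Let q_ge0 n w : 0 <= q_ n w.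
Proof. by apply: sumr_ge0 => i _; rewrite (@exprM _ _ 2 2) sqr_ge0. Qed.

Let delta n := E[BB n] - (E[ss n] + E[GG n]).

Let delta_cvg : delta n @[n --> \oo] --> 0.
Proof.
have -> : delta = fun n => E[fun w => SS n w - ss n w] + E[Err n].
  by apply/funext => n; rewrite /delta EBB expectB//; ring.
rewrite -[X in _ --> X]addr0; apply: cvgD => //.
apply: (@cvg_linear_bound _ _ (fun n => E[q_ n]) _ 0) => // l l0.
exists B => n; rewrite subr0 mul0r add0r -expectZ//.
apply: expect_norm_le; [exact: integrable_rvB|exact: integrable_rvZ|].
have := good; apply: filterS => w gw.
by apply: clamp_excess => //; [rewrite mulr_ge0|exact: SS_le].
Qed.

Let GG_le n w : `|GG n w| <= B * K ^+ 2 * S.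
Proof.
apply: le_trans (ler_norm_sum _ _ _) _; rewrite -(sum_step n); apply: ler_sum => i _.
have ni : (i <= n)%N by rewrite -ltnS.
by rewrite normrM -mulrA; apply: ler_pM => //; exact: int_le.
Qed.

Let chi1 n i w : V S w <= N -> (i <= n.+1)%N -> chi n i w = 1.
Proof.
move=> VN ni; rewrite /chi (le_trans _ VN)//.
by rewrite lerD ?Umon ?Dmon//; exact: (grid_leT S0 ni).
Qed.

Let ss_id w n : reflected_path w -> V S w <= N -> ss n w = SS n w.
Proof.
move=> gw VN; rewrite /ss clamp_id//; apply: le_trans (ler_norm_sum _ _ _) _.
apply: (@le_trans _ _ (\sum_(i < n.+1) B * (Kmu * (S / n.+1%:R) + (V (t_ n i.+1) w - V (t_ n i) w)))).
  apply: ler_sum => i _; rewrite chi1//; last exact/ltnW/ltn_ord.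
  rewrite mul1r normrM ler_pM ?hpB//.
  by have := path_bound gw (ltn_ord i); rewrite mul1r.
rewrite -mulr_sumr big_split/= sum_step ler_wpM2l//.
rewrite -(big_mkord xpredT (fun i => V (t_ n i.+1) w - V (t_ n i) w)) telescope_sumr//.
rewrite /t_ gridT /c1; move: VN ba0 (V0 (grid S n 0) w); move: (Kmu * S) => z; lra.
Qed.

Let J_cvg w : reflected_path w -> V S w <= N -> ss n w + GG n w @[n --> \oo] --> Psi w - L w.
Proof.
move=> gw VN; have [cX [U00 D00 X00] Uf Df [XE H2 PsiE]] := gw.
apply/cvgrPdist_le => /= e e0.
have := @path_sum_cvg R a b S x (X ^~ w) (M ^~ w) (U ^~ w) (D ^~ w) mu sig2 hp hpp qu qd Kmu
  S0 (fun t _ => Xab t w) cX (@Umon w) (@Dmon w) U00 D00 Uf Df XE cmu csig chp chpp hpa hpb muK e e0.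
apply: filterS => n; rewrite distrC -PsiE; apply: le_trans.
rewrite (ss_id n gw VN) -big_split/=.
rewrite le_eqVlt; apply/orP; left; apply/eqP; congr (`|_ - _|).
apply: eq_bigr => i _; rewrite chi1//; last exact/ltnW/ltn_ord.
rewrite !mul1r; congr (_ + _ * _).
apply: eq_Rintegral => r; rewrite inE/= in_itv/= => /andP[r1 _].
by apply: H2; exact: le_trans (t0 n i) r1.
Qed.

Let ss_bounds w : reflected_path w -> forall e, 0 < e -> \forall n \near \oo,
  ss n w <= k1 + e * V S w /\ - ss n w <= k1 + L w + e * V S w.
Proof.
move=> gw e e0; have [cX [U00 D00 X00] Uf Df [XE H2 PsiE]] := gw.
have := @path_sum_bounds R a b S x (X ^~ w) (M ^~ w) (U ^~ w) (D ^~ w) mu hp qu qd Kmu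
  S0 (fun t _ => Xab t w) cX (@Umon w) (@Dmon w) U00 D00 Uf Df XE cmu chp hpa hpb qu0 qd0 muK
  B e hpB e0.
apply: filterS => n /(_ N)/= [h1 h2].
have eV : 0 <= e * V S w by rewrite mulr_ge0// ltW.
split; first by apply: clamp_le_ge0 => //; exact: addr_ge0.
rewrite /ss -clampN//; apply: clamp_le_ge0 => //.
by rewrite addr_ge0// addr_ge0.
Qed.

Let hS w := h (X S w).

Let EhX0 : E[fun w => h (X 0 w)] = h x.
Proof.
rewrite -[RHS](expect_cst P); apply: expect_eq_ae => //; first exact: mhX.
by have := good; apply: filterS => w [_ [_ _ ->]].
Qed.

(** On [V S w <= N] the stopped sum is the full increment; otherwise it ends at some grid point, and
    two values of [h] differ by at most [2 * B]. *)
Let BB_le n w : `|BB n w - (hS w - h (X 0 w))| <= 2 * B * (1 - rho w).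
Proof.
have [j jn []] := @stopped_telescope R n.+1 (fun i => V (t_ n i) w) (fun i => h (X (t_ n i) w)) N
  (fun i => Vmon n i w).
rewrite /t_ grid0 gridT /BB => -> jE; rewrite /rho.
case: (leP (V S w) N) => [VN|_] /=.
  by rewrite (jE VN) gridT subrr normr0 subrr mulr0.
rewrite subr0 mulr1 opprB addrA subrK.
apply: le_trans (ler_normB _ _) _; rewrite mulrDl mul1r addrC.
by rewrite lerD// ?hB.
Qed.

Let EBB_le n : `|E[BB n] - (E[hS] - h x)| <= 2 * B * p.
Proof.
have LhX0 := hX_L1 (lexx 0); have LhS := hX_L1 S0'.
have Lh : L1 (fun w => hS w - h (X 0 w)) by exact: integrable_rvB.
rewrite -EhX0 -expectB// -expectB// /p -expectZ//.
apply: expect_norm_le; [exact: integrable_rvB|exact: integrable_rvZ|].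
by apply: aeW => w; exact: BB_le.
Qed.

Let rhoL_le w : `|rho w * L w| <= (qu + qd) * N.
Proof.
rewrite /rho; case: (leP (V S w) N) => [VN|_] /=; last first.
  by rewrite mul0r normr0 mulr_ge0// addr_ge0.
rewrite mul1r ger0_norm// /L mulrDl lerD// ler_wpM2l//.
  by apply: le_trans VN; rewrite lerDl.
by apply: le_trans VN; rewrite lerDr.
Qed.

Let rhoL_L1 : L1 (fun w => rho w * L w).
Proof.
by apply: (integrable_rv_bounded P _ rhoL_le); exact: measurable_funM.
Qed.

Let rhoPsi_L1 : L1 (fun w => rho w * Psi w).
Proof.
apply: (integrable_rvMb mrho rho_le1); exact: (integrable_rv_bounded P mPsi PsiK).
Qed.

Let rhoLam_L1 : L1 (fun w => rho w * (Psi w - L w)).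
Proof. by under eq_fun do rewrite mulrBr; exact: integrable_rvB. Qed.

Let rhoCk_L1 : L1 (fun w => (1 - rho w) * k).
Proof. by under eq_fun do rewrite mulrC; exact: integrable_rvZ. Qed.

Let ErhoCk : E[fun w => (1 - rho w) * k] = k * p.
Proof. by under eq_Rintegral do rewrite mulrC; exact: expectZ. Qed.

Let mGG n : measurable_fun setT (GG n). Proof. exact: integrable_measurable (GG_L1 n). Qed.

(** Bounded envelopes of [ss n w + GG n w], which need not converge where [V S w > N]. There [fu] is
    [k], and [fl] is [- k], corrected by the excess over a one-sided bound; the excess tends to [0],
    so both envelopes converge almost surely. On that event [fl] is a lower bound only after the
    cost [L] is added. *)
Let fu n w := rho w * (ss n w + GG n w) + (1 - rho w) * (k + Num.max 0 (ss n w - k1)).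
Let fl n w := rho w * (ss n w + GG n w) - (1 - rho w) * (k + Num.max 0 (- ss n w - k1 - L w)).
Let Kf := 2 * (B * c1) + B * K ^+ 2 * S + k.

Let k_ge0 : 0 <= k. Proof. exact: addr_ge0. Qed.

Let mfu n : measurable_fun setT (fu n).
Proof.
apply: measurable_funD; apply: measurable_funM => //; first exact: measurable_funD.
apply: measurable_funD => //; apply: measurable_maxr => //; exact: measurable_funB.
Qed.

Let mfl n : measurable_fun setT (fl n).
Proof.
apply: measurable_funB; apply: measurable_funM => //; first exact: measurable_funD.
apply: measurable_funD => //; apply: measurable_maxr => //.
by apply: measurable_funB => //; apply: measurable_funB => //; exact: measurableT_comp.
Qed.

Let max_le (y z : R) : 0 <= z -> y <= z -> 0 <= Num.max 0 y <= z.
Proof. by move=> z0 yz; rewrite le_max lexx ge_max z0 yz. Qed.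

Let fu_le n w : `|fu n w| <= Kf.
Proof.
have := ss_le n w; have := GG_le n w; rewrite /fu /Kf !ler_norml => /andP[g1 g2] /andP[s1 s2].
have /andP[m1 m2] : 0 <= Num.max 0 (ss n w - k1) <= B * c1.
  by apply: max_le => //; move: k10; lra.
move: g1 g2 s1 s2 m1 m2 Bc10 kk0 k_ge0.
move: (ss n w) (GG n w) (Num.max _ _) (B * c1) (B * K ^+ 2 * S) k => s g m u v z.
by case: (rho01 w) => -> => *; apply/andP; split; lra.
Qed.

Let fl_le n w : `|fl n w| <= Kf.
Proof.
have := ss_le n w; have := GG_le n w; rewrite /fl /Kf !ler_norml => /andP[g1 g2] /andP[s1 s2].
have /andP[m1 m2] : 0 <= Num.max 0 (- ss n w - k1 - L w) <= B * c1.
  by apply: max_le => //; move: k10 (L0 w); lra.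
move: g1 g2 s1 s2 m1 m2 Bc10 kk0 k_ge0.
move: (ss n w) (GG n w) (Num.max _ _) (B * c1) (B * K ^+ 2 * S) k => s g m u v z.
by case: (rho01 w) => -> => *; apply/andP; split; lra.
Qed.

Let vanish (y : nat -> R) z : 0 <= z -> (forall e, 0 < e -> \forall n \near \oo, y n <= e * z) ->
  Num.max 0 (y n) @[n --> \oo] --> (0 : R).
Proof.
move=> z0 hy; apply/cvgrPdist_le => /= e e0.
have e1 : 0 < e / (z + 1) by rewrite divr_gt0// ltr_wpDl.
have := hy _ e1; apply: filterS => n hn.
rewrite sub0r normrN ger0_norm ?le_max ?lexx// ge_max (ltW e0)/=.
apply: le_trans hn _; rewrite mulrAC ler_pdivrMr ?ltr_wpDl// ler_wpM2l// ?(ltW e0)//.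
by rewrite lerDl.
Qed.

Let fu_cvg w : reflected_path w ->
  fu n w @[n --> \oo] --> rho w * (Psi w - L w) + (1 - rho w) * k.
Proof.
move=> gw; have [VN|VN] := leP (V S w) N.
  have r1 : rho w = 1 by rewrite /rho VN.
  rewrite (_ : (fun n => fu n w) = fun n => ss n w + GG n w); last first.
    by apply/funext => n; rewrite /fu r1 mul1r subrr mul0r addr0.
  by rewrite r1 mul1r subrr mul0r addr0; exact: J_cvg.
have r0 : rho w = 0 by rewrite /rho leNgt VN.
rewrite (_ : (fun n => fu n w) = fun n => k + Num.max 0 (ss n w - k1)); last first.
  by apply/funext => n; rewrite /fu r0 mul0r subr0 mul1r add0r.
rewrite r0 mul0r subr0 mul1r add0r -[X in _ --> X]addr0; apply: cvgD; first exact: cvg_cst.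
apply: (@vanish _ _ (V0 S w)) => e e0; have := ss_bounds gw e0; apply: filterS => n [h1 _].
by rewrite lerBlDl.
Qed.

Let fl_cvg w : reflected_path w ->
  fl n w @[n --> \oo] --> rho w * (Psi w - L w) - (1 - rho w) * k.
Proof.
move=> gw; have [VN|VN] := leP (V S w) N.
  have r1 : rho w = 1 by rewrite /rho VN.
  rewrite (_ : (fun n => fl n w) = fun n => ss n w + GG n w); last first.
    by apply/funext => n; rewrite /fl r1 mul1r subrr mul0r subr0.
  by rewrite r1 mul1r subrr mul0r subr0; exact: J_cvg.
have r0 : rho w = 0 by rewrite /rho leNgt VN.
rewrite (_ : (fun n => fl n w) = fun n => - (k + Num.max 0 (- ss n w - k1 - L w))); last first.
  by apply/funext => n; rewrite /fl r0 mul0r subr0 mul1r sub0r.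
rewrite r0 mul0r subr0 mul1r sub0r.
suff c : k + Num.max 0 (- ss n w - k1 - L w) @[n --> \oo] --> k by exact: (cvgN c).
rewrite -[X in _ --> X]addr0; apply: cvgD; first exact: cvg_cst.
apply: (@vanish _ _ (V0 S w)) => e e0; have := ss_bounds gw e0; apply: filterS => n [_ h1].
by rewrite -addrA -opprD lerBlDl.
Qed.

Let fu_ge n w : ss n w + GG n w <= fu n w.
Proof.
rewrite /fu; case: (rho01 w) => ->; last by rewrite mul1r subrr mul0r addr0.
rewrite mul0r subr0 mul1r add0r /k.
have := GG_le n w; rewrite ler_norml => /andP[_].
have : ss n w - k1 <= Num.max 0 (ss n w - k1) by rewrite le_max lexx orbT.
move: (Num.max 0 (ss n w - k1)) (ss n w) (GG n w) (B * K ^+ 2 * S) k1 => m s g v z; lra.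
Qed.

Let fl_ge n w : fl n w <= ss n w + GG n w + (1 - rho w) * L w.
Proof.
rewrite /fl; case: (rho01 w) => ->; last by rewrite mul1r subrr !mul0r addr0 subr0.
rewrite mul0r subr0 !mul1r add0r /k.
have := GG_le n w; rewrite ler_norml => /andP[+ _].
have : - ss n w - k1 - L w <= Num.max 0 (- ss n w - k1 - L w) by rewrite le_max lexx orbT.
move: (Num.max 0 (- ss n w - k1 - L w)) (ss n w) (GG n w) (B * K ^+ 2 * S) (L w) k1 => m s g v y z; lra.
Qed.

Let fu_L1 n : L1 (fu n). Proof. exact: (integrable_rv_bounded P (mfu n) (fu_le n)). Qed.
Let fl_L1 n : L1 (fl n). Proof. exact: (integrable_rv_bounded P (mfl n) (fl_le n)). Qed.

(* On V_S > N the sums ss n do not converge to anything useful, since the weights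
   stop the sum in the middle; the one-sided bounds ss_bounds, which hold because
   h' dA is - q_u dU - q_d dD up to the drift, are enough. *)
Lemma reflected_ito_upper : E[fun w => h (X S w)] - h x <=
  E[fun w => rho w * (Psi w - L w)] + (k + 2 * B) * p.
Proof.
have c : E[fu n] + delta n @[n --> \oo] --> E[fun w => rho w * (Psi w - L w)] + k * p.
  rewrite -[X in _ --> X]addr0; apply: cvgD; last exact: delta_cvg.
  rewrite -ErhoCk -expectD//.
  apply: (bounded_convergence mfu _ fu_le).
    by apply: measurable_funD; apply: measurable_funM => //; exact: measurable_funB.
  by have := good; apply: filterS => w; exact: fu_cvg.
suff : E[hS] - h x - 2 * B * p <= E[fun w => rho w * (Psi w - L w)] + k * p.
  by rewrite /hS; lra.
apply: (cvgr_to_ge c); apply: nearW => n.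
have := EBB_le n; rewrite ler_norml => /andP[h1 _].
have h2 : E[fun w => ss n w + GG n w] <= E[fu n].
  by apply: expect_le; [exact: integrable_rvD|exact: fu_L1|exact: fu_ge].
by move: h1 h2; rewrite expectD// /delta; lra.
Qed.

(** The lower envelope is off by the cost [L] on the event that the level is crossed. The mean of
    this cost must be finite, which the upper inequality provides beforehand. *)
Lemma reflected_ito_lower : L1 L ->
  E[fun w => rho w * (Psi w - L w)] - E[fun w => (1 - rho w) * L w] <=
  E[fun w => h (X S w)] - h x + (k + 2 * B) * p.
Proof.
move=> LL; have c : E[fl n] + delta n @[n --> \oo] --> E[fun w => rho w * (Psi w - L w)] - k * p.
  rewrite -[X in _ --> X]addr0; apply: cvgD; last exact: delta_cvg.
  rewrite -ErhoCk -expectB//.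
  apply: (bounded_convergence mfl _ fl_le).
    by apply: measurable_funB; apply: measurable_funM => //; exact: measurable_funB.
  by have := good; apply: filterS => w; exact: fl_cvg.
have LrL : L1 (fun w => (1 - rho w) * L w) by exact: (integrable_rvMb mrhoC rhoC_le1).
suff : E[fun w => rho w * (Psi w - L w)] - k * p <=
    E[hS] - h x + 2 * B * p + E[fun w => (1 - rho w) * L w] by rewrite /hS; lra.
apply: (cvgr_to_le c); apply: nearW => n.
have := EBB_le n; rewrite ler_norml => /andP[_ h1].
have LJ : L1 (fun w => ss n w + GG n w) by exact: integrable_rvD.
have h2 : E[fl n] <= E[fun w => ss n w + GG n w + (1 - rho w) * L w].
  by apply: expect_le; [exact: fl_L1|exact: integrable_rvD|exact: fl_ge].
by move: h1 h2; rewrite expectD// expectD// /delta; lra.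
Qed.

End stopped.

Let L w := qu * U S w + qd * D S w.
Let rho (m : nat) w : R := (V S w <= m%:R)%R%:R.
Let p m := E[fun w => 1 - rho m w].
Let C0 := B * Kmu * S + B * K ^+ 2 * S + 2 * B.
Let G := E[Psi] - E[fun w => h (X S w)] + h x.

Let upper m : E[fun w => h (X S w)] - h x <=
  E[fun w => rho m w * (Psi w - L w)] + C0 * p m.
Proof. exact: reflected_ito_upper (ler0n _ m). Qed.

Let lower m : L1 L ->
  E[fun w => rho m w * (Psi w - L w)] - E[fun w => (1 - rho m w) * L w] <=
  E[fun w => h (X S w)] - h x + C0 * p m.
Proof. by apply: reflected_ito_lower; exact: ler0n. Qed.

Let L_ge0 w : 0 <= L w. Proof. by rewrite addr_ge0// mulr_ge0. Qed.

Let rhoP m w : rho m w = 0 \/ rho m w = 1 /\ V S w <= m%:R.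
Proof. by rewrite /rho; case: (leP (V S w) m%:R); [right|left]. Qed.

Let mrho m : measurable_fun setT (rho m).
Proof.
apply: (@measurableT_comp _ _ _ _ _ _ (fun y : R => (y <= m%:R)%R%:R : R)); last exact: mV.
rewrite (_ : (fun y => _) = \1_(`]-oo, m%:R])); first exact: measurable_indic.
by apply/funext => y; rewrite indicE mem_setE in_itv.
Qed.

Let rho1 m w : `|rho m w| <= 1.
Proof. by case: (rhoP m w) => [->|[-> _]]; rewrite ?normr0 ?normr1. Qed.

Let rhoC1 m w : 0 <= 1 - rho m w <= 1.
Proof. by case: (rhoP m w) => [->|[-> _]]; rewrite ?subr0 ?subrr ?lexx ?ler01. Qed.

Let mrhoC m : measurable_fun setT (fun w => 1 - rho m w).
Proof. exact: measurable_funB. Qed.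

Let rhoC_norm m w : `|1 - rho m w| <= 1.
Proof. by have /andP[h0 h1] := rhoC1 m w; rewrite ger0_norm. Qed.

Let rhoC_L1 m : L1 (fun w => 1 - rho m w).
Proof. exact: (integrable_rv_bounded P (mrhoC m) (rhoC_norm m)). Qed.

Let rho_near w : \forall m \near \oo, rho m w = 1.
Proof.
have := nbhs_infty_ger (V S w); apply: filterS => m hm.
by rewrite /rho hm.
Qed.

Let p_cvg : p m @[m --> \oo] --> 0.
Proof.
rewrite -[X in _ --> X](expect_cst P 0); apply: (bounded_convergence mrhoC _ rhoC_norm) => //.
apply: aeW => w; apply/cvgrPdist_le => /= e e0.
by have := rho_near w; apply: filterS => m ->; rewrite subrr subr0 normr0 ltW.
Qed.

Let mL : measurable_fun setT L.
Proof. by apply: measurable_funD; apply: measurable_funM => //; [exact: mU|exact: mD]. Qed.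

Let rhoL_L1 m : L1 (fun w => rho m w * L w).
Proof.
apply: (integrable_rv_bounded P _ (K := (qu + qd) * m%:R)) => [|w]; first exact: measurable_funM.
case: (rhoP m w) => [->|[-> VN]]; first by rewrite mul0r normr0 mulr_ge0// addr_ge0.
rewrite mul1r ger0_norm// /L mulrDl lerD// ler_wpM2l//.
  by apply: le_trans VN; rewrite lerDl.
by apply: le_trans VN; rewrite lerDr.
Qed.

Let Psi_L1 : L1 Psi. Proof. exact: (integrable_rv_bounded P mPsi PsiK). Qed.
Let rhoPsi_L1 m : L1 (fun w => rho m w * Psi w).
Proof. exact: (integrable_rvMb (mrho m) (rho1 m) Psi_L1). Qed.

Let ErhoPsi m : `|E[fun w => rho m w * Psi w] - E[Psi]| <= KP * p m.
Proof.
rewrite -expectB// /p -expectZ//; apply: expect_norm_le.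
- exact: integrable_rvB.
- exact: integrable_rvZ.
apply: aeW => w; have /andP[r0 _] := rhoC1 m w.
rewrite -{2}[Psi w]mul1r -mulrBl -opprB mulNr normrN normrM (ger0_norm r0) mulrC.
by rewrite ler_wpM2r.
Qed.

Let ErhoLam m : E[fun w => rho m w * (Psi w - L w)] =
  E[fun w => rho m w * Psi w] - E[fun w => rho m w * L w].
Proof. by under eq_Rintegral do rewrite mulrBr; exact: expectB. Qed.

Let ErhoL m : E[fun w => rho m w * L w] <= G + (C0 + KP) * p m.
Proof.
have := upper m; rewrite ErhoLam; have := ErhoPsi m; rewrite ler_norml /G => /andP[_]; lra.
Qed.

Lemma reflected_ito : L1 L /\ E[L] = G.
Proof.
have G_cvg (c : R) : G + c * p m @[m --> \oo] --> G.
  rewrite -[X in _ --> X]addr0 -(mulr0 c).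
  by apply: cvgD; [exact: cvg_cst|apply: cvgM; [exact: cvg_cst|exact: p_cvg]].
(* From the upper inequality alone: the truncated costs [rho m w * L w] increase to [L w], and their
   means are at most [G + (C0 + KP) * p m]. *)
have intL : (\int[P]_w (L w)%:E <= G%:E)%E.
  have mono : (\int[P]_w (rho m w * L w)%:E)%E @[m --> \oo] --> (\int[P]_w (L w)%:E)%E.
    rewrite (_ : (\int[P]_w (L w)%:E)%E = (\int[P]_w limn (fun m => (rho m w * L w)%:E))%E).
      apply: cvg_monotone_convergence => //.
      - by move=> m; apply/measurable_EFinP; exact: measurable_funM.
      - by move=> m w _; rewrite lee_fin mulr_ge0.
      - move=> w _ m1 m2 m12; rewrite lee_fin ler_wpM2r// /rho.
        case: (leP (V S w) m1%:R) => [h1|_] /=; last exact: ler0n.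
        by rewrite (le_trans h1) ?ler_nat.
    apply: eq_integral => w _; apply/esym/cvg_lim => //.
    apply: cvg_near_cst; have := rho_near w; apply: filterS => m rw1.
    by rewrite /= rw1 mul1r.
  have c2 : (G + (C0 + KP) * p m)%:E @[m --> \oo] --> G%:E by apply: cvg_EFin; [exact: nearW|exact: G_cvg].
  apply: (lee_cvg_to mono c2).
  apply: nearW => m; rewrite -(fineK (integrable_fin_num _ (rhoL_L1 m)))//.
  by rewrite lee_fin; exact: ErhoL.
have LL : L1 L.
  apply/integrableP; split; first exact/measurable_EFinP.
  under eq_integral do rewrite /= ger0_norm//.
  exact: le_lt_trans intL (ltry _).
split => //; apply/eqP; rewrite eq_le; apply/andP; split.
  by rewrite -lee_fin fineK//; exact: integrable_fin_num LL.
apply: (cvgr_to_le (G_cvg (- (C0 + KP)))); apply: nearW => m.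
(* The two partial costs in the lower inequality add up to exactly [E[L]], so only multiples of
   [p m] remain to vanish. *)
have EC : E[fun w => (1 - rho m w) * L w] = E[L] - E[fun w => rho m w * L w].
  by under eq_Rintegral do rewrite mulrBl mul1r; exact: expectB.
have := lower m LL; rewrite ErhoLam EC; have := ErhoPsi m; rewrite ler_norml /G => /andP[+ _]; lra.
Qed.

End reflected_ito.

(** * Stieltjes measures and regularity of reflected paths *)

Section stieltjes.
Context {R : realType}.
Implicit Types f : cumulative R R.

Lemma lebesgue_stieltjes_itv_oc f (s t : R) : s <= t ->
  lebesgue_stieltjes_measure f `]s, t] = (f t - f s)%:E.
Proof.
move=> st; rewrite /lebesgue_stieltjes_measure /measure_extension/=.
by rewrite measurable_mu_extE/=; [rewrite wlength_itv_bnd|exact: is_ocitv].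
Qed.

(** Monotonicity as an outer measure, for arbitrary sets: the times at which a path is off the
    barrier are not known to form a measurable set. *)
Lemma le_lebesgue_stieltjes f (A B : set R) : A `<=` B ->
  (lebesgue_stieltjes_measure f A <= lebesgue_stieltjes_measure f B)%E.
Proof. exact: (le_outer_measure (mu_ext (wlength f))). Qed.

(** The jump at [0] is counted because [f] vanishes at negative times: []-1, 0[] is null, being the
    union of the intervals []-1, - n.+1%:R^-1]], and []-1, t]] has mass [f t - f (-1)]. *)
Lemma lebesgue_stieltjes_itv0 f (t : R) : (forall s, s < 0 -> f s = 0) -> 0 <= t ->
  lebesgue_stieltjes_measure f `[0, t] = (f t)%:E.
Proof.
move=> f0 t0; pose mu : {measure set (measurableTypeR R) -> \bar R} := lebesgue_stieltjes_measure f.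
rewrite -[LHS]/(mu _).
pose A : set R := `]-1, 0[%classic; pose B : set R := `[0, t]%classic.
have neg : mu (`](-1 : R), (0 : R)[%classic : set R) = 0%E.
  apply: measure_negligible => //.
  apply: (@negligibleS _ _ _ mu (\bigcup_n `](-1 : R), - n.+1%:R^-1]%classic)).
    move=> s /=; rewrite in_itv/= => /andP[s1 s0].
    have [n sn] : exists n : nat, n.+1%:R^-1 <= - s.
      exists (Num.bound (- s)^-1); rewrite invf_ple ?posrE ?oppr_gt0//.
      apply/ltW; apply: lt_trans (_ : _ < (Num.bound (- s)^-1)%:R) _; last by rewrite ltr_nat.
      by apply: le_lt_trans (ler_norm _) _; exact: truncnS_gt.
    by exists n => //=; rewrite in_itv/= s1 lerNr.
  apply: negligible_bigcup => n; apply/negligibleP => //.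
  have n1 : (-1 : R) <= - n.+1%:R^-1 by rewrite lerN2 invf_le1// ler1n.
  by rewrite /mu/= lebesgue_stieltjes_itv_oc// !f0 ?subr0// oppr_lt0.
have mAB : mu (A `|` B) = (mu A + mu B)%E.
  apply: measureU; [exact: measurable_itv|exact: measurable_itv|]; rewrite -subset0 => s [/=]; rewrite /A /B /= !in_itv/= => /andP[_ s0] /andP[s1 _].
  by have := lt_le_trans s0 s1; rewrite ltxx.
rewrite -[LHS]add0e -[X in (X + _)%E]neg -mAB.
rewrite /A /B (_ : _ `|` _ = (`](-1 : R), t]%classic : set R)).
  rewrite /mu/= lebesgue_stieltjes_itv_oc ?(f0 (-1)) ?subr0 ?oppr_lt0//.
  by rewrite (le_trans _ t0)// oppr_le0.
apply/seteqP; split => s /=; rewrite !in_itv/=.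
  by move=> [/andP[-> /ltW/le_trans->//]|/andP[s0 ->]]; rewrite andbT (lt_le_trans _ s0)// oppr_lt0.
by move=> /andP[s1 st]; have [s0|s0] := ltP s 0; [left; rewrite s1|right].
Qed.

End stieltjes.

Section reflected_path_facts.
Context {R : realType}.
Local Notation leb := (@lebesgue_measure R).
Variables (mu X M : R -> R) (U D : cumulative R R) (a b x : R).
Hypothesis ab : a < b.
Hypothesis xab : a <= x <= b.
Hypothesis Uneg : forall t, t < 0 -> U t = 0.
Hypothesis Dneg : forall t, t < 0 -> D t = 0.
Hypothesis Xab : forall t, 0 <= t -> a <= X t <= b.
Hypothesis cU : forall t : R, 0 < t -> {for t, continuous U}.
Hypothesis cD : forall t : R, 0 < t -> {for t, continuous D}.
Hypothesis Ua : lebesgue_stieltjes_measure U [set t | 0 <= t /\ X t <> a] = 0%E.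
Hypothesis Db : lebesgue_stieltjes_measure D [set t | 0 <= t /\ X t <> b] = 0%E.
Hypothesis intmu : forall t, 0 <= t -> leb.-integrable `[0, t] (fun s => (mu (X s))%:E).
Hypothesis cM : {within `[0, +oo[, continuous M}.
Hypothesis M0 : M 0 = 0.
Hypothesis XE : forall t, 0 <= t ->
  X t = x + \int[leb]_(s in `[0, t]) mu (X s) + M t + U t - D t.

(** The interval []s, t]] lies inside the null set, and its mass is [f t - f s]. *)
Lemma stieltjes_flat (f : cumulative R R) (y s t : R) :
  lebesgue_stieltjes_measure f [set t | 0 <= t /\ X t <> y] = 0%E ->
  0 <= s -> s <= t -> (forall r, s < r <= t -> X r <> y) -> f t = f s.
Proof.
move=> f0 s0 st Xy.
have : (lebesgue_stieltjes_measure f `]s, t] <= 0)%E.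
  rewrite -f0; apply: le_lebesgue_stieltjes => r /=; rewrite in_itv/= => /andP[r1 r2].
  by split; [exact: le_trans (ltW r1)|apply: Xy; rewrite r1].
rewrite lebesgue_stieltjes_itv_oc// lee_fin subr_le0 => h.
by apply/eqP; rewrite eq_le h (cumulative_is_nondecreasing f).
Qed.

Let atom0 (f : cumulative R R) y : (forall t, t < 0 -> f t = 0) ->
  lebesgue_stieltjes_measure f [set t | 0 <= t /\ X t <> y] = 0%E -> X 0 <> y -> f 0 = 0.
Proof.
move=> fneg f0 X0.
have : (lebesgue_stieltjes_measure f `[0%R, 0%R] <= 0)%E.
  rewrite -f0; apply: le_lebesgue_stieltjes => r /=; rewrite in_itv/= => r0.
  by have -> : r = 0 by apply/eqP; rewrite eq_le andbC.
rewrite lebesgue_stieltjes_itv0// lee_fin => h.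
apply/eqP; rewrite eq_le h/= -[leLHS](fneg (-1)) ?oppr_lt0//.
by apply: (cumulative_is_nondecreasing f); rewrite oppr_le0.
Qed.

Let ge0 (f : cumulative R R) t : (forall t, t < 0 -> f t = 0) -> 0 <= f t.
Proof.
move=> fneg; have [t0|t0] := ltP t 0; first by rewrite fneg.
rewrite -(fneg (-1)) ?oppr_lt0//; apply: (cumulative_is_nondecreasing f).
by rewrite (le_trans _ t0)// oppr_le0.
Qed.

(** No initial jump: [U] can have an atom at [0] only if [X 0 = a]; then [D] has none since [a < b],
    and [a = x + U 0] with [a <= x] forces [U 0 = 0]. The argument for [D] is symmetric. *)
Lemma reflected_path_start : [/\ U 0 = 0, D 0 = 0 & X 0 = x].
Proof.
have X0 : X 0 = x + U 0 - D 0.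
  by rewrite XE// set_itv1 Rintegral_set1 M0 !addr0.
have U0 := ge0 0 Uneg; have D0 := ge0 0 Dneg; have /andP[x1 x2] := xab.
have UE : U 0 = 0.
  have [Xa|/eqP Xa] := eqVneq (X 0) a; last exact: atom0 Uneg Ua Xa.
  have : D 0 = 0 by apply: (atom0 Dneg Db) => Xb; move: ab; rewrite -Xa -Xb ltxx.
  by lra.
have DE : D 0 = 0.
  have [Xb|/eqP Xb] := eqVneq (X 0) b; last exact: atom0 Dneg Db Xb.
  by lra.
by split => //; rewrite X0 UE DE addr0 subr0.
Qed.

(** Continuity is assumed at positive times; at the left end [0] right continuity is enough. *)
Let cumulative_within (f : cumulative R R) (S : R) : 0 < S ->
  (forall t : R, 0 < t -> {for t, continuous f}) -> {within `[0, S], continuous f}.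
Proof.
move=> S0 cf; apply/continuous_within_itvP => //; split.
- by move=> t; rewrite in_itv/= => /andP[t0 _]; exact: cf.
- exact: cumulative_is_right_continuous.
- by apply: cvg_at_left_filter; exact: cf.
Qed.

Lemma reflected_path_continuous (S : R) : 0 < S -> {within `[0, S], continuous X}.
Proof.
move=> S0.
have c1 : {within `[0, S], continuous (fun t => \int[leb]_(s in `[0, t]) mu (X s))}.
  by apply: parameterized_integral_continuous; [exact: ltW|apply: intmu; exact: ltW].
have c2 : {within `[0, S], continuous M}.
  by apply: continuous_subspaceW cM => t /=; rewrite !in_itv/= => /andP[->].
have c3 := cumulative_within S0 cU; have c4 := cumulative_within S0 cD.
have c : {within `[0, S], continuous (fun t => x + \int[leb]_(s in `[0, t]) mu (X s) + M t + U t - D t)}.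
  move=> t; apply: cvgB; last exact: c4.
  apply: cvgD; last exact: c3.
  apply: cvgD; last exact: c2.
  by apply: cvgD; [exact: cvg_cst|exact: c1].
apply: subspace_eq_continuous c => t; rewrite inE/= in_itv/= => /andP[t0 _].
exact/esym/XE.
Qed.

End reflected_path_facts.

(** * Scale and speed densities, first order conditions *)

Section oriented_integral_derivative.
Context {R : realType}.
Implicit Types f g : R -> R.

Lemma integrable_itv_cts f (s t : R) : continuous f ->
  (@lebesgue_measure R).-integrable `[s, t] (EFin \o f).
Proof. by move=> cf; apply: integrable_itv_continuous; exact: continuous_subspaceT. Qed.

Lemma oriented_integralE f (L x y : R) : continuous f -> L <= x -> L <= y ->
  oriented_integral f x y = \int[lebesgue_measure]_(t in `[L, y]) f t
    - \int[lebesgue_measure]_(t in `[L, x]) f t.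
Proof.
move=> cf Lx Ly; rewrite /oriented_integral; case: (leP x y) => xy.
  by rewrite (Rintegral_itv_split Lx xy)//; exact: continuous_subspaceT.
by rewrite -(Rintegral_itv_split Ly (ltW xy)) ?opprB//; exact: continuous_subspaceT.
Qed.

Lemma is_derive_oriented_integral f (x0 x : R) : continuous f ->
  is_derive x 1 (oriented_integral f x0) (f x).
Proof.
(* A base point strictly below [x0] and [x]: near [x] the oriented integral is an ordinary integral
   from [L] up to a constant, however [x0] and [x] are ordered. *)
move=> cf; pose L := Num.min x0 x - 1.
have lt1 (y : R) : y < y + 1 by rewrite ltrDl.
have x1 := lt1 x.
have Lx0 : L < x0 by rewrite ltrBlDr (le_lt_trans _ (lt1 x0))// ge_min lexx.
have Lx : L < x by rewrite ltrBlDr (le_lt_trans _ x1)// ge_min lexx orbT.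
have [d1 d2] := continuous_FTC1_closed x1 (integrable_itv_cts L (x + 1) cf) Lx (cf x).
have d3 : is_derive x 1 (fun y => \int[lebesgue_measure]_(t in `[L, y]) f t
    - \int[lebesgue_measure]_(t in `[L, x0]) f t) (f x).
  rewrite -[X in is_derive _ _ _ X]subr0; apply: is_deriveB.
  by move: d2; rewrite derive1E => d2; exact: (DeriveDef d1 d2).
apply: (near_eq_is_derive _ d3).
have := lt_nbhsr Lx; apply: filterS => y /ltW Ly.
by rewrite (oriented_integralE cf (ltW Lx0)).
Qed.

Lemma is_derive1_expR f (x df : R) : is_derive x 1 f df ->
  is_derive x 1 (fun y => expR (f y)) (expR (f x) * df).
Proof. by move=> hf; apply: (is_derive_eq (is_derive1_comp (is_derive_expR (f x)) hf)). Qed.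

Lemma is_derive1_le f (df : R -> R) (y z e : R) : 
  (forall u : R, is_derive u 1 f (df u)) ->
  (forall u, `|u - y| <= `|z - y| -> Num.min y z <= u <= Num.max y z -> `|df u| <= e) ->
  `|f z - f y| <= e * `|z - y|.
Proof.
move=> hf hdf.
have cf (s t : R) : {within `[s, t], continuous f}.
  by apply: continuous_subspaceT => u; exact: is_derive1_continuous (hf u).
have [yz|/ltW zy] := leP y z.
  have [c + ->] := MVT_segment yz (fun u _ => hf u) (cf y z).
  rewrite in_itv/= => /andP[yc cz]; rewrite normrM ler_wpM2r// hdf//.
    by rewrite !ger0_norm ?subr_ge0// lerB.
  by rewrite min_l// max_r// yc.
have [c + h] := MVT_segment zy (fun u _ => hf u) (cf z y).
rewrite in_itv/= => /andP[zc cy]; rewrite distrC h normrM (distrC z) ler_wpM2r// hdf//.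
  by rewrite distrC (distrC z) !ger0_norm ?subr_ge0// lerB.
by rewrite min_r// max_l// zc.
Qed.

(** Only continuity of [hpp] is available. Its oscillation is at most [e] between points closer than
    [d]; at distance [d] or more it is at most [2 * B], hence at most [C * (z - y) ^+ 2] with
    [C = 2 * B / d ^+ 2]. Applying the mean value theorem twice gives the quadratic and the quartic
    term. *)
Lemma taylor2_bound (h hp hpp : R -> R) (a b e : R) :
  (forall u : R, is_derive u 1 h (hp u)) -> (forall u : R, is_derive u 1 hp (hpp u)) ->
  continuous hpp -> 0 < e ->
  exists2 C, 0 <= C & forall y z, a <= y <= b -> a <= z <= b ->
  `|h z - h y - hp y * (z - y) - hpp y / 2 * (z - y) ^+ 2| <=
  e * (z - y) ^+ 2 + C * (z - y) ^+ 4.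
Proof.
move=> hh hhp chpp e0.
have [d d0 Hd] := itv_unif_continuous (continuous_subspaceT chpp) e0 (a := a) (b := b).
have [B B0 HB] := itv_continuous_bounded (a := a) (b := b) (continuous_subspaceT chpp).
have d2 : 0 < d ^+ 2 by rewrite exprn_gt0.
pose C := 2 * B / d ^+ 2.
have C0 : 0 <= C by apply: divr_ge0; [exact: mulr_ge0|exact: ltW].
exists C => // y z yab zab.
pose r := e + C * (z - y) ^+ 2.
have near_hpp u : `|u - y| <= `|z - y| -> Num.min y z <= u <= Num.max y z ->
    `|hpp u - hpp y| <= r.
  move=> uy /andP[u1 u2].
  have uab : a <= u <= b.
    case/andP: yab => ya yb; case/andP: zab => za zb; apply/andP; split.
      by apply: le_trans u1; rewrite le_min ya.
    by apply: le_trans u2 _; rewrite ge_max yb.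
  have [ud|du] := ltP `|u - y| d.
    by rewrite (le_trans (ltW (Hd _ _ uab yab ud)))// lerDl mulr_ge0// sqr_ge0.
  apply: (@le_trans _ _ (2 * B)).
    by apply: le_trans (ler_normB _ _) _; rewrite mulrDl mul1r lerD ?HB.
  apply: (@le_trans _ _ (C * (z - y) ^+ 2)); last by rewrite lerDr ltW.
  rewrite /C mulrAC ler_pdivlMr// ler_wpM2l ?mulr_ge0//.
  by rewrite -(real_normK (num_real (z - y))) lerXn2r ?nnegrE ?(ltW d0)// (le_trans du).
have step1 u : `|u - y| <= `|z - y| -> Num.min y z <= u <= Num.max y z ->
    `|hp u - hp y - hpp y * (u - y)| <= r * `|z - y|.
  move=> uy u12.
  pose f v := hp v - hpp y * (v - y).
  have df (v : R) : is_derive v 1 f (hpp v - hpp y).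
    apply: is_deriveB; rewrite -[X in is_derive _ _ _ X]mulr1; apply: is_derive1Z.
    by rewrite -[X in is_derive _ _ _ X]subr0; apply: is_deriveB.
  have r0 : 0 <= r by rewrite addr_ge0 ?(ltW e0)// mulr_ge0// sqr_ge0.
  apply: (@le_trans _ _ (r * `|u - y|)); last by rewrite ler_wpM2l.
  have -> : hp u - hp y - hpp y * (u - y) = f u - f y by rewrite /f; ring.
  apply: (is_derive1_le df) => v vu /andP[v1 v2]; apply: near_hpp.
    exact: le_trans vu uy.
  case/andP: u12 => u1 u2; apply/andP; split.
    by apply: le_trans v1; rewrite le_min ge_min lexx u1.
  by apply: le_trans v2 _; rewrite ge_max le_max lexx u2.
pose f v := h v - hp y * (v - y) - hpp y / 2 * (v - y) ^+ 2.
have df (v : R) : is_derive v 1 f (hp v - hp y - hpp y * (v - y)).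
  have d1 : is_derive v 1 (fun v => v - y) 1.
    by rewrite -[X in is_derive _ _ _ X]subr0; apply: is_deriveB.
  have e1 := is_deriveB (is_deriveB (hh v) (is_derive1Z (hp y) d1))
    (is_derive1Z (hpp y / 2) (is_derive1M d1 d1)).
  by apply: (is_derive_eq e1); field.
have -> : h z - h y - hp y * (z - y) - hpp y / 2 * (z - y) ^+ 2 = f z - f y.
  by rewrite /f; ring.
apply: le_trans (is_derive1_le df step1) _.
rewrite -mulrA -expr2 real_normK ?num_real// /r mulrDl -mulrA -exprD.
exact: lexx.
Qed.

End oriented_integral_derivative.

(** * Optimality conditions and the Poisson equation *)

Section long_run_cost_calculus.
Context {R : realType}.
Variables (mu sigma c : R -> R) (qu qd x0 : R).
Hypothesis mu_cont : continuous mu.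
Hypothesis sigma_cont : continuous sigma.
Hypothesis sigma2_gt0 : forall x, 0 < sigma x ^+ 2.
Hypothesis c_cont : continuous c.
Local Notation leb := (@lebesgue_measure R).
Local Notation s := (scale_density mu sigma x0).
Local Notation m' := (speed_density mu sigma x0).
Local Notation m := (speed_measure mu sigma x0).
Local Notation C := (long_run_cost mu sigma c qu qd x0).
Let f (y : R) := 2 * mu y / sigma y ^+ 2.

Let sigma2_cont : continuous (fun y => sigma y ^+ 2).
Proof. by move=> y; apply: cvgM; exact: sigma_cont. Qed.

Let f_cont : continuous f.
Proof.
move=> y; apply: cvgM; first by apply: cvgM; [exact: cvg_cst|exact: mu_cont].
by apply: cvgV; [rewrite gt_eqF|exact: sigma2_cont].
Qed.

Lemma scale_density_gt0 y : 0 < s y. Proof. exact: expR_gt0. Qed.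

Lemma is_derive_scale_density (y : R) : is_derive y 1 s (s y * - f y).
Proof. by apply: is_derive1_expR; apply: is_deriveN; exact: is_derive_oriented_integral. Qed.

Lemma is_derive_scale_densityV (y : R) : is_derive y 1 (fun y => (s y)^-1) (mu y * m' y).
Proof.
rewrite (_ : (fun y => _) = fun y => expR (oriented_integral f x0 y)); last first.
  by apply/funext => z; rewrite /scale_density -expRN opprK.
apply: (is_derive_eq (is_derive1_expR (is_derive_oriented_integral x0 y f_cont))).
rewrite /speed_density (invfM (sigma y ^+ 2) (s y)).
have -> : (s y)^-1 = expR (oriented_integral f x0 y) by rewrite /scale_density -expRN opprK.
by rewrite {2}/f; ring.
Qed.

Let s_cont : continuous s.
Proof. move=> y; exact: is_derive1_continuous (is_derive_scale_density y). Qed.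

Let den_gt0 y : 0 < sigma y ^+ 2 * s y.
Proof. by rewrite mulr_gt0// scale_density_gt0. Qed.

Lemma speed_density_continuous : continuous m'.
Proof.
move=> y; apply: cvgM; first exact: cvg_cst.
apply: cvgV; first by rewrite gt_eqF.
by apply: cvgM; [exact: sigma2_cont|exact: s_cont].
Qed.

Let m'_cont := speed_density_continuous.

Lemma speed_density_gt0 y : 0 < m' y. Proof. by rewrite divr_gt0. Qed.

Let cm'_cont : continuous (fun y => c y * m' y).
Proof. by move=> y; apply: cvgM; [exact: c_cont|exact: m'_cont]. Qed.

Let mum'_cont : continuous (fun y => mu y * m' y).
Proof. by move=> y; apply: cvgM; [exact: mu_cont|exact: m'_cont]. Qed.

Lemma oriented_integral_le (g : R -> R) a b : a <= b ->
  oriented_integral g a b = \int[leb]_(t in `[a, b]) g t.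
Proof. by rewrite /oriented_integral => ->. Qed.

Lemma oriented_integral_ge (g : R -> R) a b : b <= a ->
  oriented_integral g a b = - \int[leb]_(t in `[b, a]) g t.
Proof.
rewrite /oriented_integral le_eqVlt => /predU1P[->|ba]; last by rewrite leNgt ba.
by rewrite lexx set_itv1 Rintegral_set1 oppr0.
Qed.

Lemma oriented_integralxx (g : R -> R) a : oriented_integral g a a = 0.
Proof. by rewrite oriented_integral_le// set_itv1 Rintegral_set1. Qed.

Lemma speed_measure_gt0 a b : a < b -> 0 < m a b.
Proof.
move=> ab.
have cI : {within `[a, b], continuous (oriented_integral m' a)}.
  apply: continuous_subspaceT => y.
  exact: is_derive1_continuous (is_derive_oriented_integral a y m'_cont).
have [z _] := MVT ab (fun y _ => is_derive_oriented_integral a y m'_cont) cI.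
rewrite oriented_integralxx subr0 (oriented_integral_le _ (ltW ab)) /speed_measure => ->.
by rewrite mulr_gt0 ?speed_density_gt0// subr_gt0.
Qed.

Lemma long_run_costE a b : a < b -> C a b * m a b =
  \int[leb]_(t in `[a, b]) (c t * m' t) + qu / s a + qd / s b.
Proof.
by move=> ab; rewrite /long_run_cost mulrAC mulVf ?mul1r// gt_eqF// speed_measure_gt0.
Qed.

Lemma drift_speed_integral a b : a <= b ->
  \int[leb]_(t in `[a, b]) (mu t * m' t) = (s b)^-1 - (s a)^-1.
Proof.
move=> ab; apply: (Rintegral_is_derive (F := fun y => (s y)^-1) ab).
  by move=> y _; exact: is_derive_scale_densityV.
exact: continuous_subspaceT.
Qed.

Let Rintegral_pi (k1 k2 : R) a b : a <= b ->
  \int[leb]_(t in `[a, b]) ((c t + k1 * mu t - k2) * m' t) =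
  \int[leb]_(t in `[a, b]) (c t * m' t) + k1 * ((s b)^-1 - (s a)^-1) - k2 * m a b.
Proof.
move=> ab; rewrite -(drift_speed_integral ab) /speed_measure.
under eq_Rintegral do rewrite mulrBl mulrDl -mulrA.
have c1 : {within `[a, b], continuous (fun t => c t * m' t)} by exact: continuous_subspaceT.
have c2 : {within `[a, b], continuous (fun t => mu t * m' t)} by exact: continuous_subspaceT.
have c2' : {within `[a, b], continuous (fun t => k1 * (mu t * m' t))}.
  by apply: continuous_subspaceT => y; apply: cvgM; [exact: cvg_cst|exact: mum'_cont].
have c3 : {within `[a, b], continuous m'} by exact: continuous_subspaceT.
have c3' : {within `[a, b], continuous (fun t => k2 * m' t)}.
  by apply: continuous_subspaceT => y; apply: cvgM; [exact: cvg_cst|exact: m'_cont].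
have c12 : {within `[a, b], continuous (fun t => c t * m' t + k1 * (mu t * m' t))}.
  by move=> y; apply: cvgD; [exact: c1|exact: c2'].
by rewrite RintegralB_itv// RintegralD_itv// (@RintegralZ_itv R _ k1 a b c2) (@RintegralZ_itv R _ k2 a b c3).
Qed.

(** The integral of [mu * m'] turns [qd / s a] into [qd / s b], which reconstitutes the numerator of
    [C a b]. The integrated condition is thus the pointwise one multiplied by the positive number
    [m a b]. *)
Lemma integral_pi1 a b : a < b ->
  \int[leb]_(t in `[a, b]) ((pi1 mu c qd t - pi1 mu c qd b) * m' t) + (qd + qu) / s a =
  m a b * (C a b - pi1 mu c qd b).
Proof.
move=> ab; rewrite (Rintegral_pi qd (pi1 mu c qd b) (ltW ab)).
have key (u v w p sa sb : R) : u * v = w + qu * sa + qd * sb ->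
    w + qd * (sb - sa) - p * v + (qd + qu) * sa = v * (u - p).
  by move=> h; rewrite [RHS]mulrBr (mulrC v u) h; ring.
exact: key (long_run_costE ab).
Qed.

Lemma integral_pi2 a b : a < b ->
  \int[leb]_(t in `[a, b]) ((pi2 mu c qu t - pi2 mu c qu a) * m' t) + (qd + qu) / s b =
  m a b * (C a b - pi2 mu c qu a).
Proof.
move=> ab; under eq_Rintegral do rewrite {1}/pi2 -mulNr.
rewrite (Rintegral_pi (- qu) (pi2 mu c qu a) (ltW ab)).
have key (u v w p sa sb : R) : u * v = w + qu * sa + qd * sb ->
    w + - qu * (sb - sa) - p * v + (qd + qu) * sb = v * (u - p).
  by move=> h; rewrite [RHS]mulrBr (mulrC v u) h; ring.
exact: key (long_run_costE ab).
Qed.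

Lemma first_order_conditions_equiv a b : a < b ->
  (C a b = pi2 mu c qu a /\ C a b = pi1 mu c qd b) <->
  (\int[leb]_(t in `[a, b]) ((pi1 mu c qd t - pi1 mu c qd b) * m' t) + (qd + qu) / s a = 0 /\
   \int[leb]_(t in `[a, b]) ((pi2 mu c qu t - pi2 mu c qu a) * m' t) + (qd + qu) / s b = 0).
Proof.
move=> ab; rewrite integral_pi1// integral_pi2//.
have m0 := speed_measure_gt0 ab.
split=> [[h1 h2]|[/eqP + /eqP]].
  by rewrite -h1 -h2 !subrr !mulr0.
by rewrite !mulf_eq0 !(gt_eqF m0)/= !subr_eq0 => /eqP h1 /eqP h2.
Qed.

(** With [C a b] minimal, the numerator minus [C a b] times the speed measure is nonnegative for
    every pair and zero at [(a, b)]; moving one end point at a time minimizes a difference instead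
    of a quotient. *)
Lemma first_order_conditions a b : a < b ->
  (forall a' b', a' < b' -> C a b <= C a' b') ->
  C a b = pi2 mu c qu a /\ C a b = pi1 mu c qd b.
Proof.
move=> ab Cmin; have m'0 y : m' y != 0 by rewrite gt_eqF// speed_density_gt0.
have ge0 a' b' : a' < b' ->
    0 <= \int[leb]_(t in `[a', b']) (c t * m' t) + qu / s a' + qd / s b' - C a b * m a' b'.
  move=> ab'; rewrite subr_ge0; apply: (@le_trans _ _ (C a' b' * m a' b')).
    apply: ler_wpM2r; [exact: ltW (speed_measure_gt0 ab')|exact: Cmin].
  by rewrite long_run_costE.
have eq0 : \int[leb]_(t in `[a, b]) (c t * m' t) + qu / s a + qd / s b - C a b * m a b = 0.
  by apply/eqP; rewrite subr_eq0; apply/eqP/esym; exact: long_run_costE.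
split.
(* Oriented integrals based at [b] make [G] differentiable on the whole line; the comparison takes
   place on []a - 1, b[], which contains [a] in its interior. *)
- pose G y := - oriented_integral (fun t => c t * m' t) b y + qu * (s y)^-1 + qd / s b
    - C a b * - oriented_integral m' b y.
  have dG (y : R) : is_derive y 1 G (- (c y * m' y) + qu * (mu y * m' y) + 0
      - C a b * - m' y).
    apply: is_deriveB; last first.
      by apply: is_derive1Z; apply: is_deriveN; exact: is_derive_oriented_integral.
    apply: is_deriveD; apply: is_deriveD.
      by apply: is_deriveN; exact: is_derive_oriented_integral.
    by apply: is_derive1Z; exact: is_derive_scale_densityV.
  have GE y : y <= b -> G y = \int[leb]_(t in `[y, b]) (c t * m' t) + qu / s y + qd / s b
      - C a b * m y b.
    by move=> yb; rewrite /G !(oriented_integral_ge _ yb) !opprK.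
  clearbody G; have ab1 : a - 1 <= b by rewrite lerBlDr (le_trans (ltW ab))// lerDl.
  have a_in : a \in `]a - 1, b[%R by rewrite in_itv/= ab andbT ltrBlDr ltrDl.
  have Gmin (t : R) : t \in `]a - 1, b[%R -> G a <= G t.
    rewrite in_itv/= => /andP[_ tb]; rewrite (GE a (ltW ab)) eq0 (GE t (ltW tb)).
    exact: ge0.
  have := derive1_at_min ab1 (fun y _ => is_derive1_derivable (dG y)) a_in Gmin.
  move=> /is_derive1_derive1; rewrite (is_derive1_derive1 (dG a)).
  have key (u1 u2 u3 u4 : R) : - (u1 * u2) + qu * (u3 * u2) + 0 - u4 * - u2 =
    u2 * (u4 - (u1 - qu * u3)) by ring.
  rewrite key => /eqP; rewrite mulf_eq0 (negbTE (m'0 a)) => h.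
  by apply/eqP; rewrite -subr_eq0.
- pose G y := oriented_integral (fun t => c t * m' t) a y + qu / s a + qd * (s y)^-1
    - C a b * oriented_integral m' a y.
  have dG (y : R) : is_derive y 1 G (c y * m' y + 0 + qd * (mu y * m' y) - C a b * m' y).
    apply: is_deriveB; last first.
      by apply: is_derive1Z; exact: is_derive_oriented_integral.
    apply: is_deriveD; last by apply: is_derive1Z; exact: is_derive_scale_densityV.
    by apply: is_deriveD; exact: is_derive_oriented_integral.
  have GE y : a <= y -> G y = \int[leb]_(t in `[a, y]) (c t * m' t) + qu / s a + qd / s y
      - C a b * m a y.
    by move=> ay; rewrite /G !(oriented_integral_le _ ay).
  clearbody G; have ab1 : a <= b + 1 by rewrite (le_trans (ltW ab))// lerDl.
  have b_in : b \in `]a, b + 1[%R by rewrite in_itv/= ab ltrDl ltr01.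
  have Gmin (t : R) : t \in `]a, b + 1[%R -> G b <= G t.
    rewrite in_itv/= => /andP[ta _]; rewrite (GE b (ltW ab)) eq0 (GE t (ltW ta)).
    exact: ge0.
  have := derive1_at_min ab1 (fun y _ => is_derive1_derivable (dG y)) b_in Gmin.
  move=> /is_derive1_derive1; rewrite (is_derive1_derive1 (dG b)).
  have key (u1 u2 u3 u4 : R) : u1 * u2 + 0 + qd * (u3 * u2) - u4 * u2 =
    u2 * (u1 + qd * u3 - u4) by ring.
  rewrite key => /eqP; rewrite mulf_eq0 (negbTE (m'0 b)) => h.
  by apply/esym/eqP; rewrite -subr_eq0.
Qed.

(** In scale and speed form the equation reads [(h' / s)' = (C a b - c) * m'], so [I = h' / s] is a
    plain integral. It starts at [- (qu / s a)], and the definition of [C a b] makes it arrive at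
    [qd / s b]. *)
Lemma poisson_equation a b : a < b -> exists h hp hpp : R -> R,
  [/\ forall u : R, is_derive u 1 h (hp u), forall u : R, is_derive u 1 hp (hpp u),
      continuous hpp, hp a = - qu /\ hp b = qd &
      forall y, hp y * mu y + hpp y / 2 * sigma y ^+ 2 = C a b - c y].
Proof.
move=> ab; pose g y := (C a b - c y) * m' y.
have g_cont : continuous g.
  move=> y; apply: cvgM; last exact: m'_cont.
  by apply: cvgB; [exact: cvg_cst|exact: c_cont].
pose I y := - (qu / s a) + oriented_integral g a y.
have dI (y : R) : is_derive y 1 I (g y).
  rewrite -[X in is_derive _ _ _ X]add0r; apply: is_deriveD.
  exact: is_derive_oriented_integral.
pose hp y := s y * I y.
pose hpp y := s y * - f y * I y + s y * g y.
have dhp (y : R) : is_derive y 1 hp (hpp y).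
  exact: (is_derive1M (is_derive_scale_density y) (dI y)).
have I_cont : continuous I by move=> y; exact: is_derive1_continuous (dI y).
have hp_cont : continuous hp by move=> y; exact: is_derive1_continuous (dhp y).
have s_neq0 y : s y != 0 by rewrite gt_eqF// scale_density_gt0.
exists (oriented_integral hp a), hp, hpp; split => //.
- by move=> y; exact: is_derive_oriented_integral.
- move=> y; apply: cvgD; apply: cvgM; [|exact: I_cont|exact: s_cont|exact: g_cont].
  by apply: cvgM; [exact: s_cont|apply: cvgN; exact: f_cont].
- split.
    by rewrite /hp /I oriented_integralxx addr0 mulrN mulrCA mulfV// mulr1.
  have c1 : {within `[a, b], continuous (fun t => c t * m' t)} by exact: continuous_subspaceT.
  have c3 : {within `[a, b], continuous m'} by exact: continuous_subspaceT.
  have c3' : {within `[a, b], continuous (fun t => C a b * m' t)}.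
    by apply: continuous_subspaceT => y; apply: cvgM; [exact: cvg_cst|exact: m'_cont].
  rewrite /hp /I (oriented_integral_le _ (ltW ab)) /g.
  under eq_Rintegral do rewrite mulrBl.
  rewrite RintegralB_itv// (@RintegralZ_itv R _ (C a b) a b c3) -/(m a b) long_run_costE//.
  move: (\int[leb]_(_ in _) _) => w.
  have -> : - (qu / s a) + (w + qu / s a + qd / s b - w) = qd / s b.
    by move: (qu / s a) (qd / s b) => u1 u2; ring.
  by rewrite mulrCA mulfV// mulr1.
- move=> y; rewrite /hpp /g /speed_density /hp /f.
  have := s_neq0 y; have : sigma y != 0 by have := sigma2_gt0 y; apply: contraTneq => ->; rewrite expr0n ltxx.
  move: (s y) (I y) (sigma y) (C a b) => u v w z w0 u0.
  by field; rewrite w0 u0.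
Qed.

End long_run_cost_calculus.

Lemma truncate_to_id (R : realType) (s t x : R) : s <= x <= t -> truncate_to s t x = x.
Proof. by case/andP=> sx xt; rewrite /truncate_to min_r// max_r. Qed.

Lemma measurable_truncate_to (R : realType) (s t : R) : measurable_fun setT (truncate_to s t).
Proof. by apply: measurable_maxr => //; exact: measurable_minr. Qed.

(** * The long-run average cost *)

Section average_cost.
Context {R : realType} {d : measure_display} {Omega : measurableType d}.
Local Notation leb := (@lebesgue_measure R).
Variables (mu sigma c : R -> R) (qu qd x0 : R).
Hypothesis mu_cont : continuous mu.
Hypothesis sigma_cont : continuous sigma.
Hypothesis sigma2_gt0 : forall x, 0 < sigma x ^+ 2.
Hypothesis c_cont : continuous c.
Hypothesis c_ge0 : forall x, 0 <= c x.
Hypothesis qu_ge0 : 0 <= qu.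
Hypothesis qd_ge0 : 0 <= qd.
Variables (P : probability Omega R) (F : R -> set (set Omega)) (W X : R -> Omega -> R)
  (U D : Omega -> cumulative R R) (a b x : R).
Hypothesis ab : a < b.
Hypothesis xab : a <= x <= b.
Hypothesis FP : complete_filtration P F.
Hypothesis WP : brownian_motion P F W.
Hypothesis CD : controlled_diffusion P F W mu sigma x X U D.
Hypothesis RB : reflecting_barrier P a b X U D.
Local Notation L1 f := (P.-integrable setT (EFin \o f)).
Local Notation "'E[' f ]" := (Rintegral P setT f).

Let C := long_run_cost mu sigma c qu qd x0 a b.
(** [X] stays in [[a, b]] almost surely, [Xc] for every [w] and [t]; it remains adapted and has
    almost surely the same values at nonnegative times. *)
Let Xc t w := truncate_to a b (X t w).
Let Xc_ab t w : a <= Xc t w <= b.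
Proof. by rewrite truncate_to_ge truncate_to_le_r// ltW. Qed.

Let stieltjes_ge0 (f : cumulative R R) (t : R) : (forall s, s < 0 -> f s = 0) -> 0 <= f t.
Proof.
move=> fneg; have [t0|t0] := ltP t 0; first by rewrite fneg.
by rewrite -lee_fin -lebesgue_stieltjes_itv0.
Qed.

(** [B] is chosen before the horizon: the remainder is the difference between [h x] and the mean of
    [h] at time [S], and [h] is bounded on [[a, b]]. *)
Lemma expected_cost_reflected : exists2 B : R, 0 <= B & forall S, 0 < S ->
  exists2 r : R, `|r| <= B & expected_cost P c qu qd X U D S = (C * S + r)%:E.
Proof.
have [aX rcX [[Uneg aU] [Dneg aD]] intmu [M HM XE]] := CD.
have [h [hp [hpp [dh dhp chpp [hpa hpb] pe]]]] :=
  poisson_equation qu qd x0 mu_cont sigma_cont sigma2_gt0 c_cont ab.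
have ch : continuous h by move=> y; exact: is_derive1_continuous (dh y).
have chp : continuous hp by move=> y; exact: is_derive1_continuous (dhp y).
have chpp2 : continuous (fun y => hpp y / 2).
  by move=> y; apply: cvgM; [exact: chpp|exact: cvg_cst].
have csig2 : continuous (fun y => sigma y ^+ 2).
  by move=> y; apply: cvgM; exact: sigma_cont.
have bounded (f : R -> R) (cf : continuous f) :=
  itv_continuous_bounded (a := a) (b := b) (continuous_subspaceT cf).
have [Bh Bh0 hBh] := bounded _ ch; have [Bp Bp0 hBp] := bounded _ chp.
have [Bpp Bpp0 hBpp] := bounded _ chpp2; have [Kmu _ muK] := bounded _ mu_cont.
have [K K0 sigK] := bounded _ sigma_cont; have [Kc Kc0 cK] := bounded _ c_cont.
pose B := Bh + Bp + Bpp.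
have hB y : a <= y <= b -> `|h y| <= B by move=> /hBh; rewrite /B; lra.
have hpB y : a <= y <= b -> `|hp y| <= B by move=> /hBp; rewrite /B; lra.
have hppB y : a <= y <= b -> `|hpp y / 2| <= B by move=> /hBpp; rewrite /B; lra.
have B0 : 0 <= B by rewrite /B; lra.
have mXt r : 0 <= r -> measurable_fun setT (X r) by exact: (adapted_measurable FP aX).
have mX t := @right_continuous_jointly_measurable R d Omega X t mXt rcX.
have mH t : 0 <= t -> measurable_fun (`[0, t] `*` setT : set (R * Omega))
    (fun p : R * Omega => sigma (X p.1 p.2)).
  move=> _; apply: (@measurableT_comp _ _ _ _ _ _ sigma); last exact: mX.
  exact: continuous_measurable_fun.
have mcX t : measurable_fun (`[0, t] `*` setT : set (R * Omega))
    (fun p : R * Omega => c (X p.1 p.2)).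
  apply: (@measurableT_comp _ _ _ _ _ _ c); last exact: mX.
  exact: continuous_measurable_fun.
have mcXc t : measurable_fun (`[0, t] `*` setT : set (R * Omega))
    (fun p : R * Omega => c (Xc p.1 p.2)).
  apply: (@measurableT_comp _ _ _ _ _ _ (fun y : R => c (truncate_to a b y))); last exact: mX.
  apply: (@measurableT_comp _ _ _ _ _ _ c); last exact: measurable_truncate_to.
  exact: continuous_measurable_fun.
have M0 := ito_integral0 FP HM.
have cM : ae_continuous P M by case: HM.
have aeI (A1 A2 : set Omega) : (almost_everywhere P) A1 -> (almost_everywhere P) A2 ->
    (almost_everywhere P) (A1 `&` A2) by exact: filterI.
have good0 := aeI _ _ RB (aeI _ _ XE (aeI _ _ intmu (aeI _ _ cM M0))).
have HK : {ae P, forall w, forall r, 0 <= r -> `|sigma (X r w)| <= K}.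
  by have := RB; apply: filterS => w [Xab _ _ _ _] r r0; apply: sigK; exact: Xab.
have aXc : adapted F Xc.
  move=> t t0; apply: measurable_wrt_comp; [exact: measurable_truncate_to|exact: aX].
exists (2 * B); first by rewrite mulr_ge0.
move=> S S0.
pose Ic w := \int[leb]_(r in `[0, S]) c (Xc r w).
(* By the Poisson equation, this is the time integral of [hp * mu + hpp / 2 * sigma ^+ 2] along
   almost every path. *)
pose Psi w := C * S - Ic w.
have mIc : measurable_fun setT Ic.
  by apply: (measurable_Rintegral_param (f := fun r w => c (Xc r w)) (mcXc S)).
have msec w : measurable_fun `[0, S] (fun r => c (Xc r w)).
  exact: (measurable_fun_section (f := fun r w => c (Xc r w)) w (mcXc S)).
have IcK w : `|Ic w| <= Kc * S.
  rewrite -[X in Kc * X]subr0; apply: Rintegral_itv_bound; first exact: ltW.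
    exact: msec.
  by move=> r _; exact: cK.
have mPsi : measurable_fun setT Psi by exact: measurable_funB.
have PsiK w : `|Psi w| <= `|C * S| + Kc * S.
  by apply: le_trans (ler_normB _ _) _; rewrite lerD2l.
have good : {ae P, forall w, reflected_path (fun s w => sigma (X s w)) M K Xc
    (fun t w => U w t) (fun t w => D w t) a b S x mu (fun y => sigma y ^+ 2) hp hpp Psi w}.
  move: good0; apply: filterS => w [[Xab cU cD Ua Db] [XEw [iw [cMw M0w]]]].
  have XcE t : 0 <= t -> Xc t w = X t w by move=> t0; rewrite /Xc truncate_to_id// Xab.
  have [U00 D00 X00] := reflected_path_start ab xab (Uneg w) (Dneg w) Ua Db M0w XEw.
  have cX : {within `[0, S], continuous (X ^~ w)}.
    exact: (reflected_path_continuous cU cD iw cMw XEw S0).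
  have cXc : {within `[0, S], continuous (Xc ^~ w)}.
    apply: subspace_eq_continuous cX => t; rewrite inE/= in_itv/= => /andP[t0 _].
    exact/esym/XcE.
  split => //.
  - by split => //; rewrite XcE.
  - move=> s t s0 st hX; apply: (stieltjes_flat Ua s0 st) => r /[dup] /andP[sr _] rst.
    by rewrite -XcE ?(le_trans s0 (ltW sr))//; exact: hX.
  - move=> s t s0 st hX; apply: (stieltjes_flat Db s0 st) => r /[dup] /andP[sr _] rst.
    by rewrite -XcE ?(le_trans s0 (ltW sr))//; exact: hX.
  - split.
    + move=> t t0; rewrite XcE// XEw//; congr (x + _ + _ + _ - _).
      by apply: eq_Rintegral => r; rewrite inE/= in_itv/= => /andP[r0 _]; rewrite XcE.
    + by move=> r r0; rewrite clamp_id ?XcE// sigK// Xab.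
    + under eq_Rintegral do rewrite pe.
      have c1 := @within_itv_comp R c (fun r => Xc r w) 0 S c_cont cXc.
      have c2 : {within `[0, S], continuous (fun=> C)}.
        by apply: continuous_subspaceT => y; exact: cvg_cst.
      rewrite RintegralB_itv// Rintegral_cst//= lebesgue_measure_itv/= lte_fin S0.
      by rewrite -EFinB/= subr0.
have aU' : adapted F (fun t w => U w t) by [].
have aD' : adapted F (fun t w => D w t) by [].
have [LL EL] := reflected_ito FP WP HM mH K0 HK S0 aXc aU' aD' Xc_ab
  (fun w s t st => cumulative_is_nondecreasing (U w) s t st)
  (fun w s t st => cumulative_is_nondecreasing (D w) s t st)
  (fun w t => stieltjes_ge0 t (Uneg w)) (fun w t => stieltjes_ge0 t (Dneg w))
  good mu_cont csig2 ch chp chpp hpa hpb qu_ge0 qd_ge0 muK hB hpB hppB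
  (fun e e0 => taylor2_bound a b dh dhp chpp e0) mPsi PsiK.
pose L w := qu * U w S + qd * D w S.
have IcL1 : L1 Ic by exact: (integrable_rv_bounded P mIc IcK).
have mXc : measurable_fun setT (fun w => h (Xc S w)).
  apply: (@measurableT_comp _ _ _ _ _ _ h); first exact: continuous_measurable_fun.
  by apply: (@measurableT_comp _ _ _ _ _ _ (truncate_to a b)); [exact: measurable_truncate_to|exact: mXt (ltW S0)].
have hL1 : L1 (fun w => h (Xc S w)).
  by apply: (integrable_rv_bounded P mXc (K := B)) => w; exact: hB.
exists (h x - E[fun w => h (Xc S w)]).
  apply: le_trans (ler_normB _ _) _; rewrite mulrDl mul1r lerD ?hB//.
  rewrite -[leRHS](expect_cst P); apply: expect_norm_le => //; first exact: integrable_rv_cst.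
  by apply: aeW => w; exact: hB.
have intLS (f : cumulative R R) (k : R) : (forall t, t < 0 -> f t = 0) ->
    (\int[lebesgue_stieltjes_measure f]_(s in `[0%R, S]) k%:E = (k * f S)%:E)%E.
  move=> fneg; transitivity (k%:E * lebesgue_stieltjes_measure f `[0%R, S])%E.
    exact: integral_cst.
  by rewrite lebesgue_stieltjes_itv0// ltW.
have inner w : (\int[leb]_(s in `[0%R, S]) (c (X s w))%:E
     + \int[lebesgue_stieltjes_measure (U w)]_(s in `[0%R, S]) qu%:E
     + \int[lebesgue_stieltjes_measure (D w)]_(s in `[0%R, S]) qd%:E =
   \int[leb]_(s in `[0%R, S]) (c (X s w))%:E + (L w)%:E)%E.
  by rewrite (intLS _ _ (Uneg w)) (intLS _ _ (Dneg w)) -addeA -EFinD.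
have cL1 : L1 (fun w => Ic w + L w) by exact: integrable_rvD.
have mL : measurable_fun setT L by exact: integrable_measurable LL.
(* Replacing [X] by [Xc] changes the running cost on a null set only and makes it bounded for every
   [w]. *)
have -> : expected_cost P c qu qd X U D S = (\int[P]_w (Ic w + L w)%:E)%E.
  rewrite /expected_cost; under eq_integral do rewrite inner.
  apply: ae_eq_integral => //.
  - apply: emeasurable_funD; last exact/measurable_EFinP.
    by apply: (measurable_fun_integral_param (f := fun r w => c (X r w)) (mcX S)).
  - by apply/measurable_EFinP; exact: measurable_funD.
  - have := RB; apply: filterS => w [Xab _ _ _ _] _; rewrite [RHS]EFinD; congr (_ + _)%E.
    rewrite /Ic /Rintegral fineK; last first.
      apply: integrable_fin_num => //.
      by apply: (integrable_itv_bounded (B := Kc) (msec w)) => r _; exact: cK.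
    apply: eq_integral => r; rewrite inE/= in_itv/= => /andP[r0 _].
    by rewrite /Xc truncate_to_id// Xab.
rewrite -(fineK (integrable_fin_num measurableT cL1))//; congr EFin.
rewrite -[LHS]/(E[fun w => Ic w + L w]) expectD// EL /Psi expectB//; last exact: integrable_rv_cst.
by rewrite expect_cst; ring.
Qed.

Lemma average_cost_cvg :
  ((T^-1)%:E * expected_cost P c qu qd X U D T)%E @[T --> +oo] --> C%:E.
Proof.
have [B B0 HB] := expected_cost_reflected.
have costE T : 0 < T -> exists2 r : R, `|r| <= B &
    ((T^-1)%:E * expected_cost P c qu qd X U D T)%E = (C + T^-1 * r)%:E.
  move=> T0; have [r rB ->] := HB T T0; exists r => //.
  rewrite -EFinM; congr EFin; rewrite mulrDr mulrCA mulVf ?mulr1// gt_eqF//.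
apply: cvg_EFin.
  near=> T; have T0 : 0 < T by near: T; exact: nbhs_pinfty_gt.
  by have [r _ ->] := costE T T0.
apply/cvgrPdist_le => /= e e0; near=> T.
have T0 : 0 < T by near: T; exact: nbhs_pinfty_gt.
have [r rB ->] := costE T T0; rewrite /= opprD addNKr normrN normrM gtr0_norm ?invr_gt0//.
rewrite mulrC ler_pdivrMr//; apply: le_trans rB _.
rewrite -ler_pdivrMl//; near: T; apply: nbhs_pinfty_ge; exact: num_real.
Unshelve. all: by end_near. Qed.

End average_cost.

Theorem lemma2p1 (R : realType) (mu sigma c : R -> R) (qu qd x0 : R)
  (mu_cont : continuous mu)
  (sigma_cont : continuous sigma)
  (sigma_ge0 : forall x, 0 <= sigma x)
  (sigma2_gt0 : forall x, 0 < sigma x ^+ 2)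
  (loc_int : locally_integrable setT (fun x => (1 + `|mu x|) / sigma x ^+ 2))
  (c_cont : continuous c)
  (c_min : forall x, c 0 <= c x)
  (c0_ge0 : 0 <= c 0)
  (qu_ge0 : 0 <= qu)
  (qd_ge0 : 0 <= qd)
  (pi1_unimodal : unimodal (pi1 mu c qd))
  (pi2_unimodal : unimodal (pi2 mu c qu))
  (pi1_infty : pi1 mu c qd x @[x --> +oo] --> +oo)
  (pi2_infty : pi2 mu c qu x @[x --> -oo] --> +oo) :
  (forall (d : measure_display) (Omega : measurableType d)
     (P : probability Omega R) (F : R -> set (set Omega))
     (W X : R -> Omega -> R) (U D : Omega -> cumulative R R) (a b x : R),
     a < b -> a <= x <= b ->
     complete_filtration P F ->
     brownian_motion P F W ->
     controlled_diffusion P F W mu sigma x X U D ->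
     reflecting_barrier P a b X U D ->
     ((T^-1)%:E * expected_cost P c qu qd X U D T)%E @[T --> +oo] -->
       (long_run_cost mu sigma c qu qd x0 a b)%:E)
  /\
  (forall a b : R, a < b ->
     (forall a' b' : R, a' < b' ->
        long_run_cost mu sigma c qu qd x0 a b <=
        long_run_cost mu sigma c qu qd x0 a' b') ->
     long_run_cost mu sigma c qu qd x0 a b = pi2 mu c qu a /\
     long_run_cost mu sigma c qu qd x0 a b = pi1 mu c qd b)
  /\
  (forall a b : R, a < b ->
     (long_run_cost mu sigma c qu qd x0 a b = pi2 mu c qu a /\
      long_run_cost mu sigma c qu qd x0 a b = pi1 mu c qd b)
     <->
     (\int[lebesgue_measure]_(t in `[a, b])
        ((pi1 mu c qd t - pi1 mu c qd b) * speed_density mu sigma x0 t)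
        + (qd + qu) / scale_density mu sigma x0 a = 0 /\
      \int[lebesgue_measure]_(t in `[a, b])
        ((pi2 mu c qu t - pi2 mu c qu a) * speed_density mu sigma x0 t)
        + (qd + qu) / scale_density mu sigma x0 b = 0)).
Proof.
have c_ge0 x : 0 <= c x by exact: le_trans c0_ge0 (c_min x).
split=> [d Omega P F W X U D a b x ab xab FP WP CD RB|].
  exact (average_cost_cvg mu_cont sigma_cont sigma2_gt0 c_cont c_ge0 qu_ge0 qd_ge0
    ab xab FP WP CD RB).
split=> a b ab; first exact: first_order_conditions.
exact: first_order_conditions_equiv.
Qed.
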